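(* Let $w_0\in H^1(0,1)$ and let $w$ be the solution of the closed-loop problem described in the context. Let $\alpha$ satisfy $$0\le\alpha\le\frac12\min\Big\{\frac{\nu}{\mu+1},\ \frac{\nu}{2\mu+\nu},\ \frac{\nu(1+c_i+w_d)}{\nu+(1+c_i+w_d)\mu}\ (i=0,1)\Big\}.$$ Then for all $t>0$ $$\|w(t)\|^2+\mu\|w_x(t)\|^2+\frac{\mu}{\nu}E_1(w)(t)+\beta e^{-2\alpha t}\int_0^t e^{2\alpha s}\Big(E_1(w)(s)+\|w_x(s)\|^2\Big)\,ds\le e^{-2\alpha t}\Big(\|w_0\|^2+\mu\|w_{0x}\|^2+\frac{\mu}{\nu}E_1(w)(0)\Big),$$ where $$\beta=\min\Big\{2\big(\nu-\alpha(\mu+1)\big),\ 1-2\alpha\frac{\mu}{\nu},\ (1+c_i+w_d)-2\alpha\Big((1+c_i+w_d)\frac{\mu}{\nu}+1\Big)\ (i=0,1)\Big\}$$ and $$E_1(w)(t)=\sum_{i=0}^{1}\Big((c_i+1+w_d)+\frac{1}{3c_i}w^2(i,t)\Big)w^2(i,t).$$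
   Context: Constants: $\mu>0$, $\nu>0$, $w_d\ge 0$, $c_0>0$, $c_1>0$. $\|\cdot\|$ and $(\cdot,\cdot)$ are the norm and inner product of $L^2(0,1)$; subscripts $x,t$ denote partial derivatives. Closed-loop problem: $w=w(x,t)$, $x\in(0,1)$, $t>0$, satisfies $$w_t-\mu w_{xxt}-\nu w_{xx}+(1+w_d)w_x+ww_x=0,\qquad w(x,0)=w_0(x),$$ with nonlinear Neumann boundary feedback laws $$w_x(0,t)=\frac1\nu\Big((c_0+1+w_d)w(0,t)+\frac{2}{9c_0}w^3(0,t)\Big),\qquad w_x(1,t)=-\frac1\nu\Big((c_1+1+w_d)w(1,t)+\frac{2}{9c_1}w^3(1,t)\Big).$$ It is understood in the weak sense: $w(t)\in H^1(0,1)$, $w_t\in L^2(L^2)$, $\mu w_t\in L^2(H^1)$, $w(\cdot,0)=w_0$, and for almost all $t>0$ and all $\chi\in H^1(0,1)$, $$(w_t,\chi)+\mu(w_{xt},\chi_x)+\nu(w_x,\chi_x)+(1+w_d)(w_x,\chi)+(ww_x,\chi)+\frac{\mu}{\nu}\sum_{i=0}^1\Big((c_i+1+w_d)w_t(i,t)+\frac{2}{3c_i}w^2(i,t)w_t(i,t)\Big)\chi(i)+\sum_{i=0}^1\Big((c_i+1+w_d)w(i,t)+\frac{2}{9c_i}w^3(i,t)\Big)\chi(i)=0.$$ Existence of such a solution is assumed. *)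

(* Defs.v *)
From HB Require Import structures.
From mathcomp Require Export all_boot all_order all_algebra.
From mathcomp Require Export all_classical all_reals all_analysis.
Export Order.TTheory GRing.Theory Num.Theory.
Export numFieldNormedType.Exports.

Set Implicit Arguments.
Unset Strict Implicit.
Unset Printing Implicit Defensive.

Local Open Scope classical_set_scope.
Local Open Scope ring_scope.

Section Sobolev.
Context {R : realType}.
Implicit Types (v g phi : R -> R).

Local Notation leb := (@lebesgue_measure R).

(* C_c^1 functions on ]a, b[.  The support is automatically compact, being
   closed and bounded. *)
Definition test_function (a b : R) phi : Prop :=
  [/\ forall x, derivable phi x 1,
      continuous (derive1 phi) &
      closure [set x | phi x != 0] `<=` `]a, b[ ].

(* g is the weak (distributional) derivative of v on ]a, b[. *)
Definition weak_deriv (a b : R) v g : Prop :=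
  forall phi, test_function a b phi ->
    \int[leb]_(x in `]a, b[) (v x * derive1 phi x) =
    - \int[leb]_(x in `]a, b[) (g x * phi x).

Definition L2 v : Prop := (v \_ `]0, 1[) \in Lfun leb 2%:E.

Definition ip v g : R := \int[leb]_(x in `]0, 1[) (v x * g x).

Definition L2norm v : R := Num.sqrt (ip v v).

(* An element of H^1(0,1) is represented by its representative that is
   continuous on [0, 1], so that v 0 and v 1 are its boundary traces. *)
Definition H1 v : Prop :=
  [/\ L2 v, {within `[0, 1], continuous v} &
      exists g, L2 g /\ weak_deriv 0 1 v g].

(* v_x for v in H^1(0,1): some L^2 weak derivative.  It is unique up to a null
   set, and is only ever used under an integral over ]0, 1[. *)
Definition wderiv v : R -> R :=
  xget (fun=> 0) [set g | L2 g /\ weak_deriv 0 1 v g].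

Definition H1norm v : R :=
  Num.sqrt (L2norm v ^+ 2 + L2norm (wderiv v) ^+ 2).

(* Functions of t and x are curried with time first: u t is the function
   x |-> u(x, t). *)

Definition simple_on (V : set (R -> R)) (D : set R) (s : R -> R -> R) : Prop :=
  [/\ finite_set (s @` D), s @` D `<=` V &
      forall v, measurable (D `&` s @^-1` [set v])].

Definition strongly_measurable (V : set (R -> R)) (N : (R -> R) -> R)
    (D : set R) (u : R -> R -> R) : Prop :=
  exists s : nat -> R -> R -> R,
    (forall n, simple_on V D (s n)) /\
    {ae leb, forall t, D t -> (fun n => N (s n t \- u t)) @ \oo --> (0 : R)}.

(* The Bochner space L^2(D; V), where N is the norm of V. *)
Definition bochner_L2 (V : set (R -> R)) (N : (R -> R) -> R)
    (D : set R) (u : R -> R -> R) : Prop :=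
  [/\ {ae leb, forall t, D t -> V (u t)},
      strongly_measurable V N D u &
      (\int[leb]_(t in D) ((N (u t) ^+ 2)%:E) < +oo)%E].

(* u = w_t as an L^2(0,1)-valued distribution on ]0, T[: the identity
   int w phi' dt = - int u phi dt of Bochner integrals in L^2(0,1), paired with
   an arbitrary chi in L^2(0,1). *)
Definition weak_time_deriv (T : R) (w u : R -> R -> R) : Prop :=
  forall chi, L2 chi ->
    weak_deriv 0 T (fun t => ip (w t) chi) (fun t => ip (u t) chi).

End Sobolev.

Section ClosedLoop.
Context {R : realType}.
Variables (mu nu wd : R) (c : 'I_2 -> R).

Local Notation leb := (@lebesgue_measure R).

(* The boundary point of index i : 'I_2 is i%:R, that is 0 or 1. *)

Definition weak_form (w wt chi : R -> R) : Prop :=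
  ip wt chi + mu * ip (wderiv wt) (wderiv chi)
  + nu * ip (wderiv w) (wderiv chi)
  + (1 + wd) * ip (wderiv w) chi
  + ip (fun x => w x * wderiv w x) chi
  + mu / nu * (\sum_(i < 2) ((c i + 1 + wd) * wt i%:R
                 + 2 / (3 * c i) * w i%:R ^+ 2 * wt i%:R) * chi i%:R)
  + \sum_(i < 2) ((c i + 1 + wd) * w i%:R
                 + 2 / (9 * c i) * w i%:R ^+ 3) * chi i%:R = 0.

(* As usual w is taken to be the representative that is continuous in time,
   which gives a meaning to w(t) for every t and to the initial condition;
   continuity into L^2(0,1) suffices to single it out.  The Bochner conditions
   are imposed on every bounded time interval. *)
Definition weak_solution (w0 : R -> R) (w : R -> R -> R) : Prop :=
  [/\ forall t : R, 0 <= t -> H1 (w t),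
      {in `[0, 1], w 0 =1 w0},
      forall t : R, 0 <= t ->
        L2norm (w s \- w t) @[s --> within `[0, +oo[ (nbhs t)] --> (0 : R) &
      exists wt : R -> R -> R,
        [/\ forall T : R, 0 < T -> weak_time_deriv T w wt,
            forall T : R, 0 < T -> bochner_L2 L2 L2norm `]0, T[ wt,
            forall T : R, 0 < T ->
              bochner_L2 H1 H1norm `]0, T[ (fun t x => mu * wt t x) &
            {ae leb, forall t : R, 0 < t ->
              forall chi, H1 chi -> weak_form (w t) (wt t) chi}]].

Definition E1 (v : R -> R) : R :=
  \sum_(i < 2) ((c i + 1 + wd) + 1 / (3 * c i) * v i%:R ^+ 2) * v i%:R ^+ 2.

Definition alpha_max : R :=
  1 / 2 * \big[Num.min/Num.min (nu / (mu + 1)) (nu / (2 * mu + nu))]_(i < 2)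
            (nu * (1 + c i + wd) / (nu + (1 + c i + wd) * mu)).

Definition beta (alpha : R) : R :=
  \big[Num.min/Num.min (2 * (nu - alpha * (mu + 1))) (1 - 2 * alpha * (mu / nu))]_(i < 2)
    ((1 + c i + wd) - 2 * alpha * ((1 + c i + wd) * (mu / nu) + 1)).

End ClosedLoop.

(* Main.v *)
(* Taking chi = w(t) in the weak form gives, formally, d/dt Phi(w) = - 2 D(w), where
   Phi(w) = |w|^2 + mu |w_x|^2 + (mu/nu) E_1(w) and D is the viscous plus boundary
   dissipation, the convection terms integrating to boundary values. Pointwise
   in time
     2 alpha Phi(w) + beta (E_1(w) + |w_x|^2) <= 2 D(w),
   by completing squares at both ends and a sharp Poincare inequality
   bounding |w|^2 - |w_x|^2 by a quadratic form in w(0), w(1). That form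
   couples the two ends, so the boundary terms cannot be estimated separately.

   Since w_t is only a distribution in time, Phi(w(t)) is never differentiated.
   Instead the increment of Phi(w) over [s, t] is bounded by
   - 2 (t - s) D(w(s)) + C (t - s) (K(t) - K(s)) with K nondecreasing; along
   partitions of vanishing mesh the second term drops out. *)

Require Import Defs.
From mathcomp Require Import measurable_realfun ring lra.

Set Implicit Arguments.
Unset Strict Implicit.
Unset Printing Implicit Defensive.

Local Open Scope classical_set_scope.
Local Open Scope ring_scope.

(** * The space L^2(0,1) *)

Section L2theory.
Context {R : realType}.
Local Notation leb := (@lebesgue_measure R).
Local Notation I01 := (`]0, 1[%classic : set R).
Implicit Types (u v f g : R -> R).

(** The increment bound comes from freezing z = w(s) as test function over all of [s, t]. The
    derivative of the energy at z is then a fixed functional of w, and its increment is bounded by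
    integrating an almost everywhere bound on its time derivative. Three errors arise: the weak form
    at time r is tested with w(s) instead of w(r), the nonlinear boundary coefficients are taken at
    s instead of r, and the energy has a second-order remainder. All are controlled by w(r) - w(s)
    in H^1, hence by the integral J of a majorant m of the H^1 norm of w_t; here the term mu w_xxt
    counts, since mu > 0 puts w_t in H^1. Cauchy-Schwarz bounds J^2 by (t - s) times the integral of
    m^2, so K combines the primitives of m and m^2. A second obstacle is measurability: pairings
    such as (w_t, chi) are not assumed measurable in time. They are only compared, under lower
    integrals, with measurable bounds, and the integrand of the conclusion gets its measurability
    from monotone functions. *)

Lemma L2P v : L2 v <-> measurable_fun I01 v /\
  leb.-integrable I01 (EFin \o (fun x => v x ^+ 2)).
Proof.
split.
  rewrite /L2 => Lv.
  have mv : measurable_fun setT (v \_ I01).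
    by move: (Lv) => /[!inE] /andP[/[!inE]].
  have mv' : measurable_fun I01 v by apply/(measurable_restrictT v).
  split => //.
  have := Lfun2_integrable_sqr Lv.
  have -> : EFin \o (fun x => (v \_ I01) x ^+ 2) = (EFin \o (fun x => v x ^+ 2)) \_ I01.
    by apply/funext => x; rewrite /patch/=; case: ifP => // _; rewrite expr0n.
  by move=> h; apply: (integrable_mkcond _ _).2.
move=> [mv iv].
rewrite /L2 inE; apply/andP; split; rewrite inE/=.
  by apply/(measurable_restrictT v).
rewrite /finite_norm unlock /Lnorm/= .
apply: poweR_lty.
have /integrableP[_] : leb.-integrable setT ((EFin \o (fun x => v x ^+ 2)) \_ I01).
  by apply: (integrable_mkcond _ _).1.
congr (_ < +oo)%E; apply: eq_integral => x _.
rewrite /patch/=; case: ifP => _ /=; last by rewrite !normr0 ?powR0.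
by rewrite ger0_norm ?sqr_ge0// powR_mulrn// real_normK// num_real.
Qed.

Lemma L2_measurable v : L2 v -> measurable_fun I01 v.
Proof. by move=> /L2P[]. Qed.

Lemma L2_integrable_sqr v : L2 v -> leb.-integrable I01 (EFin \o (fun x => v x ^+ 2)).
Proof. by move=> /L2P[]. Qed.

Lemma integrable_bounded (D : set R) (a b : R) v M : measurable D -> D `<=` `[a, b] ->
  measurable_fun D v -> (forall x, D x -> `|v x| <= M) ->
  leb.-integrable D (EFin \o v).
Proof.
move=> mD Dab mv vM; apply: measurable_bounded_integrable => //.
- rewrite (@le_lt_trans _ _ (leb `[a, b]))//; first by apply: le_measure => //; rewrite inE.
  by rewrite lebesgue_measure_itv/=; case: ifP => // _; rewrite -EFinB ltry.
- exists M; split; first exact: num_real.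
  by move=> y My x Dx; rewrite /= (le_trans (vM _ Dx))// ltW.
Qed.

Lemma integrable_mul_sqr (D : set R) u v : measurable D ->
  measurable_fun D u -> measurable_fun D v ->
  leb.-integrable D (EFin \o (fun x => u x ^+ 2)) ->
  leb.-integrable D (EFin \o (fun x => v x ^+ 2)) ->
  leb.-integrable D (EFin \o (fun x => u x * v x)).
Proof.
move=> mD mu mv iu iv.
have iuv : leb.-integrable D (fun x => (u x ^+ 2)%:E + (v x ^+ 2)%:E)%E.
  exact: integrableD.
apply: (le_integrable _ _ _ iuv) => //.
  by apply/measurable_EFinP; exact: measurable_funM.
move=> x Dx /=; rewrite lee_fin normrM [leRHS]ger0_norm ?addr_ge0 ?sqr_ge0//.
rewrite -(real_normK (num_real (u x))) -(real_normK (num_real (v x))).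
by move: (normr_ge0 (u x)) (normr_ge0 (v x)); nra.
Qed.

Lemma L2_integrable_mul u v : L2 u -> L2 v ->
  leb.-integrable I01 (EFin \o (fun x => u x * v x)).
Proof. by move=> /L2P[mu iu] /L2P[mv iv]; exact: integrable_mul_sqr. Qed.

Lemma L2_bounded v M : measurable_fun I01 v ->
  (forall x, I01 x -> `|v x| <= M) -> L2 v.
Proof.
move=> mv vM; apply/L2P; split => //.
apply: (@integrable_bounded _ 0 1 _ (M ^+ 2)) => //.
- exact: subset_itv_oo_cc.
- exact: measurable_funX.
move=> x Dx /=; rewrite ger0_norm ?sqr_ge0//.
by rewrite -(real_normK (num_real (v x))) lerXn2r ?nnegrE ?vM// (le_trans _ (vM _ Dx)).
Qed.

Lemma L2_cst a : L2 (fun _ : R => a).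
Proof. by apply: (@L2_bounded _ `|a|) => //; exact: measurable_cst. Qed.

Lemma L2D u v : L2 u -> L2 v -> L2 (u \+ v).
Proof.
move=> Lu Lv; have := L2_integrable_mul Lu Lv.
move: Lu Lv => /L2P[mu iu] /L2P[mv iv] iuv; apply/L2P; split.
  exact: measurable_funD.
apply: (@eq_integrable _ _ _ leb I01 _ (fun x => (u x ^+ 2)%:E + 2%:E * (u x * v x)%:E + (v x ^+
  2)%:E)%E) => //.
  by move=> x _ /=; rewrite -EFinM -!EFinD; congr EFin; ring.
by apply: integrableD => //; apply: integrableD => //; exact: integrableZl.
Qed.

Lemma L2Z a u : L2 u -> L2 (fun x => a * u x).
Proof.
move=> /L2P[mu iu]; apply/L2P; split.
  exact: measurable_funM.
apply: (@eq_integrable _ _ _ leb I01 _ (fun x => (a ^+ 2)%:E * (u x ^+ 2)%:E)%E) => //.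
  by move=> x _ /=; rewrite -EFinM exprMn.
exact: integrableZl.
Qed.

Lemma L2N u : L2 u -> L2 (\- u).
Proof.
move=> /(L2Z (-1)); congr L2; apply/funext => x /=; by rewrite mulN1r.
Qed.

Lemma L2B u v : L2 u -> L2 v -> L2 (u \- v).
Proof. by move=> Lu Lv; exact: (L2D Lu (L2N Lv)). Qed.

Lemma eq_L2 u v : {in I01, u =1 v} -> L2 u -> L2 v.
Proof.
move=> uv; rewrite /L2; suff -> : u \_ I01 = v \_ I01 by [].
by apply/funext => x; rewrite /patch; case: ifP => // /uv.
Qed.

Lemma eq_ip u u' v v' : {in I01, u =1 u'} -> {in I01, v =1 v'} -> ip u v = ip u' v'.
Proof. by move=> uu vv; apply: eq_Rintegral => x xI; rewrite uu ?vv. Qed.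

Lemma ipC u v : ip u v = ip v u.
Proof. by rewrite /ip; under eq_Rintegral do rewrite mulrC. Qed.

Lemma ipDl u v f : L2 u -> L2 v -> L2 f -> ip (u \+ v) f = ip u f + ip v f.
Proof.
move=> Lu Lv Lf; rewrite /ip -RintegralD//; [|exact: L2_integrable_mul|exact: L2_integrable_mul].
by apply: eq_Rintegral => x _ /=; rewrite mulrDl.
Qed.

Lemma ipZl a u f : L2 u -> L2 f -> ip (fun x => a * u x) f = a * ip u f.
Proof.
move=> Lu Lf; rewrite /ip -RintegralZl//; [|exact: L2_integrable_mul].
by apply: eq_Rintegral => x _ /=; rewrite mulrA.
Qed.

Lemma ipNl u f : L2 u -> L2 f -> ip (\- u) f = - ip u f.
Proof.
move=> Lu Lf; rewrite -mulN1r -ipZl//.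
by apply: eq_ip => x _ //=; rewrite mulN1r.
Qed.

Lemma ipBl u v f : L2 u -> L2 v -> L2 f -> ip (u \- v) f = ip u f - ip v f.
Proof. by move=> Lu Lv Lf; rewrite -ipNl// -ipDl//; exact: L2N. Qed.

Lemma ipDr u v f : L2 u -> L2 v -> L2 f -> ip f (u \+ v) = ip f u + ip f v.
Proof. by move=> Lu Lv Lf; rewrite ipC ipDl// !(ipC _ f). Qed.

Lemma ipBr u v f : L2 u -> L2 v -> L2 f -> ip f (u \- v) = ip f u - ip f v.
Proof. by move=> Lu Lv Lf; rewrite ipC ipBl// !(ipC _ f). Qed.

Lemma ipZr a u f : L2 u -> L2 f -> ip f (fun x => a * u x) = a * ip f u.
Proof. by move=> Lu Lf; rewrite ipC ipZl// ipC. Qed.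

Lemma ip_ge0 u : 0 <= ip u u.
Proof. by apply: Rintegral_ge0 => x _; rewrite -expr2 sqr_ge0. Qed.

Lemma L2norm_ge0 u : 0 <= L2norm u.
Proof. exact: sqrtr_ge0. Qed.

Lemma sqr_L2norm u : L2norm u ^+ 2 = ip u u.
Proof. by rewrite sqr_sqrtr ?ip_ge0. Qed.

Lemma ip_sqrD a u v : L2 u -> L2 v ->
  ip (fun x => u x + a * v x) (fun x => u x + a * v x) =
  ip u u + 2 * a * ip u v + a ^+ 2 * ip v v.
Proof.
move=> Lu Lv; have Lav := L2Z a Lv.
rewrite ipDl ?ipDr ?ipZl ?ipZr//; [|exact: L2D].
by rewrite (ipC v u); ring.
Qed.

(** Both Cauchy-Schwarz inequalities, for [ip] and for integrals over subintervals, come from this.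
    C = 0 has to be allowed, because a nonzero function may have zero norm. *)
Lemma sqr_le_discriminant (A B C : R) : 0 <= C ->
  (forall a, 0 <= A + 2 * a * B + a ^+ 2 * C) -> B ^+ 2 <= A * C.
Proof.
move=> C0 h; have [v0|v0] := eqVneq C 0.
  rewrite v0 mulr0; have [->|uv0] := eqVneq B 0; first by rewrite expr0n.
  (* At this point the affine function A + 2 a B equals -1. *)
  have := h (- (A + 1) / (2 * B)).
  rewrite v0 mulr0 addr0.
  have -> : A + 2 * (- (A + 1) / (2 * B)) * B = -1 by field.
  by rewrite oppr_ge0 ler10.
have v1 : 0 < C by rewrite lt_def v0.
have := h (- B / C).
have -> : A + 2 * (- B / C) * B + (- B / C) ^+ 2 * C = (A * C - B ^+ 2) / C by field.
by rewrite pmulr_lge0 ?invr_gt0// subr_ge0.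
Qed.

Lemma sqr_ip_le u v : L2 u -> L2 v -> ip u v ^+ 2 <= ip u u * ip v v.
Proof.
move=> Lu Lv; apply: sqr_le_discriminant => [|a]; first exact: ip_ge0.
by rewrite -ip_sqrD// ip_ge0.
Qed.

Lemma normr_ip_le u v : L2 u -> L2 v -> `|ip u v| <= L2norm u * L2norm v.
Proof.
move=> Lu Lv; rewrite -(ler_pXn2r (n:=2)) ?nnegrE ?mulr_ge0 ?L2norm_ge0//.
by rewrite exprMn !sqr_L2norm real_normK ?num_real ?sqr_ip_le.
Qed.

Lemma ip_le u v : L2 u -> L2 v -> ip u v <= L2norm u * L2norm v.
Proof. by move=> Lu Lv; rewrite (le_trans (ler_norm _))// normr_ip_le. Qed.

Lemma ler_L2normD u v : L2 u -> L2 v -> L2norm (u \+ v) <= L2norm u + L2norm v.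
Proof.
move=> Lu Lv; rewrite -(ler_pXn2r (n:=2)) ?nnegrE ?addr_ge0 ?L2norm_ge0//.
rewrite sqr_L2norm ipDl ?ipDr//; [|exact: L2D].
rewrite sqrrD !sqr_L2norm (ipC v u).
by have := ip_le Lu Lv; lra.
Qed.

Lemma L2normN u : L2norm (\- u) = L2norm u.
Proof.
by rewrite /L2norm /ip; congr Num.sqrt; apply: eq_Rintegral => x _ /=; rewrite mulrNN.
Qed.

Lemma L2normZ a u : L2 u -> L2norm (fun x => a * u x) = `|a| * L2norm u.
Proof.
move=> Lu; rewrite /L2norm ipZl ?ipZr//; last exact: L2Z.
by rewrite mulrA sqrtrM -?expr2 ?sqr_ge0// sqrtr_sqr.
Qed.

Lemma L2normB_sym u v : L2norm (u \- v) = L2norm (v \- u).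
Proof. by rewrite -L2normN; congr L2norm; apply/funext => x /=; rewrite opprB. Qed.

Lemma ler_L2norm_distD v u f : L2 u -> L2 v -> L2 f ->
  L2norm (u \- f) <= L2norm (u \- v) + L2norm (v \- f).
Proof.
move=> Lu Lv Lf; rewrite (le_trans _ (ler_L2normD _ _))//; [|exact: L2B|exact: L2B].
by rewrite le_eqVlt; apply/orP; left; apply/eqP; congr L2norm; apply/funext => x /=; ring.
Qed.

Lemma ler_dist_L2norm u v : L2 u -> L2 v -> `|L2norm u - L2norm v| <= L2norm (u \- v).
Proof.
have h f g : L2 f -> L2 g -> L2norm f - L2norm g <= L2norm (f \- g).
  move=> Lf Lg; rewrite lerBlDr (le_trans _ (ler_L2normD _ _))//; [|exact: L2B].
  by rewrite le_eqVlt; apply/orP; left; apply/eqP; congr L2norm; apply/funext => x /=; ring.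
by move=> Lu Lv; rewrite ler_norml h// andbT lerNl opprB (L2normB_sym u) h.
Qed.

Lemma sqr_L2normB (u v : R -> R) : L2 u -> L2 v ->
  L2norm (u \- v) ^+ 2 = ip u u - 2 * ip u v + ip v v.
Proof.
move=> Lu Lv; rewrite sqr_L2norm (ipBr Lu Lv (L2B Lu Lv)) (ipBl Lu Lv Lu) (ipBl Lu Lv Lv) (ipC v u).
by ring.
Qed.

End L2theory.

(** * Increments of functions with an integrable weak derivative *)

Section lebesgue_ae.
Context {R : realType}.
Local Notation leb := (@lebesgue_measure R).

Lemma leb_aeS (P Q : R -> Prop) : (forall x, P x -> Q x) ->
  {ae leb, forall x, P x} -> {ae leb, forall x, Q x}.
Proof.
move=> PQ [N [mN N0 PN]]; exists N; split=> // x /= nQ.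
by apply: PN => /= /PQ.
Qed.

Lemma leb_ae_and (P Q : R -> Prop) : {ae leb, forall x, P x} ->
  {ae leb, forall x, Q x} -> {ae leb, forall x, P x /\ Q x}.
Proof.
move=> hP hQ; apply: (negligibleS _ (negligibleU hP hQ)) => x /=.
by move=> nPQ; apply: contrapT => /not_orP[/contrapT nP /contrapT nQ]; exact: nPQ.
Qed.
End lebesgue_ae.

(** * Integrals of functions not known to be measurable *)

Section lower_integral.
Context {R : realType}.
Local Notation leb := (@lebesgue_measure R).
Local Open Scope ereal_scope.
Implicit Types (f g : R -> \bar R) (D : set R).

Lemma ge0_le_lower_integral D f g : (forall x, D x -> 0 <= f x) ->
  (forall x, D x -> f x <= g x) ->
  \int[leb]_(x in D) f x <= \int[leb]_(x in D) g x.
Proof.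
move=> f0 fg; rewrite !ge0_integralE//; last first.
  by move=> x Dx; rewrite (le_trans _ (fg x Dx))// f0.
apply: le_ereal_sup => _ [h hf <-]; exists h => //= x.
rewrite (le_trans (hf x))// /patch; case: ifPn => // /set_mem; exact: fg.
Qed.

(** Only [g], the measurable side, is altered on the null set, to +oo; this leaves its integral
    unchanged and makes the inequality hold everywhere. The next lemma does the same with the value
    0, [g] being there the smaller side. *)
Lemma ae_ge0_le_lower_integral D f g : measurable D -> measurable_fun D g ->
  (forall x, D x -> 0 <= f x) -> (forall x, D x -> 0 <= g x) ->
  {ae leb, forall x, D x -> f x <= g x} ->
  \int[leb]_(x in D) f x <= \int[leb]_(x in D) g x.
Proof.
move=> mD mg f0 g0 [N [mN N0 fgN]].
pose g' x := if x \in N then +oo else g x.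
have mg' : measurable_fun D g'.
  apply: measurable_fun_if => //.
  - by apply: (measurable_fun_bool true) => //; rewrite preimage_mem_true; exact: measurableI.
  - by apply: measurable_funS mg.
have -> : \int[leb]_(x in D) g x = \int[leb]_(x in D) g' x.
  apply: ge0_ae_eq_integral => //.
  - by move=> x Dx; rewrite /g'; case: ifP => // _; exact: g0.
  - exists N; split => // x /= /not_implyP[Dx]; rewrite /g'.
    by case: ifPn => // /set_mem.
apply: ge0_le_lower_integral => // x Dx; rewrite /g'; case: ifPn => [_|/negP xN].
  by rewrite leey.
by apply: contrapT => fg; apply: xN; apply/mem_set/fgN => /(_ Dx).
Qed.

Lemma ae_ge0_ge_lower_integral D f g : measurable D -> measurable_fun D g ->
  (forall x, D x -> 0 <= f x) -> (forall x, D x -> 0 <= g x) ->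
  {ae leb, forall x, D x -> g x <= f x} ->
  \int[leb]_(x in D) g x <= \int[leb]_(x in D) f x.
Proof.
move=> mD mg f0 g0 [N [mN N0 fgN]].
pose g' x := if x \in N then 0 else g x.
have mg' : measurable_fun D g'.
  apply: measurable_fun_if => //.
  - by apply: (measurable_fun_bool true) => //; rewrite preimage_mem_true; exact: measurableI.
  - by apply: measurable_funS mg.
have -> : \int[leb]_(x in D) g x = \int[leb]_(x in D) g' x.
  apply: ge0_ae_eq_integral => //.
  - by move=> x Dx; rewrite /g'; case: ifP => // _; exact: g0.
  - exists N; split => // x /= /not_implyP[Dx]; rewrite /g'.
    by case: ifPn => // /set_mem.
apply: ge0_le_lower_integral => x Dx; rewrite /g'; case: ifPn => [_|/negP xN] //.
- exact: g0.
- exact: f0.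
by apply: contrapT => fg; apply: xN; apply/mem_set/fgN => /(_ Dx).
Qed.

(* [h] need not be measurable: the library's integral of a nonnegative function
   is the supremum over simple functions below it, which is monotone. This is
   needed because measurability of [t |-> ip (w_t t) chi] is not a hypothesis. *)
Lemma le_lower_Rintegral_ae D (h e e' : R -> R) : measurable D ->
  leb.-integrable D (EFin \o e) -> leb.-integrable D (EFin \o e') ->
  {ae leb, forall x, D x -> (e' x <= h x <= e x)%R} ->
  (\int[leb]_(x in D) h x <= \int[leb]_(x in D) e x)%R.
Proof.
move=> mD ie ie' hee.
have me : measurable_fun D (EFin \o e) by exact: (measurable_int leb).
have me' : measurable_fun D (EFin \o e') by exact: (measurable_int leb).
have hp : \int[leb]_(x in D) ((EFin \o h) ^\+ x) <= \int[leb]_(x in D) ((EFin \o e) ^\+ x).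
  apply: ae_ge0_le_lower_integral => //; first exact: measurable_funepos.
  apply: leb_aeS hee => x hx Dx; have /andP[_ he] := hx Dx.
  by rewrite !unlock/= ge_max le_max /= lee_fin he/= le_max lexx orbT.
have hn : \int[leb]_(x in D) ((EFin \o e) ^\- x) <= \int[leb]_(x in D) ((EFin \o h) ^\- x).
  apply: ae_ge0_ge_lower_integral => //; first exact: measurable_funeneg.
  apply: leb_aeS hee => x hx Dx; have /andP[_ he] := hx Dx.
  by rewrite !unlock/= ge_max le_max /= lee_fin lerN2 he/= le_max lexx orbT.
(* [e'] provides finiteness: if the negative part of [h] had infinite integral, the real-valued
   integral of [h] would default to 0. *)
have hn' : \int[leb]_(x in D) ((EFin \o h) ^\- x) <= \int[leb]_(x in D) ((EFin \o e') ^\- x).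
  apply: ae_ge0_le_lower_integral => //; first exact: measurable_funeneg.
  apply: leb_aeS hee => x hx Dx; have /andP[he _] := hx Dx.
  by rewrite !unlock/= ge_max le_max /= lee_fin lerN2 he/= le_max lexx orbT.
have fep : \int[leb]_(x in D) ((EFin \o e) ^\+ x) \is a fin_num.
  by apply: integrable_pos_fin_num.
have fen : \int[leb]_(x in D) ((EFin \o e) ^\- x) \is a fin_num.
  by apply: integrable_neg_fin_num.
have fen' : \int[leb]_(x in D) ((EFin \o e') ^\- x) \is a fin_num.
  by apply: integrable_neg_fin_num.
have fhp : \int[leb]_(x in D) ((EFin \o h) ^\+ x) \is a fin_num.
  by rewrite ge0_fin_numE ?integral_ge0// (le_lt_trans hp)// ltey_eq fep.
have fhn : \int[leb]_(x in D) ((EFin \o h) ^\- x) \is a fin_num.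
  by rewrite ge0_fin_numE ?integral_ge0// (le_lt_trans hn')// ltey_eq fen'.
rewrite /Rintegral; rewrite integralE [in leRHS]integralE.
move: hp hn fhp fhn fep fen.
move: (\int[leb]_(x in D) _) (\int[leb]_(x in D) _) (\int[leb]_(x in D) _) (\int[leb]_(x in D) _).
by move=> [a| |] [b| |] [c| |] [d| |] //=; rewrite ?lee_fin => ? ? *; lra.
Qed.

End lower_integral.

(** * C^1 ramps and approximate identities *)

Section smooth_step.
Context {R : realType}.
Implicit Types x : R.

Definition sqrpos x : R := Num.max 0 x ^+ 2.

Lemma is_derive_sqrpos x : is_derive x 1 sqrpos (2 * Num.max 0 x).
Proof.
(* The candidate derivative is 2-Lipschitz, hence a remainder of at most h^2, also across the kink
   at 0. *)
have key h : `|sqrpos (h + x) - sqrpos x - 2 * Num.max 0 x * h| <= h ^+ 2.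
  rewrite /sqrpos; have [x0|x0] := leP x 0; have [hx|hx] := leP (h + x) 0;
    rewrite ?expr0n/=; rewrite ler_norml; apply/andP; split; nra.
have cvgq : h^-1 *: (sqrpos (h *: 1 + x) - sqrpos x) @[h --> 0^'] --> 2 * Num.max 0 x.
  apply/cvgrPdist_le => /= e e0; near=> h.
  have h0 : h != 0 by near: h; exact: nbhs_dnbhs_neq.
  have he : `|h| <= e by near: h; apply: dnbhs0_le.
  rewrite distrC (le_trans _ he)//.
  have -> : h^-1 *: (sqrpos (h *: 1 + x) - sqrpos x) - 2 * Num.max 0 x =
      h^-1 * (sqrpos (h + x) - sqrpos x - 2 * Num.max 0 x * h).
    by rewrite /GRing.scale/= mulr1; field.
  by rewrite normrM normfV ler_pdivrMl ?normr_gt0// -expr2 real_normK ?num_real.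
apply: DeriveDef; first by apply/cvg_ex; exists (2 * Num.max 0 x).
by apply/cvg_lim.
Unshelve. all: by end_near. Qed.

(** Test functions are only asked to be C^1, so a quadratic spline is enough: it rises from 0 at 0
    to 1 at 1, and its derivative [tent] is the hat on [0, 1] of height 2 and mass 1. *)
Definition smoothstep x : R :=
  2 * sqrpos x - 4 * sqrpos (x - 2^-1) + 2 * sqrpos (x - 1).

Definition tent x : R :=
  4 * Num.max 0 x - 8 * Num.max 0 (x - 2^-1) + 4 * Num.max 0 (x - 1).

Lemma smoothstep_le0 x : x <= 0 -> smoothstep x = 0.
Proof.
move=> x0; rewrite /smoothstep /sqrpos !max_l ?expr0n ?mulr0 ?subrr ?addr0//; lra.
Qed.

Lemma smoothstep_ge1 x : 1 <= x -> smoothstep x = 1.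
Proof. by move=> x1; rewrite /smoothstep /sqrpos !max_r; [field|lra|lra|lra]. Qed.

Lemma smoothstep_ge0 x : 0 <= smoothstep x.
Proof.
rewrite /smoothstep /sqrpos; have [x0|x0] := leP x 0; have [x2|x2] := leP (x - 2^-1) 0;
have [x1|x1] := leP (x - 1) 0; nra.
Qed.

Lemma smoothstep_le1 x : smoothstep x <= 1.
Proof.
rewrite /smoothstep /sqrpos; have [x0|x0] := leP x 0; have [x2|x2] := leP (x - 2^-1) 0;
have [x1|x1] := leP (x - 1) 0; nra.
Qed.

Lemma tent_ge0 x : 0 <= tent x.
Proof.
rewrite /tent; have [x0|x0] := leP x 0; have [x2|x2] := leP (x - 2^-1) 0;
have [x1|x1] := leP (x - 1) 0; lra.
Qed.

Lemma tent_le0 x : x <= 0 -> tent x = 0.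
Proof. by move=> x0; rewrite /tent !max_l ?mulr0 ?subrr ?addr0//; lra. Qed.

Lemma tent_ge1 x : 1 <= x -> tent x = 0.
Proof. by move=> x1; rewrite /tent !max_r; [field|lra|lra|lra]. Qed.

Lemma continuous_tent : continuous (tent : R -> R).
Proof.
have cmax (c : R) : continuous (fun x : R => Num.max 0 (x - c)).
  move=> x; apply: (@continuous_max R R (cst 0) (fun x => x - c)); first exact: cvg_cst.
  by apply: cvgB; [exact: cvg_id|exact: cvg_cst].
have c0 : continuous (fun x : R => Num.max 0 x).
  move=> x; apply: (@continuous_max R R (cst 0) id); first exact: cvg_cst.
  exact: cvg_id.
move=> x; rewrite /tent; apply: cvgD; first apply: cvgB.
- by apply: cvgM; [exact: cvg_cst|exact: c0].
- by apply: cvgM; [exact: cvg_cst|exact: cmax].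
- by apply: cvgM; [exact: cvg_cst|exact: cmax].
Qed.

Lemma is_derive1_affine (f : R -> R) (k c x d : R) : is_derive (k * (x - c)) 1 f d ->
  is_derive x 1 (fun x => f (k * (x - c))) (k * d).
Proof.
move=> fd.
have gk : is_derive x 1 (fun x => k * (x - c)) k.
  have : is_derive x 1 (k \*: (id - cst c)) (k *: (1 - 0)).
    exact: is_deriveZ.
  by rewrite subr0 /GRing.scale/= mulr1.
by have := @is_derive1_comp R f (fun x => k * (x - c)) x d k fd gk; rewrite mulrC.
Qed.

Lemma is_derive_smoothstep x : is_derive x 1 smoothstep (tent x).
Proof.
have h c : is_derive x 1 (fun x => sqrpos (x - c)) (2 * Num.max 0 (x - c)).
  have := @is_derive1_affine sqrpos 1 c x _ (is_derive_sqrpos _); rewrite !mul1r.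
  by congr (is_derive _ _ _ _); apply/funext => y; rewrite mul1r.
have : is_derive x 1
    (2 \*: sqrpos - 4 \*: (fun x => sqrpos (x - 2^-1)) + 2 \*: (fun x => sqrpos (x - 1)))
    (2 *: (2 * Num.max 0 x) - 4 *: (2 * Num.max 0 (x - 2^-1)) + 2 *: (2 * Num.max 0 (x - 1))).
  have h0 := is_derive_sqrpos x; have h2 := h 2^-1; have h1 := h 1.
  exact: is_deriveD.
by move/is_derive_eq; apply; rewrite /tent /GRing.scale/=; ring.
Qed.

Section step.
Variables (N : R) (N0 : 0 < N).

Lemma is_derive_step c x :
  is_derive x 1 (fun x => smoothstep (N * (x - c))) (N * tent (N * (x - c))).
Proof. exact/is_derive1_affine/is_derive_smoothstep. Qed.

Lemma continuous_tent_affine c : continuous (fun x : R => N * tent (N * (x - c))).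
Proof.
move=> x; apply: cvgM; first exact: cvg_cst.
apply: (@continuous_comp R R R (fun x => N * (x - c)) tent); last exact: continuous_tent.
by apply: cvgM; [exact: cvg_cst|apply: cvgB; [exact: cvg_id|exact: cvg_cst]].
Qed.

Local Notation leb := (@lebesgue_measure R).

Lemma tent_affine_ge0 c x : 0 <= N * tent (N * (x - c)).
Proof. by rewrite mulr_ge0 ?tent_ge0// ltW. Qed.

Lemma tent_affine_out c x : ~~ (c <= x <= c + N^-1) -> N * tent (N * (x - c)) = 0.
Proof.
rewrite negb_and -!ltNge => /orP[xc|xc].
  by rewrite tent_le0 ?mulr0// nmulr_lle0 ?subr_lt0// ltW.
rewrite tent_ge1 ?mulr0// -ler_pdivrMl// mulr1 lerBrDl; exact: ltW.
Qed.

Lemma integrable_continuous_oo (a b : R) (f : R -> R) :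
  {within `[a, b], continuous f} -> leb.-integrable `]a, b[ (EFin \o f).
Proof.
move=> cf; apply: (@integrableS _ _ _ leb `[a, b]) => //.
  exact: subset_itv_oo_cc.
by apply: continuous_compact_integrable => //; exact: segment_compact.
Qed.

Lemma Rintegral_oo_cc (a b : R) (f : R -> R) : leb.-integrable `]a, b[ (EFin \o f) ->
  \int[leb]_(x in `]a, b[) f x = \int[leb]_(x in `[a, b]) f x.
Proof.
move=> fi; by rewrite /Rintegral -(integral_itv_bndoo true false)//; exact: (measurable_int leb).
Qed.

Lemma Rintegral_tent (a b c : R) : a <= c -> c + N^-1 <= b ->
  \int[leb]_(x in `]a, b[) (N * tent (N * (x - c))) = 1.
Proof.
move=> ac cb.
have ab : a < b by rewrite (le_lt_trans ac)// (lt_le_trans _ cb)// ltrDl invr_gt0.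
rewrite Rintegral_oo_cc; last first.
  exact/integrable_continuous_oo/continuous_subspaceT/continuous_tent_affine.
rewrite /Rintegral (@continuous_FTC2 _ _ (fun x => smoothstep (N * (x - c))))//=.
- rewrite smoothstep_ge1 ?smoothstep_le0 ?subr0//.
    by rewrite pmulr_rle0// subr_le0.
  by rewrite -ler_pdivrMl// mulr1 lerBrDl.
- exact/continuous_subspaceT/continuous_tent_affine.
- have ds x := is_derive_step c x.
  have cs : continuous (fun x => smoothstep (N * (x - c))).
    by move=> x; apply: differentiable_continuous; apply/derivable1_diffP; exact: ex_derive.
  split.
  + by move=> x _; exact: ex_derive.
  + exact/cvg_at_right_filter/cs.
  + exact/cvg_at_left_filter/cs.
- by move=> x _; rewrite derive1E; have ds := is_derive_step c x; rewrite derive_val.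
Qed.

(** The rescaled tent is a probability density carried by [c, c + 1/N], so the integral is an
    average of values of [f] taken there. *)
Lemma Rintegral_tent_approx (a b c y e : R) f : a <= c -> c + N^-1 <= b ->
  {within `[a, b], continuous f} ->
  (forall x, c <= x <= c + N^-1 -> `|f x - y| <= e) ->
  `|\int[leb]_(x in `]a, b[) (f x * (N * tent (N * (x - c)))) - y| <= e.
Proof.
move=> ac cb cf fy; pose K x := N * tent (N * (x - c)).
have cK : {within `[a, b], continuous K}.
  exact/continuous_subspaceT/continuous_tent_affine.
have iK : leb.-integrable `]a, b[ (EFin \o K) by exact: integrable_continuous_oo.
have ifK : leb.-integrable `]a, b[ (EFin \o (fun x => f x * K x)).
  by apply: integrable_continuous_oo => x; apply: continuousM; [exact: cf|exact: cK].
have izK z : leb.-integrable `]a, b[ (EFin \o (fun x => z * K x)).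
  by apply: integrable_continuous_oo => x; apply: continuousM; [exact: cst_continuous|exact: cK].
have Kz z : \int[leb]_(x in `]a, b[) (z * K x) = z.
  by rewrite RintegralZl// Rintegral_tent// mulr1.
rewrite -{1}(Kz y) -RintegralB// -(Kz e).
have ifyK : leb.-integrable `]a, b[ (EFin \o (fun x => f x * K x - y * K x)).
  apply: integrable_continuous_oo => x.
  apply: cvgB; first by apply: continuousM; [exact: cf|exact: cK].
  by apply: continuousM; [exact: cst_continuous|exact: cK].
apply: (le_trans (le_normr_Rintegral _ ifyK)) => //.
apply: le_Rintegral => //.
  exact: integrable_norm ifyK.
move=> x _; rewrite -mulrBl normrM (ger0_norm (tent_affine_ge0 _ _)).
have [xc|xc] := boolP (c <= x <= c + N^-1).
  by rewrite ler_wpM2r ?tent_affine_ge0// fy.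
by rewrite /K tent_affine_out// !mulr0.
Qed.
End step.
End smooth_step.

(** * Cutoffs of an interval and increments from weak derivatives *)

Section bump.
Context {R : realType}.
Local Notation leb := (@lebesgue_measure R).
Implicit Types (a b s t x N : R).

Lemma integrable_measurable_fun (D : set R) (f : R -> R) :
  leb.-integrable D (EFin \o f) -> measurable_fun D f.
Proof. by move=> /measurable_int mf; apply/measurable_EFinP. Qed.

Lemma within_continuousM (A : set R) (f g : R -> R) : {within A, continuous f} ->
  {within A, continuous g} -> {within A, continuous (fun x => f x * g x)}.
Proof. by move=> cf cg x; apply: continuousM; [exact: cf|exact: cg]. Qed.

Lemma within_continuousD (A : set R) (f g : R -> R) : {within A, continuous f} ->
  {within A, continuous g} -> {within A, continuous (fun x => f x + g x)}.
Proof. by move=> cf cg x; apply: cvgD; [exact: cf|exact: cg]. Qed.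

(** A C^1 cutoff of ]s, t[ that rises on [s + 1/N, s + 2/N] and falls on [t - 2/N, t - 1/N]. The
    margin 1/N at both ends keeps the closed support inside the open interval, and the condition 4
    <= N (t - s) keeps the two ramps apart. *)
Definition bump s t N x : R :=
  smoothstep (N * (x - (s + N^-1))) - smoothstep (N * (x - (t - 2 * N^-1))).

Lemma is_derive_bump s t N x : 0 < N -> is_derive x 1 (bump s t N)
  (N * tent (N * (x - (s + N^-1))) - N * tent (N * (x - (t - 2 * N^-1)))).
Proof.
move=> N0; have h1 := is_derive_step N (s + N^-1) x.
have h2 := is_derive_step N (t - 2 * N^-1) x.
exact: is_deriveB.
Qed.

Lemma bump_left s t N x : 0 < N -> 4 <= N * (t - s) -> x <= s + N^-1 -> bump s t N x = 0.
Proof.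
move=> N0 Nst xs; have NN : N * N^-1 = 1 by rewrite mulfV ?gt_eqF.
by rewrite /bump !smoothstep_le0 ?subrr//; nra.
Qed.

Lemma bump_right s t N x : 0 < N -> 4 <= N * (t - s) -> t - N^-1 <= x -> bump s t N x = 0.
Proof.
move=> N0 Nst xs; have NN : N * N^-1 = 1 by rewrite mulfV ?gt_eqF.
by rewrite /bump !smoothstep_ge1 ?subrr//; nra.
Qed.

Lemma bump_mid s t N x : 0 < N -> s + 2 * N^-1 <= x <= t - 2 * N^-1 -> bump s t N x = 1.
Proof.
move=> N0 /andP[xs xt]; have NN : N * N^-1 = 1 by rewrite mulfV ?gt_eqF.
by rewrite /bump smoothstep_ge1 ?smoothstep_le0 ?subr0//; nra.
Qed.

Lemma normr_bump_le1 s t N x : `|bump s t N x| <= 1.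
Proof.
rewrite ler_norml; have := @smoothstep_ge0 R; have := @smoothstep_le1 R => h1 h0.
have := h1 (N * (x - (s + N^-1))); have := h1 (N * (x - (t - 2 * N^-1))).
have := h0 (N * (x - (s + N^-1))); have := h0 (N * (x - (t - 2 * N^-1))).
by rewrite /bump; lra.
Qed.

Lemma bump_ge0 s t N x : 0 < N -> 4 <= N * (t - s) -> 0 <= bump s t N x.
Proof.
move=> N0 Nst; have [xt|xt] := leP x (t - 2 * N^-1).
  rewrite /bump [X in _ - X]smoothstep_le0 ?subr0 ?smoothstep_ge0//.
  by rewrite pmulr_rle0// subr_le0.
have NN : N * N^-1 = 1 by rewrite mulfV ?gt_eqF.
by rewrite /bump smoothstep_ge1 ?subr_ge0 ?smoothstep_le1//; nra.
Qed.

Lemma derive1_bump s t N x : 0 < N -> derive1 (bump s t N) x =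
  N * tent (N * (x - (s + N^-1))) - N * tent (N * (x - (t - 2 * N^-1))).
Proof. by move=> N0; rewrite derive1E; have := is_derive_bump s t x N0; move=> H; rewrite
  derive_val. Qed.

Lemma continuous_bump s t N : 0 < N -> continuous (bump s t N).
Proof.
move=> N0 x; apply: differentiable_continuous; apply/derivable1_diffP.
by have H := is_derive_bump s t x N0; exact: ex_derive.
Qed.

Lemma test_function_bump a b s t N : 0 < N -> 4 <= N * (t - s) -> a <= s -> t <= b ->
  test_function a b (bump s t N).
Proof.
move=> N0 Nst as_ tb; split.
- by move=> x; have H := is_derive_bump s t x N0; exact: ex_derive.
- have -> : derive1 (bump s t N) =
      (fun x => N * tent (N * (x - (s + N^-1))) - N * tent (N * (x - (t - 2 * N^-1)))).
    by apply/funext => x; rewrite derive1_bump.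
  by move=> x; apply: cvgB; exact: continuous_tent_affine.
- have Ni : 0 < N^-1 by rewrite invr_gt0.
  apply: (@subset_trans _ `[s + N^-1, t - N^-1]); last first.
    by move=> x /=; rewrite !in_itv/= => /andP[? ?]; apply/andP; split; lra.
  have /closure_id -> : closed (`[s + N^-1, t - N^-1] : set R) by exact: itv_closed.
  apply: closure_subset => x /=; rewrite in_itv/= => bx; apply/andP; split.
  + by rewrite leNgt; apply: contra bx => /ltW /(bump_left N0 Nst) ->.
  + by rewrite leNgt; apply: contra bx => /ltW /(bump_right N0 Nst) ->.
Qed.

Lemma near_invS (d : R) : 0 < d -> \forall n \near \oo, n.+1%:R^-1 < d.
Proof.
by move=> d0; exact: (near_infty_natSinv_lt (PosNum d0)).
Qed.

Lemma near_scale (d : R) : 0 < d -> \forall n \near \oo, 4 <= n.+1%:R * d.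
Proof.
move=> d0; have d4 : 0 < d / 4 by rewrite divr_gt0.
near=> n; have : n.+1%:R^-1 < d / 4 by near: n; exact: near_invS.
rewrite invf_plt ?posrE// => h; rewrite -ler_pdivrMr// ltW// (le_lt_trans _ h)//.
by rewrite invf_div.
Unshelve. all: by end_near. Qed.

Lemma cvg_bump s t x : s < t -> bump s t n.+1%:R x @[n --> \oo] --> (\1_(`]s, t[%classic) x : R).
Proof.
(* For fixed x the sequence is eventually constant, with value 0 at both end points. *)
move=> st; apply: cvg_near_cst; rewrite indicE mem_setE in_itv/=.
have [xs|xs] := leP x s.
  near=> n; rewrite bump_left//; first by near: n; apply: near_scale; rewrite subr_gt0.
  by rewrite (le_trans xs)// lerDl.
have [xt|xt] := leP t x.
  near=> n; rewrite bump_right//; first by near: n; apply: near_scale; rewrite subr_gt0.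
  by rewrite (le_trans _ xt)// gerBl.
near=> n; rewrite bump_mid//; apply/andP; split.
  have : n.+1%:R^-1 < (x - s) / 2 by near: n; apply: near_invS; rewrite divr_gt0// subr_gt0.
  by move: (n.+1%:R^-1) => v; lra.
have : n.+1%:R^-1 < (t - x) / 2 by near: n; apply: near_invS; rewrite divr_gt0// subr_gt0.
by move: (n.+1%:R^-1) => v; lra.
Unshelve. all: by end_near. Qed.

Lemma integrable_mul_bump D e s t N : measurable D -> 0 < N ->
  leb.-integrable D (EFin \o e) ->
  leb.-integrable D (EFin \o (fun x => e x * bump s t N x)).
Proof.
move=> mD N0 ie; apply: (le_integrable _ _ _ ie) => //.
  apply/measurable_EFinP/measurable_funM.
    exact: integrable_measurable_fun.
  by apply: measurable_funTS; apply: continuous_measurable_fun; exact: continuous_bump.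
by move=> x Dx /=; rewrite lee_fin normrM ler_piMr// normr_bump_le1.
Qed.

Lemma Rintegral_bump_cvg a b s t e : a <= s -> s < t -> t <= b ->
  leb.-integrable `]a, b[ (EFin \o e) ->
  \int[leb]_(x in `]a, b[) (e x * bump s t n.+1%:R x) @[n --> \oo] -->
  \int[leb]_(x in `]s, t[) e x.
Proof.
move=> as_ st tb ie.
have sab : `]s, t[ `<=` (`]a, b[ : set R).
  by move=> x /=; rewrite !in_itv/= => /andP[? ?]; apply/andP; split; lra.
have [] := @dominated_convergence _ _ _ leb `]a, b[ _
  (fun n x => (e x * bump s t n.+1%:R x)%:E) (fun x => (e x * \1_(`]s, t[%classic) x)%:E)
  (fun x => `|e x|%:E) => //.
- by move=> n; apply: (measurable_int leb); apply: integrable_mul_bump.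
- apply/measurable_EFinP/measurable_funM; first exact: integrable_measurable_fun.
  exact: measurable_indic.
- apply: aeW => x _; apply: cvg_EFin; first exact: nearW.
  by apply: cvgM; [exact: cvg_cst|exact: cvg_bump].
- exact: integrable_norm ie.
- by apply: aeW => x n _; rewrite /= lee_fin normrM ler_piMr// normr_bump_le1.
move=> ie1 _ h.
have -> : \int[leb]_(x in `]s, t[) e x = \int[leb]_(x in `]a, b[) (e x * \1_(`]s, t[%classic) x).
  rewrite -[in LHS](setIidr sab) Rintegral_mkcondr; apply: eq_Rintegral => x _.
  by rewrite /patch indicE; case: ifP => _; rewrite ?mulr1 ?mulr0.
apply: fine_cvg.
rewrite fineK; first exact: h.
exact: integrable_fin_num.
Qed.

Lemma within_continuous_near (a b x e : R) (f : R -> R) : a <= x <= b -> 0 < e ->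
  {within `[a, b], continuous f} ->
  exists2 d, 0 < d & forall y, a <= y <= b -> `|y - x| < d -> `|f y - f x| <= e.
Proof.
move=> axb e0 cf.
have /subspace_continuousP/(_ x) := cf.
rewrite /= in_itv/= => /(_ axb)/cvgrPdist_le/(_ e e0).
rewrite near_withinE => /nbhs_ballP[d /= d0 h].
exists d => // y ayb yd; rewrite distrC; apply: h => //=.
by rewrite /ball/= distrC.
Qed.

(** Test with [bump s t N]: the two tents in its derivative average [f] near [s] and near [t], so
    one side of the identity tends to f s - f t. The other is minus the integral of g times the
    bump, where [g] may fail to be measurable; it is compared with [e] by [le_lower_Rintegral_ae],
    and dominated convergence removes the bump. *)
Lemma weak_deriv_increment_le a b f g e e' s t :
  {within `[a, b], continuous f} ->
  leb.-integrable `]a, b[ (EFin \o e) -> leb.-integrable `]a, b[ (EFin \o e') ->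
  {ae leb, forall x, `]s, t[%classic x -> e' x <= g x <= e x} ->
  weak_deriv a b f g -> a <= s -> s < t -> t <= b ->
  f t - f s <= \int[leb]_(x in `]s, t[) e x.
Proof.
move=> cf ie ie' ge wd as_ st tb.
apply/ler_addgt0Pr => eps eps0.
(* One third for each of the two averages of [f], one for the convergence of the integrals of [e]
   times the bump. *)
have e3 : 0 < eps / 3 by rewrite divr_gt0.
have asb : a <= s <= b by rewrite as_/= (le_trans (ltW st)).
have atb : a <= t <= b by rewrite tb andbT (le_trans _ (ltW st)).
have [d1 d10 fd1] := within_continuous_near asb e3 cf.
have [d2 d20 fd2] := within_continuous_near atb e3 cf.
have /cvgrPdist_le/(_ _ e3) cvgb := Rintegral_bump_cvg as_ st tb ie.
near \oo => n.
have N4 : 4 <= n.+1%:R * (t - s) by near: n; apply: near_scale; rewrite subr_gt0.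
have Nd1 : n.+1%:R^-1 < d1 / 2 by near: n; apply: near_invS; rewrite divr_gt0.
have Nd2 : n.+1%:R^-1 < d2 / 2 by near: n; apply: near_invS; rewrite divr_gt0.
have bn : `|\int[leb]_(x in `]s, t[) e x - \int[leb]_(x in `]a, b[) (e x * bump s t n.+1%:R x)|
  <= eps / 3.
  by near: n.
have N0 : 0 < n.+1%:R :> R by [].
move: n.+1%:R N0 N4 Nd1 Nd2 bn => N N0 N4 Nd1 Nd2 bn.
have Ni0 : 0 < N^-1 by rewrite invr_gt0.
have NN : N * N^-1 = 1 by rewrite mulfV ?gt_eqF.
have N4' : 4 * N^-1 <= t - s.
  by rewrite -(ler_pM2l N0) mulrCA NN mulr1.
have [as' sb' at' tb'] : [/\ a <= s + N^-1, s + N^-1 + N^-1 <= b,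
    a <= t - 2 * N^-1 & t - 2 * N^-1 + N^-1 <= b].
  by move: N^-1 Ni0 N4' => v; clear -as_ tb; move=> *; split; lra.
have near_s x : s + N^-1 <= x <= s + N^-1 + N^-1 -> a <= x <= b /\ `|x - s| < d1.
  move=> xs; have ? : 0 <= x - s by move: N^-1 Ni0 xs => v; clear; lra.
  rewrite ger0_norm//; split; first by clear -xs as' sb'; lra.
  by move: N^-1 Nd1 xs => v; clear; lra.
have near_t x : t - 2 * N^-1 <= x <= t - 2 * N^-1 + N^-1 -> a <= x <= b /\ `|x - t| < d2.
  move=> xt; have ? : x - t <= 0 by move: N^-1 Ni0 xt => v; clear; lra.
  rewrite ler0_norm//; split; first by clear -xt at' tb'; lra.
  by move: N^-1 Nd2 xt => v; clear; lra.
have wdN := wd _ (test_function_bump N0 N4 as_ tb).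
have ctN c : {within `[a, b], continuous (fun x => N * tent (N * (x - c)))}.
  exact/continuous_subspaceT/continuous_tent_affine.
have ifK c : leb.-integrable `]a, b[ (EFin \o (fun x => f x * (N * tent (N * (x - c))))).
  exact/integrable_continuous_oo/(within_continuousM cf)/ctN.
have Is : `|\int[leb]_(x in `]a, b[) (f x * (N * tent (N * (x - (s + N^-1))))) - f s| <= eps / 3.
  by apply: Rintegral_tent_approx => // x /near_s[]; exact: fd1.
have It : `|\int[leb]_(x in `]a, b[) (f x * (N * tent (N * (x - (t - 2 * N^-1))))) - f t| <= eps
  / 3.
  by apply: Rintegral_tent_approx => // x /near_t[]; exact: fd2.
have dE : \int[leb]_(x in `]a, b[) (f x * derive1 (bump s t N) x) =
    \int[leb]_(x in `]a, b[) (f x * (N * tent (N * (x - (s + N^-1))))) -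
    \int[leb]_(x in `]a, b[) (f x * (N * tent (N * (x - (t - 2 * N^-1))))).
  rewrite -RintegralB//; apply: eq_Rintegral => x _.
  by rewrite derive1_bump// mulrBr.
have gb : \int[leb]_(x in `]a, b[) (g x * bump s t N x) <= \int[leb]_(x in `]a, b[) (e x * bump s
  t N x).
  apply: (@le_lower_Rintegral_ae _ _ _ _ (fun x => e' x * bump s t N x)) => //.
  - exact: integrable_mul_bump.
  - exact: integrable_mul_bump.
  - apply: leb_aeS ge => x gx abx; have [stx|stx] := pselect (`]s, t[%classic x).
      by have /andP[g1 g2] := gx stx; rewrite !ler_wpM2r// bump_ge0.
    suff -> : bump s t N x = 0 by rewrite !mulr0 lexx.
    move/negP : stx; rewrite /= in_itv/= negb_and -!leNgt => /orP[xs|tx].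
      by rewrite bump_left// (le_trans xs)// lerDl ltW.
    by rewrite bump_right// (le_trans _ tx)// gerBl ltW.
move: bn Is It gb wdN; rewrite dE !ler_norml.
move: (Rintegral _ _ _) (Rintegral _ _ _) (Rintegral _ _ _) (Rintegral _ _ _) (Rintegral _ _ _).
clear; move=> I1 I2 I3 I4 I5; lra.
Unshelve. all: by end_near. Qed.

End bump.

(** * Density of test functions *)

Section test_functions.
Context {R : realType}.
Local Notation leb := (@lebesgue_measure R).
Local Notation I01 := (`]0, 1[%classic : set R).
Implicit Types (a b : R) (phi psi u v : R -> R).

Lemma test_function_derive a b phi (x : R) : test_function a b phi ->
  is_derive x 1 phi (derive1 phi x).
Proof. by move=> [dphi _ _]; rewrite derive1E; apply: DeriveDef. Qed.

Lemma test_function_continuous a b phi : test_function a b phi -> continuous phi.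
Proof.
move=> [dphi _ _] x; apply: differentiable_continuous; exact/derivable1_diffP.
Qed.

Lemma test_functionD a b phi psi : test_function a b phi -> test_function a b psi ->
  test_function a b (phi \+ psi).
Proof.
move=> tphi tpsi.
have d (x : R) : is_derive x 1 (phi \+ psi) (derive1 phi x + derive1 psi x).
  have h1 := test_function_derive x tphi; have h2 := test_function_derive x tpsi.
  exact: is_deriveD.
move: tphi tpsi => [_ cphi sphi] [_ cpsi spsi]; split.
- by move=> x; have h := d x; exact: ex_derive.
- have -> : derive1 (phi \+ psi) = derive1 phi \+ derive1 psi.
    by apply/funext => x; have h := d x; rewrite derive1E derive_val.
  by move=> x; apply: cvgD; [exact: cphi|exact: cpsi].
- apply: (@subset_trans _ (closure ([set x | phi x != 0] `|` [set x | psi x != 0]))).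
    apply: closure_subset => x /=; have [->|p0] := eqVneq (phi x) 0; last by left.
    by rewrite add0r; right.
  by rewrite closureU subUset.
Qed.

Lemma test_functionZ a b k phi : test_function a b phi ->
  test_function a b (fun x => k * phi x).
Proof.
move=> tphi.
have d (x : R) : is_derive x 1 (fun x => k * phi x) (k * derive1 phi x).
  have h1 := test_function_derive x tphi.
  have : is_derive x 1 (k \*: phi) (k *: derive1 phi x) by exact: is_deriveZ.
  exact.
move: tphi => [_ cphi sphi]; split.
- by move=> x; have h := d x; exact: ex_derive.
- have -> : derive1 (fun x => k * phi x) = fun x => k * derive1 phi x.
    by apply/funext => x; have h := d x; rewrite derive1E derive_val.
  by move=> x; apply: cvgM; [exact: cvg_cst|exact: cphi].
- apply: subset_trans sphi; apply: closure_subset => x /=.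
  by rewrite mulf_eq0 negb_or => /andP[].
Qed.

Lemma test_function0 a b : test_function a b (fun=> 0).
Proof.
split.
- by move=> x; exact: derivable_cst.
- have -> : derive1 (fun _ : R => 0 : R) = fun=> 0.
    by apply/funext => x; rewrite derive1E derive_cst.
  by move=> x; exact: cvg_cst.
- have -> : [set x : R | (0 : R) != 0] = set0 by apply/seteqP; split=> y //=; rewrite eqxx.
  by rewrite closure0; exact: sub0set.
Qed.

Lemma L2_continuous v : {within `[0, 1], continuous v} -> L2 v.
Proof.
move=> cv; apply/L2P; split.
  by apply: integrable_measurable_fun; apply: integrable_continuous_oo.
by apply: integrable_continuous_oo; exact: within_continuousM.
Qed.

Lemma L2_test phi : test_function 0 1 phi -> L2 phi.
Proof. by move=> /test_function_continuous cphi; apply: L2_continuous; exact: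
  continuous_subspaceT. Qed.

Lemma L2_derive1_test phi : test_function 0 1 phi -> L2 (derive1 phi).
Proof. by move=> [_ cphi _]; apply: L2_continuous; exact: continuous_subspaceT. Qed.

End test_functions.

Section L2_density.
Context {R : realType}.
Local Notation leb := (@lebesgue_measure R).
Local Notation I01 := (`]0, 1[%classic : set R).
Implicit Types (u v g h : R -> R).

Lemma L2_le v h : measurable_fun I01 v -> (forall x, I01 x -> `|v x| <= h x) -> L2 h -> L2 v.
Proof.
move=> mv vh /L2P[mh ih]; apply/L2P; split => //.
apply: (le_integrable _ _ _ ih) => //.
  by apply/measurable_EFinP; exact: measurable_funX.
move=> x Dx /=; rewrite lee_fin !ger0_norm ?sqr_ge0//.
by rewrite -(real_normK (num_real (v x))) lerXn2r ?nnegrE ?vh// (le_trans _ (vh _ Dx)).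
Qed.

Lemma L2_dominated_cvg (g_ : nat -> R -> R) g h :
  (forall n, measurable_fun I01 (g_ n)) -> measurable_fun I01 g ->
  (forall x, I01 x -> g_ n x @[n --> \oo] --> g x) ->
  (forall n x, I01 x -> `|g_ n x| <= h x) -> L2 h ->
  L2 g /\ L2norm (g \- g_ n) @[n --> \oo] --> 0.
Proof.
move=> mg_ mg cg gh Lh.
have ggh x : I01 x -> `|g x| <= h x.
  move=> Ix; have cn : `|g_ n x| @[n --> \oo] --> `|g x| by apply: cvg_norm; exact: cg.
  rewrite -(cvg_lim _ cn)//; apply: limr_le; first exact: cvgP cn.
  by apply: nearW => n; exact: gh.
have Lg : L2 g by exact: L2_le ggh Lh.
split => //.
have Lg_ n : L2 (g_ n) by apply: L2_le Lh => //; exact: gh.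
have L2h : L2 (fun x => 2 * h x) by exact: L2Z.
have [] := @dominated_convergence _ _ _ leb I01 _
  (fun n x => ((g x - g_ n x) ^+ 2)%:E) (fun=> 0%E)
  (fun x => ((2 * h x) ^+ 2)%:E) => //.
- move=> n; apply/measurable_EFinP; apply: measurable_funX.
  by apply: measurable_funB => //; exact: mg_.
- apply: aeW => x Ix; apply: cvg_EFin; first exact: nearW.
  have cB : g x - g_ n x @[n --> \oo] --> g x - g x.
    by apply: cvgB; [exact: cvg_cst|exact: cg].
  have cBB := cvgM cB cB; rewrite subrr mulr0 in cBB.
  by under eq_fun do rewrite /= expr2; exact: cBB.
- by have /L2P[_] := L2h.
- apply: aeW => x n Ix; rewrite /= lee_fin ger0_norm ?sqr_ge0//.
  rewrite -(real_normK (num_real (_ - _))) lerXn2r ?nnegrE//.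
    by rewrite mulr_ge0// (le_trans _ (ggh _ Ix)).
  by rewrite mulr_natl mulr2n (le_trans (ler_normB _ _))// lerD ?ggh ?gh.
move=> _ _; rewrite integral0 => /fine_cvgP[_ h0].
have -> : (fun n => L2norm (g \- g_ n)) = (fun n => Num.sqrt (\int[leb]_(x in I01) ((g x - g_ n
  x) ^+ 2))).
  by apply/funext => n; rewrite /L2norm /ip; under eq_Rintegral do rewrite /= -expr2.
rewrite -[X in _ --> X]sqrtr0; apply: (@cvg_comp _ _ _ _ Num.sqrt); first exact: h0.
exact: sqrt_continuous.
Qed.

(** The L^2 closure of the test functions, named as a set so that density follows from its stability
    under sums, multiples and limits. *)
Definition test_closure : set (R -> R) := [set v | L2 v /\
  forall d, 0 < d -> exists2 phi, test_function 0 1 phi & L2norm (v \- phi) <= d].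

Lemma test_closureD u v : test_closure u -> test_closure v -> test_closure (u \+ v).
Proof.
move=> [Lu du] [Lv dv]; split; first exact: L2D.
move=> d d0; have d2 : 0 < d / 2 by rewrite divr_gt0.
have [p tp up] := du _ d2; have [q tq vq] := dv _ d2.
exists (p \+ q); first exact: test_functionD.
have -> : (u \+ v) \- (p \+ q) = (u \- p) \+ (v \- q) by apply/funext => x /=; ring.
have Lp := L2_test tp; have Lq := L2_test tq.
rewrite (splitr d); apply: (le_trans (ler_L2normD _ _)); [exact: L2B|exact: L2B|exact: lerD].
Qed.

Lemma test_closureZ k u : test_closure u -> test_closure (fun x => k * u x).
Proof.
move=> [Lu du]; split; first exact: L2Z.
move=> d d0; have k0 : 0 < `|k| + 1 by rewrite ltr_wpDl.
have [p tp up] := du _ (divr_gt0 d0 k0).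
exists (fun x => k * p x); first exact: test_functionZ.
have -> : (fun x => k * u x) \- (fun x => k * p x) = (fun x => k * (u \- p) x).
  by apply/funext => x /=; ring.
have Lp := L2_test tp.
rewrite L2normZ; last exact: L2B.
rewrite (@le_trans _ _ (`|k| * (d / (`|k| + 1))))// ?ler_wpM2l//.
by rewrite mulrCA ler_piMr ?(ltW d0)// ler_pdivrMr// mul1r lerDl.
Qed.

Lemma test_closure0 : test_closure (fun=> 0).
Proof.
split=> [|d d0]; first exact: L2_cst.
exists (fun=> 0); first exact: test_function0.
rewrite (_ : _ \- _ = fun=> 0); last by apply/funext => x /=; rewrite subrr.
by rewrite /L2norm /ip; under eq_Rintegral do rewrite mulr0; rewrite /Rintegral integral0 sqrtr0
  ltW.
Qed.

Lemma test_closure_sum (I : Type) (r : seq I) (F : I -> R -> R) :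
  (forall i, test_closure (F i)) -> test_closure (fun x => \sum_(i <- r) F i x).
Proof.
move=> tF; elim: r => [|i r IH].
  by under eq_fun do rewrite big_nil; exact: test_closure0.
by under eq_fun do rewrite big_cons; exact: test_closureD.
Qed.

Lemma test_closure_lim (g_ : nat -> R -> R) g : L2 g ->
  (forall n, test_closure (g_ n)) -> L2norm (g \- g_ n) @[n --> \oo] --> 0 ->
  test_closure g.
Proof.
move=> Lg tg /cvgrPdist_le cg; split => // d d0.
have d2 : 0 < d / 2 by rewrite divr_gt0.
have [n _ /(_ n (leqnn n))] := cg _ d2.
rewrite /= sub0r normrN ger0_norm ?L2norm_ge0// => gn.
have [Lgn /(_ _ d2)[p tp up]] := tg n.
exists p => //; have Lp := L2_test tp.
by rewrite (le_trans (ler_L2norm_distD Lg Lgn Lp))// [leRHS]splitr lerD.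
Qed.

Lemma eq_test_closure u v : {in I01, u =1 v} -> test_closure u -> test_closure v.
Proof.
move=> uv [Lu du]; split; first exact: eq_L2 Lu.
move=> d /du[p tp up]; exists p => //; rewrite (le_trans _ up)//.
rewrite le_eqVlt; apply/orP; left; apply/eqP; rewrite /L2norm; congr Num.sqrt.
by apply: eq_ip => x xI /=; rewrite uv.
Qed.

Lemma test_closure_indic_oo (s t : R) : 0 <= s -> t <= 1 -> test_closure (\1_(`]s, t[%classic)).
Proof.
move=> s0 t1; have [st|ts] := ltP s t; last first.
  have -> : \1_(`]s, t[%classic) = (fun=> 0) :> (R -> R).
    by apply/funext => x; rewrite set_itv_ge ?indic0// -leNgt bnd_simp.
  exact: test_closure0.
(* The shift by n0 makes every term of the sequence, not only the late ones, a test function. *)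
have [n0 hn0] : exists n0, forall n, 4 <= (n + n0).+1%:R * (t - s).
  have [n0 _ hn] := near_scale (d := t - s) ltac:(by rewrite subr_gt0).
  by exists n0 => n; apply: hn => /=; rewrite leq_addl.
pose g_ n := bump s t (n + n0).+1%:R.
have [] := @L2_dominated_cvg g_ (\1_(`]s, t[%classic)) (fun=> 1).
- move=> n; apply: measurable_funTS; apply: continuous_measurable_fun.
  exact: continuous_bump.
- by apply: measurable_indic.
- move=> x _; rewrite (cvg_shiftn n0 (fun n => bump s t n.+1%:R x)).
  exact: cvg_bump.
- by move=> n x _; exact: normr_bump_le1.
- exact: L2_cst.
move=> Lg cg; apply: test_closure_lim cg => // n; split.
  by apply/L2_test/test_function_bump.
move=> d d0; exists (g_ n); first exact: test_function_bump.
rewrite (_ : _ \- _ = fun=> 0); last by apply/funext => x /=; rewrite subrr.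
by rewrite /L2norm /ip; under eq_Rintegral do rewrite mulr0; rewrite /Rintegral integral0 sqrtr0
  ltW.
Qed.

(** Dynkin's argument: the sets whose indicator lies in the closure form a lambda-system, and the
    rays ]x, +oo[ are stable under intersection and generate the Borel sets. Within ]0, 1[ a ray is
    an open interval, which bumps approximate. *)
Lemma test_closure_indic (E : set R) : measurable E -> test_closure (\1_E).
Proof.
pose H : set (set R) := [set A | measurable A /\ test_closure (\1_A)].
suff : (@RGenOInfty.G R).-sigma.-measurable `<=` H.
  rewrite -RGenOInfty.measurableE => mH mA.
  by have [] := mH E mA.
apply: (@lambda_system_subset _ _ _ setT) => //.
- move=> _ _ [x ->] [y ->]; exists (Num.max x y).
  apply/seteqP; split => z /=; rewrite !in_itv/= !andbT gt_max; first by case=> -> ->.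
  by move=> /andP[].
- split => //.
  + split; first exact: measurableT.
    apply: (@eq_test_closure (\1_(`]0, 1[%classic))); last exact: test_closure_indic_oo.
    by move=> x xI; rewrite !indicE in_setT xI.
  + move=> A B BA [mA tA] [mB tB]; split; first exact: measurableD.
    have := test_closureD tA (test_closureZ (-1) tB).
    congr test_closure; apply/funext => x /=; rewrite !indicE.
    rewrite in_setD; have [xB|xB] := boolP (x \in B) => /=.
      by rewrite (mem_set (BA _ (set_mem xB))) /=; lra.
    by rewrite andbT /=; lra.
  + move=> F ndF HF; have mF : measurable (\bigcup_i F i : set R).
      by apply: bigcupT_measurable => i; exact: (HF i).1.
    split => //.
    have [] := @L2_dominated_cvg (fun n => \1_(F n)) (\1_(\bigcup_i F i)) (fun=> 1).
    * by move=> n; apply: measurable_indic; exact: (HF n).1.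
    * exact: measurable_indic.
    * move=> x _; apply: cvg_near_cst; have [[n _ Fnx]|nF] := pselect ((\bigcup_i F i) x).
        exists n => // m /= nm; rewrite !indicE !mem_set//; first by exists n.
        by move/subsetPset : (ndF _ _ nm); exact.
      apply: nearW => n; rewrite !indicE !memNset// => Fnx; apply: nF; by exists n.
    * by move=> n x _; rewrite indicE ger0_norm// lern1 leq_b1.
    * exact: L2_cst.
    by move=> Lg cg; apply: test_closure_lim cg => // n; have [] := HF n.
- move=> _ [x ->]; split; first exact: measurable_itv.
  apply: (@eq_test_closure (\1_(`](Num.max x 0), 1[%classic))); last first.
    by apply: test_closure_indic_oo => //; rewrite le_max lexx orbT.
  move=> y; rewrite !indicE !inE /= !in_itv/= => /andP[y0 y1].
  by rewrite !mem_setE !in_itv/= gt_max y0 y1 !andbT.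
Qed.

Import HBNNSimple.

Lemma test_closure_ge0 v : L2 v -> (forall x, 0 <= v x) -> test_closure v.
Proof.
move=> Lv v0; have mI : measurable I01 by [].
have /measurable_EFinP mv : measurable_fun I01 v by exact: L2_measurable.
pose g_ n : R -> R := nnsfun_approx mI mv n.
have v0' x : I01 x -> (0 <= (EFin \o v) x)%E by rewrite /= lee_fin.
have [] := @L2_dominated_cvg g_ v v.
- by move=> n; apply: measurable_funTS; exact: measurable_funP.
- by apply/measurable_EFinP.
- by move=> x Ix; have := cvg_nnsfun_approx mI mv v0' Ix => /fine_cvgP[_].
- move=> n x Ix; rewrite ger0_norm; last by rewrite /g_; exact: fun_ge0.
  by have := le_approx n v0' Ix; rewrite -(nnsfun_approxE mI mv) lee_fin.
- exact: Lv.
move=> _ cg; apply: test_closure_lim cg => // n.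
have -> : g_ n = fun x => \sum_(y <- finmap.enum_fset (fset_set (range (g_ n)))) (y * \1_(g_ n
  @^-1` [set y]) x).
  by apply/funext => x; rewrite /g_ [LHS]fimfunE fsbig_finite.
apply: test_closure_sum => i; apply: test_closureZ; apply: test_closure_indic.
exact: measurable_funPTI.
Qed.

(** Density gives the uniqueness of weak derivatives, and it lets a pairing of a space derivative
    with an L^2 function be approximated by one that can be integrated by parts. *)
Theorem test_function_dense v : L2 v -> test_closure v.
Proof.
move=> Lv; have mv := L2_measurable Lv.
have L2abs : L2 (fun x => `|v x|).
  apply: (eq_L2 (u := fun x => `|v x|)) => //.
  have /L2P[_ iv] := Lv; apply/L2P; split; first exact: measurableT_comp.
  by under [X in EFin \o X]eq_fun do rewrite real_normK ?num_real//.
have mabs : measurable_fun I01 (fun x => `|v x|) by exact: L2_measurable.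
have t1 : test_closure (fun x => `|v x| + v x).
  apply: test_closure_ge0 => [|x]; first exact: L2D.
  by rewrite -lerBlDr sub0r -normrN ler_norm.
have t2 : test_closure (fun x => `|v x| - v x).
  apply: test_closure_ge0 => [|x]; first exact: L2B.
  by rewrite subr_ge0 ler_norm.
have := test_closureD (test_closureZ (2^-1) t1) (test_closureZ (- 2^-1) t2).
by congr test_closure; apply/funext => x /=; field.
Qed.

End L2_density.

(** * Primitives and H^1(0,1) *)

Section interval_integrals.
Context {R : realType}.
Local Notation leb := (@lebesgue_measure R).
Local Notation I01 := (`]0, 1[%classic : set R).
Implicit Types (f g u v : R -> R) (x y z : R).

Lemma Rintegral_oo_cst x y (c : R) : x <= y -> \int[leb]_(r in `]x, y[) c = c * (y - x).
Proof.
move=> xy; have yx : lebesgue_measure (`]x, y[%classic : set R) = (y - x)%:E.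
  rewrite lebesgue_measure_itv/= lte_fin; have [//|yx] := ltP x y.
  by rewrite (le_anti (introT andP (conj xy yx))) subrr.
by rewrite Rintegral_cst//; congr (_ * _); rewrite -[RHS]/(fine (y - x)%:E) -yx.
Qed.

Lemma integrable_oo_cst x y (c : R) : leb.-integrable `]x, y[ (EFin \o (fun=> c)).
Proof.
apply: (@integrable_bounded _ _ x y _ `|c|) => //; exact: subset_itv_oo_cc.
Qed.

Lemma Rintegral_oo_CS x y g : x <= y -> measurable_fun `]x, y[ g ->
  leb.-integrable `]x, y[ (EFin \o (fun r => g r ^+ 2)) ->
  (\int[leb]_(r in `]x, y[) g r) ^+ 2 <= (y - x) * \int[leb]_(r in `]x, y[) (g r ^+ 2).
Proof.
move=> xy mg ig2; apply: sqr_le_discriminant; first by apply: Rintegral_ge0 => r _; exact: sqr_ge0.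
have i1 c : leb.-integrable `]x, y[ (EFin \o (fun=> c)) by exact: integrable_oo_cst.
have ig : leb.-integrable `]x, y[ (EFin \o g).
  have : leb.-integrable `]x, y[ (EFin \o (fun r => g r * 1)).
    by apply: integrable_mul_sqr => //; under [X in EFin \o X]eq_fun do rewrite expr1n.
  by under [X in EFin \o X]eq_fun do rewrite mulr1.
move=> a.
have iag : leb.-integrable `]x, y[ (EFin \o (fun r => (2 * a) * g r)).
  exact: (@integrableZl _ _ _ leb _ _ (2 * a) (EFin \o g)).
have iag2 : leb.-integrable `]x, y[ (EFin \o (fun r => a ^+ 2 * g r ^+ 2)).
  exact: (@integrableZl _ _ _ leb _ _ (a ^+ 2) (EFin \o (fun r => g r ^+ 2))).
have -> : y - x = \int[leb]_(r in `]x, y[) 1 by rewrite Rintegral_oo_cst// mul1r.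
rewrite -RintegralZl// -RintegralZl// -RintegralD// -RintegralD//; last first.
  exact: (@integrableD _ _ _ leb _ _ (EFin \o (fun=> 1)) (EFin \o (fun r => (2 * a) * g r))).
apply: Rintegral_ge0 => r _.
by have := sqr_ge0 (1 + a * g r); nra.
Qed.

Lemma Rintegral_oo_split x y z g : x <= y -> y <= z -> leb.-integrable `]x, z[ (EFin \o g) ->
  \int[leb]_(r in `]x, z[) g r = \int[leb]_(r in `]x, y[) g r + \int[leb]_(r in `]y, z[) g r.
Proof.
move=> xy yz ig.
have [->|xy'] := eqVneq x y.
  by rewrite (@set_itv_ge _ _ (BRight y) (BLeft y)) ?Rintegral_set0 ?add0r// -leNgt bnd_simp.
have [<-|yz'] := eqVneq y z.
  by rewrite (@set_itv_ge _ _ (BRight y) (BLeft y)) ?Rintegral_set0 ?addr0// -leNgt bnd_simp.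
have -> : \int[leb]_(r in `]x, y[) g r = \int[leb]_(r in `]x, y]) g r.
  rewrite Rintegral_itv_bndo_bndc//; apply: integrableS ig => //.
  by apply: subset_itvl; rewrite bnd_simp.
rewrite -(Rintegral_itvB ig (x := y)); first by rewrite addrC subrK.
- by rewrite bnd_simp.
- by rewrite bnd_simp lt_neqAle yz'.
Qed.

(** On a uniform partition the step h factors out and the increments of [K] telescope: f b - f a <=
    h (K b - K a) for every h = (b - a) / (n + 1). *)
Lemma increment_le_by_partition (f K : R -> R) (a b : R) : a <= b ->
  (forall x y, a <= x -> x <= y -> y <= b -> f y - f x <= (y - x) * (K y - K x)) ->
  f b <= f a.
Proof.
move=> ab fK.
have key (n : nat) : f b - f a <= (b - a) / n.+1%:R * (K b - K a).
  pose h := (b - a) / n.+1%:R; have h0 : 0 <= h by rewrite divr_ge0// subr_ge0.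
  have hb : a + n.+1%:R * h = b by rewrite /h mulrC divfK// addrC subrK.
  suff H (i : nat) : (i <= n.+1)%N -> f (a + i%:R * h) - f a <= h * (K (a + i%:R * h) - K a).
    by have := H n.+1 (leqnn _); rewrite hb.
  elim: i => [|i IH] i_n; first by rewrite mul0r addr0 !subrr mulr0.
  have {}IH := IH (ltnW i_n).
  have /= := fK (a + i%:R * h) (a + i.+1%:R * h).
  have -> : a + i.+1%:R * h - (a + i%:R * h) = h by rewrite -natr1; ring.
  move=> /(_ _ _ _)/wrap[| | |].
  - by rewrite lerDl mulr_ge0.
  - by rewrite lerD2l ler_wpM2r// ler_nat.
  - by rewrite -[leRHS]hb lerD2l ler_wpM2r// ler_nat.
  by move: IH; move: (K _) (K _) (f _) (f _) => *; lra.
rewrite -subr_le0; apply/ler_addgt0Pr => e e0; rewrite add0r.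
pose M := `|(b - a) * (K b - K a)| + 1.
have M0 : 0 < M by rewrite ltr_wpDl.
have [n _ /(_ n (leqnn n)) hn] := near_invS (divr_gt0 e0 M0).
rewrite (le_trans (key n))// mulrAC.
rewrite (@le_trans _ _ (M * n.+1%:R^-1))//.
  by rewrite ler_wpM2r ?invr_ge0// (le_trans (ler_norm _))// lerDl.
by move: hn; rewrite /= ltr_pdivlMr// mulrC => /ltW.
Qed.

Lemma increment_eq_by_partition (f K : R -> R) (a b : R) : a <= b ->
  (forall x y, a <= x -> x <= y -> y <= b -> `|f y - f x| <= (y - x) * (K y - K x)) ->
  f b = f a.
Proof.
move=> ab fK; apply/le_anti/andP; split.
  apply: (@increment_le_by_partition f K) => // x y ax xy yb.
  exact: le_trans (ler_norm _) (fK _ _ ax xy yb).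
rewrite -lerN2; apply: (@increment_le_by_partition (\- f) K) => // x y ax xy yb.
rewrite /= (_ : - f y - - f x = - (f y - f x)); last by ring.
by apply: (le_trans (ler_norm _)); rewrite normrN fK.
Qed.

End interval_integrals.

Section primitives.
Context {R : realType}.
Local Notation leb := (@lebesgue_measure R).
Local Notation I01 := (`]0, 1[%classic : set R).
Implicit Types (f g u v h : R -> R) (x y z : R).

(** H^1(0,1) in integrated form: the fundamental theorem of calculus between any two points of
    [0, 1], end points included. Products, integration by parts and traces are obtained from it
    without differentiating at any point. *)
Definition is_primitive v g := [/\ measurable_fun I01 v, L2 g &
  forall x y, 0 <= x -> x <= y -> y <= 1 -> v y - v x = \int[leb]_(r in `]x, y[) g r].

Lemma subset_oo_01 x y : 0 <= x -> y <= 1 -> `]x, y[ `<=` I01.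
Proof.
move=> x0 y1 r /=; rewrite !in_itv/= => /andP[xr ry].
by rewrite (le_lt_trans x0)// (lt_le_trans ry).
Qed.

Lemma integrable_01_oo x y (f : R -> R) : 0 <= x -> y <= 1 ->
  leb.-integrable I01 (EFin \o f) -> leb.-integrable `]x, y[ (EFin \o f).
Proof. by move=> x0 y1; apply: integrableS => //; exact: subset_oo_01. Qed.

Lemma L2_integrable g : L2 g -> leb.-integrable I01 (EFin \o g).
Proof.
move=> Lg; have := L2_integrable_mul Lg (L2_cst 1).
by under [X in EFin \o X]eq_fun do rewrite mulr1.
Qed.

Lemma L2_oo_CS g x y : L2 g -> 0 <= x -> x <= y -> y <= 1 ->
  (\int[leb]_(r in `]x, y[) g r) ^+ 2 <= (y - x) * \int[leb]_(r in `]x, y[) (g r ^+ 2).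
Proof.
move=> Lg x0 xy y1; apply: Rintegral_oo_CS => //.
  by apply: measurable_funS (L2_measurable Lg) => //; exact: subset_oo_01.
by apply: integrable_01_oo => //; exact: L2_integrable_sqr.
Qed.

Lemma L2_normr v : L2 v -> L2 (fun x => `|v x|).
Proof.
move=> /L2P[mv iv]; apply/L2P; split; first exact: measurableT_comp.
by under [X in EFin \o X]eq_fun do rewrite real_normK ?num_real//.
Qed.

Lemma L2_bounded_mul M u g : measurable_fun I01 u -> (forall x, I01 x -> `|u x| <= M) ->
  L2 g -> L2 (fun x => u x * g x).
Proof.
move=> mu uM Lg; apply: (@L2_le _ _ (fun x => M * `|g x|)).
- by apply: measurable_funM => //; exact: L2_measurable.
- by move=> x Ix; rewrite normrM ler_wpM2r// uM.
- exact/L2Z/L2_normr.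
Qed.

Lemma Rintegral_oo_le_sub x y x' y' f : x <= x' -> x' <= y' -> y' <= y ->
  (forall r, 0 <= f r) -> leb.-integrable `]x, y[ (EFin \o f) ->
  \int[leb]_(r in `]x', y'[) f r <= \int[leb]_(r in `]x, y[) f r.
Proof.
move=> xx xy yy f0 fi.
rewrite (Rintegral_oo_split xx (le_trans xy yy) fi).
rewrite (Rintegral_oo_split xy yy); last first.
  by apply: integrableS fi => //; apply: subset_itvr; rewrite bnd_simp.
by rewrite addrCA lerDl addr_ge0 ?Rintegral_ge0.
Qed.

Lemma Rintegral_normr_oo_le x y g : L2 g -> 0 <= x -> x <= y -> y <= 1 ->
  \int[leb]_(r in `]x, y[) `|g r| <= L2norm g.
Proof.
move=> Lg x0 xy y1.
rewrite -(ler_pXn2r (n:=2)) ?nnegrE ?L2norm_ge0//; last by apply: Rintegral_ge0.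
rewrite (le_trans (L2_oo_CS (L2_normr Lg) x0 xy y1))//.
have i2 : leb.-integrable I01 (EFin \o (fun r => `|g r| ^+ 2)) by exact/L2_integrable_sqr/L2_normr.
rewrite sqr_L2norm (@le_trans _ _ (\int[leb]_(r in `]x, y[) (`|g r| ^+ 2)))//.
  by rewrite ler_piMl ?Rintegral_ge0//; lra.
rewrite (le_trans (Rintegral_oo_le_sub x0 xy y1 _ i2))//.
rewrite le_eqVlt; apply/orP; left; apply/eqP; apply: eq_Rintegral => r _.
by rewrite real_normK ?num_real// expr2.
Qed.

Lemma is_primitive_dist v g x y : is_primitive v g -> 0 <= x -> x <= y -> y <= 1 ->
  `|v y - v x| <= \int[leb]_(r in `]x, y[) `|g r|.
Proof.
move=> [mv Lg vg] x0 xy y1; rewrite vg//; apply: le_normr_Rintegral => //.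
by apply: integrable_01_oo => //; exact: L2_integrable.
Qed.

Lemma is_primitive_dist_le v g x y : is_primitive v g -> 0 <= x <= 1 -> 0 <= y <= 1 ->
  `|v y - v x| <= L2norm g.
Proof.
move=> vg; wlog xy : x y / x <= y.
  by move=> H x01 y01; have [/H|/ltW/H yx] := leP x y; [exact|rewrite distrC; exact: yx].
move=> /andP[x0 _] /andP[_ y1]; rewrite (le_trans (is_primitive_dist vg _ _ _))//.
by apply: Rintegral_normr_oo_le => //; case: vg.
Qed.

Lemma is_primitive_bounded v g x : is_primitive v g -> 0 <= x <= 1 ->
  `|v x| <= `|v 0| + L2norm g.
Proof.
move=> vg x01; rewrite -lerBlDl (le_trans (lerB_dist _ _))//.
by apply: is_primitive_dist_le x01; rewrite // lexx ler01.
Qed.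

Lemma is_primitive_L2 v g : is_primitive v g -> L2 v.
Proof.
move=> vg; have [mv Lg _] := vg; apply: (L2_bounded (M := `|v 0| + L2norm g)) => // x.
rewrite /= in_itv/= => /andP[x0 x1]; apply: is_primitive_bounded => //.
by rewrite !ltW.
Qed.

Lemma is_primitive_L2_mul v g f : is_primitive v g -> L2 f -> L2 (fun x => v x * f x).
Proof.
move=> vg Lf; have [mv Lg _] := vg; apply: (L2_bounded_mul (M := `|v 0| + L2norm g)) => // x.
rewrite /= in_itv/= => /andP[x0 x1]; apply: is_primitive_bounded => //.
by rewrite !ltW.
Qed.

Lemma is_primitive_cst (c : R) : is_primitive (fun=> c) (fun=> 0).
Proof.
split; [exact: measurable_cst|exact: L2_cst|move=> x y *].
by rewrite subrr Rintegral_oo_cst// mul0r.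
Qed.

Lemma is_primitive_id : is_primitive id (fun=> 1).
Proof.
split; [exact: measurable_id|exact: L2_cst|move=> x y *].
by rewrite Rintegral_oo_cst// mul1r.
Qed.

Lemma is_primitiveD u v g h : is_primitive u g -> is_primitive v h ->
  is_primitive (u \+ v) (g \+ h).
Proof.
move=> [mu Lg ug] [mv Lh vh]; split; [exact: measurable_funD|exact: L2D|move=> x y x0 xy y1].
rewrite RintegralD//; [|by apply: integrable_01_oo => //; exact: L2_integrable..].
by rewrite -ug// -vh//=; ring.
Qed.

(* Both factors oscillate by at most the integral of the modulus of their
   derivative, so that the error made over [x, y] is of order (y - x) times the
   increment of an integral and disappears under refinement. *)
Lemma is_primitiveM u v g h : is_primitive u g -> is_primitive v h ->
  is_primitive (fun x => u x * v x) (fun x => v x * g x + u x * h x).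
Proof.
move=> ug vh; have [mu Lg ugE] := ug; have [mv Lh vhE] := vh.
have Lvg : L2 (fun x => v x * g x) by exact: is_primitive_L2_mul vh Lg.
have Luh : L2 (fun x => u x * h x) by exact: is_primitive_L2_mul ug Lh.
have Lvu : L2 (fun x => v x * g x + u x * h x) by exact: L2D.
split => //; first exact: measurable_funM.
move=> a b a0 ab b1.
pose F x := u x * v x - \int[leb]_(r in `]0, x[) (v r * g r + u r * h r).
(* The error over [x, y] is at most 2 U V <= U^2 + V^2, and Cauchy-Schwarz bounds each square by y -
   x times an integral of g^2 or h^2; hence this [K]. *)
pose K x := \int[leb]_(r in `]0, x[) (g r ^+ 2) + \int[leb]_(r in `]0, x[) (h r ^+ 2).
have split_int (f : R -> R) x y : leb.-integrable I01 (EFin \o f) -> 0 <= x -> x <= y -> y <= 1 ->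
    \int[leb]_(r in `]0, y[) f r - \int[leb]_(r in `]0, x[) f r = \int[leb]_(r in `]x, y[) f r.
  move=> fi x0 xy y1; rewrite (Rintegral_oo_split x0 xy); last exact: integrable_01_oo.
  by rewrite addrC addKr.
suff : F b = F a.
  rewrite /F => /eqP; rewrite -subr_eq0 => /eqP FF.
  rewrite -(split_int _ _ _ (L2_integrable Lvu) a0 ab b1).
  by apply/eqP; rewrite -subr_eq0; apply/eqP; rewrite -[RHS]FF; ring.
apply: (@increment_eq_by_partition _ F K a b ab) => x y ax xy yb.
have x0 : 0 <= x by exact: le_trans ax.
have y1 : y <= 1 by exact: le_trans b1.
have iint f : L2 f -> leb.-integrable `]x, y[ (EFin \o f).
  by move=> Lf; apply: integrable_01_oo => //; exact: L2_integrable.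
pose U := \int[leb]_(r in `]x, y[) `|g r|; pose V := \int[leb]_(r in `]x, y[) `|h r|.
have U0 : 0 <= U by exact: Rintegral_ge0.
have V0 : 0 <= V by exact: Rintegral_ge0.
have KE : K y - K x = \int[leb]_(r in `]x, y[) (g r ^+ 2) + \int[leb]_(r in `]x, y[) (h r ^+ 2).
  rewrite -(split_int _ _ _ (L2_integrable_sqr Lg) x0 xy y1).
  by rewrite -(split_int _ _ _ (L2_integrable_sqr Lh) x0 xy y1) /K; ring.
have FE : F y - F x = \int[leb]_(r in `]x, y[) (g r * (v y - v r) + h r * (u x - u r)).
  have -> : F y - F x = (u y - u x) * v y + u x * (v y - v x) -
      \int[leb]_(r in `]x, y[) (v r * g r + u r * h r).
    by rewrite -(split_int _ _ _ (L2_integrable Lvu) x0 xy y1) /F; ring.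
  rewrite ugE// vhE//.
  rewrite -RintegralZr//; last exact: iint.
  rewrite -RintegralZl//; last exact: iint.
  have i1 : leb.-integrable `]x, y[ (EFin \o (fun r => g r * v y)).
    by under [X in EFin \o X]eq_fun do rewrite mulrC; exact/iint/L2Z.
  have i2 : leb.-integrable `]x, y[ (EFin \o (fun r => u x * h r)) by exact/iint/L2Z.
  rewrite -RintegralD// -RintegralB//.
  - by apply: eq_Rintegral => r _; ring.
  - have : L2 ((fun r => v y * g r) \+ (fun r => u x * h r)) by apply: L2D; exact: L2Z.
    by under eq_fun do rewrite [v y * _]mulrC; exact: iint.
  - exact: iint.
rewrite FE KE.
have Lm : L2 (fun r => g r * (v y - v r) + h r * (u x - u r)).
  have : L2 ((fun r => v y * g r + u x * h r) \- (fun x => v x * g x + u x * h x)).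
    by apply: L2B => //; apply: (@L2D _ (fun r => v y * g r) (fun r => u x * h r)); exact: L2Z.
  by apply: eq_L2 => r _ /=; ring.
rewrite (le_trans (le_normr_Rintegral _ (iint _ Lm)))//.
rewrite (@le_trans _ _ (V * U + U * V))//.
  rewrite /U /V -!RintegralZl//; [|exact/iint/L2_normr|exact/iint/L2_normr].
  rewrite -RintegralD//; [|exact/iint/L2Z/L2_normr|exact/iint/L2Z/L2_normr].
  apply: le_Rintegral => //; [exact/iint/L2_normr| |move=> r].
    exact: (iint _ (L2D (L2Z _ (L2_normr Lg)) (L2Z _ (L2_normr Lh)))).
  rewrite /= in_itv/= => /andP[xr ry].
  rewrite (le_trans (ler_normD _ _))// !normrM mulrC lerD//.
    rewrite ler_wpM2r// (le_trans (is_primitive_dist vh _ (ltW ry) _))//; first by rewrite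
      (le_trans x0)// ltW.
    by apply: Rintegral_oo_le_sub => //; [exact: ltW|exact: ltW|exact/iint/L2_normr].
  rewrite mulrC ler_wpM2r// distrC (le_trans (is_primitive_dist ug _ (ltW xr) _))//; first by
    rewrite (le_trans _ y1)// ltW.
  by apply: Rintegral_oo_le_sub => //; [exact: ltW|exact: ltW|exact/iint/L2_normr].
have CSg := L2_oo_CS (L2_normr Lg) x0 xy y1.
have CSh := L2_oo_CS (L2_normr Lh) x0 xy y1.
rewrite -/U in CSg; rewrite -/V in CSh.
have absE (f : R -> R) : \int[leb]_(r in `]x, y[) (`|f r| ^+ 2) = \int[leb]_(r in `]x, y[) (f r
  ^+ 2).
  by apply: eq_Rintegral => r _; rewrite real_normK ?num_real.
rewrite !absE in CSg CSh.
by have := sqr_ge0 (U - V); rewrite mulrDr; nra.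
Qed.

Lemma is_primitive_ip u v g h : is_primitive u g -> is_primitive v h ->
  ip g v + ip u h = u 1 * v 1 - u 0 * v 0.
Proof.
move=> ug vh; have [_ _ ->//] := is_primitiveM ug vh.
have [mu Lg _] := ug; have [mv Lh _] := vh.
have Lu := is_primitive_L2 ug; have Lv := is_primitive_L2 vh.
rewrite RintegralD//; [|exact: L2_integrable_mul|exact: L2_integrable_mul].
by congr (_ + _); apply: eq_Rintegral => x _; rewrite mulrC.
Qed.

(** Integration by parts against x - 1, which vanishes at 1. Time derivatives are only known through
    L^2 pairings, so traces have to be written as such pairings before they can be followed in
    time. *)
Lemma trace0 v g : is_primitive v g -> v 0 = ip v (fun=> 1) + ip g (fun x => x - 1).
Proof.
move=> vg; have pk : is_primitive (fun x => x - 1) (fun x => 1 + 0).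
  exact: (is_primitiveD is_primitive_id (is_primitive_cst (- 1))).
have := is_primitive_ip vg pk; rewrite addr0 subrr mulr0 !sub0r mulrN1 opprK addrC.
by move=> <-.
Qed.

Lemma trace1 v g : is_primitive v g -> v 1 = ip v (fun=> 1) + ip g id.
Proof.
move=> vg; have := is_primitive_ip vg is_primitive_id.
by rewrite mulr1 mulr0 subr0 addrC => <-.
Qed.

End primitives.

(** * Weak derivatives and H^1(0,1) *)

Section H1theory.
Context {R : realType}.
Local Notation leb := (@lebesgue_measure R).
Local Notation I01 := (`]0, 1[%classic : set R).
Implicit Types (f g u v h phi : R -> R) (x y z : R).

Lemma L2norm_eq0_ip g f : L2 g -> L2 f -> L2norm g = 0 -> ip g f = 0.
Proof.
move=> Lg Lf g0; apply/eqP; rewrite -normr_le0.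
by rewrite (le_trans (normr_ip_le Lg Lf))// g0 mul0r.
Qed.

Lemma L2norm_dist0_ip g h f : L2 g -> L2 h -> L2 f -> L2norm (g \- h) = 0 -> ip g f = ip h f.
Proof.
move=> Lg Lh Lf gh; apply/eqP; rewrite -subr_eq0 -ipBl//.
by rewrite L2norm_eq0_ip//; exact: L2B.
Qed.

Lemma L2norm_dist0 g h : L2 g -> L2 h -> L2norm (g \- h) = 0 -> L2norm g = L2norm h.
Proof.
move=> Lg Lh gh; apply/eqP; rewrite -subr_eq0 -normr_le0.
by rewrite -gh ler_dist_L2norm.
Qed.

(** g - h is orthogonal to every test function p; choosing p within d of g - h itself gives |g -
    h|^2 = (g - h, g - h - p) <= d |g - h|. *)
Lemma weak_deriv_unique v g h : L2 g -> L2 h -> weak_deriv 0 1 v g -> weak_deriv 0 1 v h ->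
  L2norm (g \- h) = 0.
Proof.
move=> Lg Lh vg vh; have Lgh := L2B Lg Lh.
apply/le_anti; rewrite L2norm_ge0 andbT; apply/ler_addgt0Pr => d d0; rewrite add0r.
have [->|gh0] := eqVneq (L2norm (g \- h)) 0; first exact: ltW.
have gh1 : 0 < L2norm (g \- h) by rewrite lt_def gh0 L2norm_ge0.
have [_ /(_ _ d0)[p tp pd]] := test_function_dense Lgh.
have Lp := L2_test tp.
have ghp : ip (g \- h) p = 0.
  rewrite ipBl//; have := vg _ tp; rewrite (vh _ tp) => /eqP; rewrite eqr_opp => /eqP.
  by rewrite /ip => ->; rewrite subrr.
rewrite -(ler_pM2l gh1) -expr2 sqr_L2norm.
have -> : ip (g \- h) (g \- h) = ip (g \- h) ((g \- h) \- p).
  by rewrite [RHS]ipBr// ghp subr0.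
by rewrite (le_trans (ip_le _ _))// ?ler_wpM2l ?L2norm_ge0//; exact: L2B.
Qed.

Lemma H1_L2 v : H1 v -> L2 v.
Proof. by case. Qed.

Lemma H1_wderiv v : H1 v -> L2 (wderiv v) /\ weak_deriv 0 1 v (wderiv v).
Proof. by move=> [_ _ vg]; exact: (xgetPex (fun=> 0) vg). Qed.

Lemma H1_L2_wderiv v : H1 v -> L2 (wderiv v).
Proof. by move=> /H1_wderiv[]. Qed.

Lemma weak_deriv_lin a u v g h : L2 u -> L2 v -> L2 g -> L2 h ->
  weak_deriv 0 1 u g -> weak_deriv 0 1 v h ->
  weak_deriv 0 1 (fun x => a * u x + v x) (fun x => a * g x + h x).
Proof.
move=> Lu Lv Lg Lh ug vh p tp; have Lp := L2_test tp; have Ldp := L2_derive1_test tp.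
rewrite -/(ip (fun x => a * u x + v x) _) -/(ip (fun x => a * g x + h x) p).
have -> : ip (fun x => a * u x + v x) (derive1 p) = a * ip u (derive1 p) + ip v (derive1 p).
  by rewrite -ipZl// -ipDl//; exact: L2Z.
have -> : ip (fun x => a * g x + h x) p = a * ip g p + ip h p.
  by rewrite -ipZl// -ipDl//; exact: L2Z.
by have := ug _ tp; have := vh _ tp; rewrite /ip => -> ->; ring.
Qed.

Lemma H1_lin a u v : H1 u -> H1 v -> H1 (fun x => a * u x + v x).
Proof.
move=> Hu Hv; have [Lu cu _] := Hu; have [Lv cv _] := Hv; split.
- exact: (L2D (L2Z a Lu) Lv).
- apply: within_continuousD => //; apply: within_continuousM => //.
  by move=> x; exact: cst_continuous.
have [Lg ug] := H1_wderiv Hu; have [Lh vh] := H1_wderiv Hv.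
exists (fun x => a * wderiv u x + wderiv v x); split; first exact: (L2D (L2Z a Lg) Lh).
exact: weak_deriv_lin.
Qed.

(** [wderiv] chooses a representative, so linearity is stated up to a function of zero norm;
    [L2norm_dist0] and [L2norm_dist0_ip] carry it over to norms and pairings. *)
Lemma wderiv_lin a u v : H1 u -> H1 v ->
  L2norm (wderiv (fun x => a * u x + v x) \- (fun x => a * wderiv u x + wderiv v x)) = 0.
Proof.
move=> Hu Hv; have [Lg ug] := H1_wderiv Hu; have [Lh vh] := H1_wderiv Hv.
have [Lw ww] := H1_wderiv (H1_lin a Hu Hv).
apply: weak_deriv_unique ww _ => //; first exact: (L2D (L2Z a Lg) Lh).
by apply: weak_deriv_lin => //; exact: H1_L2.
Qed.

Lemma weak_deriv0 : weak_deriv 0 1 (fun _ : R => 0) (fun=> 0).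
Proof.
move=> p _; under eq_Rintegral do rewrite mul0r.
by under [in RHS]eq_Rintegral do rewrite mul0r; rewrite /Rintegral integral0 oppr0.
Qed.

Lemma H1_cst0 : H1 (fun _ : R => 0).
Proof.
split; [exact: L2_cst|by move=> x; exact: cst_continuous|exists (fun=> 0); split].
  exact: L2_cst.
exact: weak_deriv0.
Qed.

Lemma H1Z a u : H1 u -> H1 (fun x => a * u x).
Proof.
by move=> Hu; have := H1_lin a Hu H1_cst0; under eq_fun do rewrite addr0.
Qed.

Lemma H1B u v : H1 u -> H1 v -> H1 (u \- v).
Proof.
move=> Hu Hv; have := H1_lin (-1) Hv Hu.
by congr H1; apply/funext => x /=; ring.
Qed.

Lemma wderivB u v : H1 u -> H1 v -> L2norm (wderiv (u \- v) \- (wderiv u \- wderiv v)) = 0.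
Proof.
move=> Hu Hv; have := wderiv_lin (-1) Hv Hu.
rewrite (_ : (fun x => -1 * v x + u x) = u \- v); last by apply/funext => x /=; ring.
by rewrite (_ : (fun x => -1 * wderiv v x + wderiv u x) = wderiv u \- wderiv v)//;
  apply/funext => x /=; ring.
Qed.

Lemma wderivZ a u : H1 u -> L2norm (wderiv (fun x => a * u x) \- (fun x => a * wderiv u x)) = 0.
Proof.
move=> Hu; have [Lu ug] := H1_wderiv Hu; have [Law aug] := H1_wderiv (H1Z a Hu).
apply: weak_deriv_unique aug _ => //; first exact: L2Z.
have := weak_deriv_lin a (H1_L2 Hu) (L2_cst 0) Lu (L2_cst 0) ug weak_deriv0.
by congr (weak_deriv _ _ _ _); apply/funext => x; rewrite addr0.
Qed.

Lemma L2norm_wderivZ a u : H1 u -> L2norm (wderiv (fun x => a * u x)) = `|a| * L2norm (wderiv u).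
Proof.
move=> Hu; have Lu := H1_L2_wderiv Hu; rewrite -L2normZ//.
apply: L2norm_dist0; last exact: wderivZ.
- exact/H1_L2_wderiv/H1Z.
- exact: L2Z.
Qed.

Lemma ip_wderivB u v f : H1 u -> H1 v -> L2 f ->
  ip (wderiv (u \- v)) f = ip (wderiv u) f - ip (wderiv v) f.
Proof.
move=> Hu Hv Lf; have Lu := H1_L2_wderiv Hu; have Lv := H1_L2_wderiv Hv.
rewrite -ipBl//.
by apply: (L2norm_dist0_ip (H1_L2_wderiv (H1B Hu Hv)) (L2B Lu Lv) Lf); exact: wderivB.
Qed.

Lemma L2norm_wderivB u v : H1 u -> H1 v -> L2norm (wderiv (u \- v)) = L2norm (wderiv u \- wderiv v).
Proof.
move=> Hu Hv; apply: L2norm_dist0; last exact: wderivB.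
- exact/H1_L2_wderiv/H1B.
- by apply: L2B; exact: H1_L2_wderiv.
Qed.

(** [weak_deriv_increment_le] with both bounds equal to the weak derivative, applied to v and to -v,
    gives the two inequalities. Continuity on the closed interval is what includes the end points 0
    and 1. *)
Lemma H1_is_primitive v : H1 v -> is_primitive v (wderiv v).
Proof.
move=> Hv; have [Lv cv _] := Hv; have [Lg vg] := H1_wderiv Hv.
split => //; first exact: L2_measurable.
have ig := L2_integrable Lg.
have le1 x y : 0 <= x -> x < y -> y <= 1 -> v y - v x <= \int[leb]_(r in `]x, y[) wderiv v r.
  move=> x0 xy y1; apply: (weak_deriv_increment_le cv ig ig _ vg) => //.
  by apply: aeW => r _; rewrite lexx.
have vgN : weak_deriv 0 1 (\- v) (\- wderiv v).
  move=> p tp; have Lp := L2_test tp; have Ldp := L2_derive1_test tp.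
  have := vg _ tp; rewrite -/(ip v _) -/(ip (wderiv v) _) -/(ip (\- v) _) -/(ip (\- wderiv v) _).
  by rewrite !ipNl// => ->.
have cvN : {within `[0, 1], continuous (\- v)} by move=> x; apply: cvgN; exact: cv.
have igN := L2_integrable (L2N Lg).
have le2 x y : 0 <= x -> x < y -> y <= 1 -> - v y - - v x <= \int[leb]_(r in `]x, y[) (- wderiv v
  r).
  move=> x0 xy y1; apply: (weak_deriv_increment_le cvN igN igN _ vgN) => //.
  by apply: aeW => r _; rewrite lexx.
move=> x y x0; rewrite le_eqVlt => /predU1P[<- _|xy y1].
  by rewrite set_itv_ge ?Rintegral_set0 ?subrr// -leNgt bnd_simp.
apply/le_anti; rewrite le1//= -lerN2; have := le2 x y x0 xy y1.
have -> : \int[leb]_(r in `]x, y[) (- wderiv v r) = - \int[leb]_(r in `]x, y[) wderiv v r.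
  under eq_Rintegral do rewrite -mulN1r.
  by rewrite RintegralZl ?mulN1r//; exact: integrable_01_oo ig.
by rewrite -opprD.
Qed.

(** Serves the initial condition, which identifies two functions on [0, 1] only: their sets of weak
    derivatives coincide, so [xget] picks the same element. *)
Lemma eq_H1norms (u v : R -> R) : {in `[0, 1], u =1 v} ->
  L2norm u = L2norm v /\ L2norm (wderiv u) = L2norm (wderiv v).
Proof.
move=> uv.
have uvo x : x \in (`]0, 1[%classic : set R) -> u x = v x.
  by rewrite inE => x01; apply: uv; exact: subset_itv_oo_cc x01.
split; first by congr Num.sqrt; apply: eq_Rintegral => x /uvo ->.
congr L2norm; congr xget; apply/seteqP; split => g [Lg ug]; split => // phi tphi; rewrite -ug//.
  by apply: eq_Rintegral => x /uvo ->.
by apply: eq_Rintegral => x /uvo ->.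
Qed.

End H1theory.

(** * Increments in time *)

Section bochner.
Context {R : realType}.
Local Notation leb := (@lebesgue_measure R).
Local Notation I01 := (`]0, 1[%classic : set R).

(** Finitely many values, each taken on a measurable set, make any functional of a simple function
    measurable, however irregular the functional. *)
Lemma simple_on_measurable (V : set (R -> R)) (D : set R) (s : R -> R -> R)
  (F : (R -> R) -> R) : simple_on V D s -> measurable_fun D (fun t => F (s t)).
Proof.
move=> [fs _ ms] mD B mB.
have -> : D `&` (fun t => F (s t)) @^-1` B =
    \bigcup_(v in (s @` D) `&` [set v | B (F v)]) (D `&` s @^-1` [set v]).
  apply/seteqP; split => [t [Dt Bt]|t [v [_ Bv]] [Dt stv]].
    by exists (s t) => //; split => //; exists t.
  by split => //=; rewrite stv.
apply: fin_bigcup_measurable => [|v _]; last exact: ms.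
exact: finite_setIl.
Qed.

Lemma L2norm_le_H1norm (v : R -> R) : L2norm v <= H1norm v.
Proof. by rewrite -[leLHS]ger0_norm ?L2norm_ge0// -sqrtr_sqr ler_wsqrtr// lerDl sqr_ge0. Qed.

Lemma L2norm_wderiv_le_H1norm (v : R -> R) : L2norm (wderiv v) <= H1norm v.
Proof. by rewrite -[leLHS]ger0_norm ?L2norm_ge0// -sqrtr_sqr ler_wsqrtr// lerDr sqr_ge0. Qed.

Lemma cvg_H1norm (v_ : nat -> R -> R) (v : R -> R) : (forall n, H1 (v_ n)) -> H1 v ->
  H1norm (v_ n \- v) @[n --> \oo] --> 0 -> H1norm (v_ n) @[n --> \oo] --> H1norm v.
Proof.
move=> Hv_ Hv cv.
have c1 : L2norm (v_ n) @[n --> \oo] --> L2norm v.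
  apply/cvgrPdist_le => e e0; have /cvgrPdist_le/(_ e e0) := cv.
  apply: filterS => n; rewrite sub0r normrN ger0_norm ?sqrtr_ge0// => h.
  rewrite distrC (le_trans (ler_dist_L2norm (H1_L2 (Hv_ n)) (H1_L2 Hv)))//.
  exact: le_trans (L2norm_le_H1norm _) h.
have c2 : L2norm (wderiv (v_ n)) @[n --> \oo] --> L2norm (wderiv v).
  apply/cvgrPdist_le => e e0; have /cvgrPdist_le/(_ e e0) := cv.
  apply: filterS => n; rewrite sub0r normrN ger0_norm ?sqrtr_ge0// => h.
  rewrite distrC (le_trans (ler_dist_L2norm (H1_L2_wderiv (Hv_ n)) (H1_L2_wderiv Hv)))//.
  by rewrite -L2norm_wderivB//; exact: le_trans (L2norm_wderiv_le_H1norm _) h.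
apply: (@cvg_comp _ _ _ (fun n => L2norm (v_ n) ^+ 2 + L2norm (wderiv (v_ n)) ^+ 2) Num.sqrt).
  by apply: cvgD; [exact: (cvgM c1 c1)|exact: (cvgM c2 c2)].
exact: sqrt_continuous.
Qed.

(** The norm of [u t] is a limit of measurable functions only almost everywhere, and [u t] may leave
    H^1 on a null set. Replacing the norm by 0 on a measurable null set containing all bad times
    gives a truly measurable function; the later estimates use the Bochner condition only through
    it. *)
Lemma bochner_H1_majorant (D : set R) (u : R -> R -> R) : measurable D -> bochner_L2 H1 H1norm D
  u ->
  exists m : R -> R, [/\ forall t, 0 <= m t, measurable_fun D m, leb.-integrable D (EFin \o (fun
    t => m t ^+ 2)) &
    {ae leb, forall t, D t -> H1 (u t) /\ H1norm (u t) <= m t}].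
Proof.
move=> mD [aeH [s [ss scvg]] ufin].
have aeHc := leb_ae_and aeH scvg.
have [N [mN N0 PN]] := aeHc.
pose m t := H1norm (u t) * \1_(~` N) t.
have mm : measurable_fun D m.
  apply: (@measurable_fun_cvg _ _ _ D (fun n t => H1norm (s n t) * \1_(~` N) t)).
    move=> n; apply: measurable_funM; first exact: simple_on_measurable (ss n).
    by apply: measurable_indic; exact: measurableC.
  move=> t Dt; have [tN|tN] := pselect (N t).
    have tN0 : \1_(~` N) t = 0 :> R by rewrite indicE memNset//= => /(_ tN).
    apply: cvg_near_cst; apply: nearW => n; rewrite /m tN0.
    by move: (H1norm _) (H1norm _) => a b; rewrite !mulr0.
  apply: cvgM; last exact: cvg_cst.
  have [/(_ Dt) Hut /(_ Dt) cut] : (D t -> H1 (u t)) /\ (D t -> H1norm (s n t \- u t) @[n -->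
    \oo] --> 0).
    by apply: contrapT => h; apply: tN; apply: PN => /= hh; exact: h.
  by apply: cvg_H1norm => // n; have [_ sV _] := ss n; apply: sV; exists t.
exists m; split => //.
- by move=> t; rewrite /m mulr_ge0 ?sqrtr_ge0// indicE.
- apply/integrableP; split; first by apply/measurable_EFinP; exact: measurable_funX.
  (* The dominating integrand [H1norm (u t) ^+ 2] is not known to be measurable, hence the
     comparison of lower integrals. *)
  apply: le_lt_trans ufin; apply: ge0_le_lower_integral => t Dt; first exact: abse_ge0.
  rewrite /= lee_fin ger0_norm ?sqr_ge0// /m exprMn.
  by rewrite ler_piMr ?sqr_ge0// indicE; case: (_ \in _); rewrite ?expr1n ?expr0n.
- exists N; split => // t /= /not_implyP[Dt hn]; apply: contrapT => tN; apply: hn.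
have -> : m t = H1norm (u t) by rewrite /m indicE mem_set ?mulr1.
by split => //; apply: contrapT => h; apply: tN; apply: PN => /= -[/(_ Dt)].
Qed.

End bochner.

Section time_increments.
Context {R : realType}.
Local Notation leb := (@lebesgue_measure R).
Variables (T : R) (w wt : R -> R -> R) (m : R -> R).
Hypothesis wH1 : forall t : R, 0 <= t -> H1 (w t).
Hypothesis wc : forall t : R, 0 <= t ->
  L2norm (w s \- w t) @[s --> within `[0, +oo[ (nbhs t)] --> (0 : R).
Hypothesis wwt : weak_time_deriv T w wt.
Hypothesis m0 : forall t, 0 <= m t.
Hypothesis mm : measurable_fun `]0, T[ m.
Hypothesis im2 : leb.-integrable `]0, T[ (EFin \o (fun t => m t ^+ 2)).
Hypothesis wtm : {ae leb, forall t, `]0, T[%classic t ->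
  [/\ H1 (wt t), L2norm (wt t) <= m t & L2norm (wderiv (wt t)) <= m t]}.

Local Notation J s t := (\int[leb]_(r in `]s, t[) m r).

Lemma majorant_integrable : leb.-integrable `]0, T[ (EFin \o m).
Proof.
have : leb.-integrable `]0, T[ (EFin \o (fun r => m r * 1)).
  apply: integrable_mul_sqr => //.
  by under [X in EFin \o X]eq_fun do rewrite expr1n; exact: integrable_oo_cst.
by under [X in EFin \o X]eq_fun do rewrite mulr1.
Qed.

Lemma subset_oo_0T s t : 0 <= s -> t <= T -> `]s, t[ `<=` (`]0, T[%classic : set R).
Proof.
move=> s0 tT r /=; rewrite !in_itv/= => /andP[sr rt].
by rewrite (le_lt_trans s0)// (lt_le_trans rt).
Qed.

Lemma majorant_integrable_oo s t : 0 <= s -> t <= T -> leb.-integrable `]s, t[ (EFin \o m).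
Proof.
by move=> s0 tT; apply: integrableS majorant_integrable => //; exact: subset_oo_0T.
Qed.

Lemma wt_majorant s t : 0 <= s -> t <= T -> {ae leb, forall r, `]s, t[%classic r ->
  [/\ H1 (wt r), L2norm (wt r) <= m r & L2norm (wderiv (wt r)) <= m r]}.
Proof. by move=> s0 tT; apply: leb_aeS wtm => r h rst; apply: h; exact: (subset_oo_0T s0 tT). Qed.

Lemma ip_evolution_continuous chi : L2 chi ->
  {within `[0, T], continuous (fun t => ip (w t) chi)}.
Proof.
move=> Lchi; apply/subspace_continuousP => t /=; rewrite in_itv/= => /andP[t0 tT].
apply/cvgrPdist_le => e e0.
have k0 : 0 < L2norm chi + 1 by rewrite ltr_wpDl ?L2norm_ge0.
have /cvgrPdist_le/(_ _ (divr_gt0 e0 k0)) := wc t0.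
rewrite !near_withinE; apply: filterS => s h; rewrite /= in_itv/= => /andP[s0 sT].
have {}h := h ltac:(by rewrite /= in_itv/= s0).
rewrite sub0r normrN ger0_norm ?L2norm_ge0// in h.
have Ls := H1_L2 (wH1 s0); have Lt := H1_L2 (wH1 t0).
rewrite distrC -ipBl// (le_trans (normr_ip_le _ _))//; first exact: L2B.
rewrite (@le_trans _ _ (e / (L2norm chi + 1) * L2norm chi))// ?ler_wpM2r ?L2norm_ge0//.
by rewrite -mulrA ler_piMr ?(ltW e0)// mulrC ler_pdivrMr// mul1r lerDl.
Qed.

Lemma ip_increment_le s t chi k C : 0 <= s -> s < t -> t <= T -> L2 chi ->
  {ae leb, forall r, `]s, t[%classic r -> ip (wt r) chi <= k + C * m r} ->
  ip (w t \- w s) chi <= k * (t - s) + C * J s t.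
Proof.
move=> s0 st tT Lchi wtchi.
have Ls := H1_L2 (wH1 s0); have Lt := H1_L2 (wH1 (le_trans s0 (ltW st))).
have im := majorant_integrable.
have iCm D : measurable D -> D `<=` `]0, T[ -> forall C', leb.-integrable D (EFin \o (fun r => C'
  * m r)).
  move=> mD D0T C'; apply: (@integrableS _ _ _ leb `]0, T[) => //.
  exact: (@integrableZl _ _ _ leb _ _ C' (EFin \o m)).
have sub := subset_oo_0T s0 tT.
have ik a b : leb.-integrable `]a, b[ (EFin \o (fun=> k)) by exact: integrable_oo_cst.
have := @weak_deriv_increment_le R 0 T (fun t => ip (w t) chi) (fun t => ip (wt t) chi)
  (fun r => k + C * m r) (fun r => - L2norm chi * m r) s t
  (ip_evolution_continuous Lchi).
have -> : \int[leb]_(r in `]s, t[) (k + C * m r) = k * (t - s) + C * J s t.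
  rewrite RintegralD//; [|exact: iCm].
  rewrite Rintegral_oo_cst ?(ltW st)// RintegralZl//; exact: majorant_integrable_oo.
rewrite -ipBl//; apply => //.
- by have := integrableD _ (ik 0 T) (iCm _ _ (@subset_refl _ _) C); apply.
- exact: iCm.
- apply: leb_aeS (leb_ae_and wtchi (wt_majorant s0 tT)) => r [h1 h2] rst.
  rewrite h1// andbT; have [/H1_L2 Lr wtr _] := h2 rst.
  rewrite mulNr lerNl (le_trans (ler_norm _))// normrN (le_trans (normr_ip_le Lr Lchi))//.
  by rewrite mulrC ler_wpM2l ?L2norm_ge0.
- exact: wwt.
Qed.

Lemma ip_wderiv_test (v phi : R -> R) : H1 v -> test_function 0 1 phi ->
  ip (wderiv v) phi = - ip v (derive1 phi).
Proof.
by move=> /H1_wderiv[_ vg] tphi; apply: oppr_inj; rewrite opprK; exact/esym/vg.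
Qed.

(* The weak formulation in time only gives access to pairings with elements of
   L^2; derivatives in space are reached by duality with test functions. *)
Lemma H1_increment_le s t xi eta k C : 0 <= s -> s < t -> t <= T -> L2 xi -> L2 eta ->
  {ae leb, forall r, `]s, t[%classic r ->
    ip (wt r) xi + ip (wderiv (wt r)) eta <= k + C * m r} ->
  ip (w t \- w s) xi + ip (wderiv (w t \- w s)) eta <= k * (t - s) + C * J s t.
Proof.
move=> s0 st tT Lxi Leta h; have t0 := le_trans s0 (ltW st).
have Hd : H1 (w t \- w s) by apply: H1B; exact: wH1.
have Lgd := H1_L2_wderiv Hd.
have J0 : 0 <= J s t by exact: Rintegral_ge0.
apply/ler_addgt0Pr => e e0.
have k0 : 0 < J s t + L2norm (wderiv (w t \- w s)) + 1.
  by rewrite ltr_wpDl ?addr_ge0 ?L2norm_ge0.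
(* Replacing [eta] by a test function costs d times [m] under the time integral and d times the norm
   of the derivative of the increment; this d keeps the total below e, and the summand 1 keeps the
   denominator positive. *)
pose d := e / (J s t + L2norm (wderiv (w t \- w s)) + 1).
have d0 : 0 < d by rewrite divr_gt0.
have [_ /(_ _ d0)[p tp pd]] := test_function_dense Leta.
have Lp := L2_test tp; have Ldp := L2_derive1_test tp; have Lep := L2B Leta Lp.
have Lchi : L2 (xi \- derive1 p) by exact: L2B.
have split_ip v : H1 v -> ip v xi + ip (wderiv v) eta =
    ip v (xi \- derive1 p) + ip (wderiv v) (eta \- p).
  move=> Hv; have Lv := H1_L2 Hv; have Lgv := H1_L2_wderiv Hv.
  by rewrite !ipBr// (ip_wderiv_test Hv tp); ring.
have err v : H1 v -> `|ip (wderiv v) (eta \- p)| <= d * L2norm (wderiv v).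
  move=> Hv; have Lgv := H1_L2_wderiv Hv.
  by rewrite (le_trans (normr_ip_le Lgv Lep))// mulrC ler_wpM2r ?L2norm_ge0.
rewrite split_ip//.
have := @ip_increment_le s t (xi \- derive1 p) k (C + d) s0 st tT Lchi.
move=> /(_ _)/wrap[|I1].
  apply: leb_aeS (leb_ae_and h (wt_majorant s0 tT)) => r [h1 h2] rst.
  have {h1} := h1 rst; have [Hr _ wtr] := h2 rst; rewrite split_ip//.
  have := err _ Hr; rewrite ler_norml => /andP[e1 _].
  have : d * L2norm (wderiv (wt r)) <= d * m r by rewrite ler_wpM2l// ltW.
  by move: e1; clear; lra.
have := err _ Hd; rewrite ler_norml => /andP[_ e2].
have dE : d * (J s t + L2norm (wderiv (w t \- w s)) + 1) = e by rewrite divfK// gt_eqF.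
by move: I1 e2 dE d0; rewrite mulrDl; move: (J s t) => j; clear; lra.
Qed.

(** By duality: paired with the increment itself, or with its space derivative, [H1_increment_le]
    yields x^2 <= x J for the norm x in question. This makes w continuous in time with values in
    H^1. *)
Lemma L2norm_increment_le s t : 0 <= s -> s < t -> t <= T ->
  L2norm (w t \- w s) <= J s t /\ L2norm (wderiv (w t \- w s)) <= J s t.
Proof.
move=> s0 st tT; have t0 := le_trans s0 (ltW st).
have Hd : H1 (w t \- w s) by apply: H1B; exact: wH1.
have Ld := H1_L2 Hd; have Lgd := H1_L2_wderiv Hd; have L0 : L2 (fun _ : R => 0) by exact: L2_cst.
have J0 : 0 <= J s t by exact: Rintegral_ge0.
have ip0 f : ip f (fun=> 0) = 0.
  by rewrite /ip; under eq_Rintegral do rewrite mulr0; rewrite /Rintegral integral0.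
have concl x : 0 <= x -> x ^+ 2 <= x * J s t -> x <= J s t.
  rewrite le_eqVlt => /predU1P[<-//|x0]; by rewrite expr2 ler_pM2l.
have wtr := wt_majorant s0 tT.
split; apply: concl; rewrite ?L2norm_ge0// sqr_L2norm.
- have := @H1_increment_le s t (w t \- w s) (fun=> 0) 0 (L2norm (w t \- w s)) s0 st tT Ld L0.
  rewrite ip0 addr0 mul0r add0r; apply.
  apply: leb_aeS wtr => r h /h[/H1_L2 Lr wr _]; rewrite ip0 addr0 add0r mulrC.
  by rewrite (le_trans (ip_le Lr Ld))// ler_wpM2r ?L2norm_ge0.
- have := @H1_increment_le s t (fun=> 0) (wderiv (w t \- w s)) 0 (L2norm (wderiv (w t \- w s)))
  s0 st tT L0 Lgd.
  rewrite ip0 !add0r mul0r add0r; apply.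
  apply: leb_aeS wtr => r h /h[/H1_L2_wderiv Lr _ wr]; rewrite ip0 !add0r mulrC.
  by rewrite (le_trans (ip_le Lr Lgd))// ler_wpM2r ?L2norm_ge0.
Qed.

Lemma majorant_CS s t : 0 <= s -> s <= t -> t <= T ->
  J s t ^+ 2 <= (t - s) * \int[leb]_(r in `]s, t[) (m r ^+ 2).
Proof.
move=> s0 st tT; apply: Rintegral_oo_CS => //.
  by apply: measurable_funS mm => //; exact: subset_oo_0T.
by apply: integrableS im2 => //; exact: subset_oo_0T.
Qed.

End time_increments.

(** * The pointwise dissipation inequality *)

Section algebra.
Context {R : realType}.
Implicit Types (x y p q m k b c mu nu V W beta E : R).

(** Origin of the coefficients: write v as the affine function s with end values p, q plus a
    remainder z, and use (s + z)^2 <= 6/5 s^2 + 6 z^2. Since z^2 <= x (1 - x) |z_x|^2 and x (1 - x)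
    has integral 1/6, the weight 6 makes the remainder cost |z_x|^2 = |v_x|^2 - (q - p)^2. Then 2/5
    (p^2 + p q + q^2) - (q - p)^2 is the form. *)
Definition trace_form p q := 12 / 5 * p * q - 3 / 5 * (p ^+ 2 + q ^+ 2).

(** The maximum over p, at p = 2 q, is 9/5 q^2. The bound fits the surplus 2 b q^2 that linear
    convection leaves at the right end. *)
Lemma trace_form_le_right p q : trace_form p q <= 2 * q ^+ 2.
Proof.
by rewrite /trace_form; have := sqr_ge0 (p - 2 * q); have := sqr_ge0 q; nra.
Qed.

(** Here x = p / (3 m) and y = q / (3 m). For c0 = m the square at the left end vanishes at x = 1,
    so for x >= 1 that square is discarded and the right end pays for the whole form. *)
Lemma trace_form_gt1 x y : 1 <= x -> 0 <= y -> trace_form x y <= y ^+ 2 * (1 + 2 * y).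
Proof.
move=> x1 y0; rewrite /trace_form.
(* The maximum over x, 9/5 y^2 at x = 2 y, suffices when y >= 2/5; below that 2 y < 1 <= x, so x = 1
   is the worst case. *)
have [y4|y4] := leP (2 / 5) y.
  have := sqr_ge0 (x - 2 * y); have : 0 <= y ^+ 2 * (y - 2 / 5) by rewrite mulr_ge0 ?sqr_ge0//
    subr_ge0.
  by nra.
have : (1 - 2 * y) ^+ 2 <= (x - 2 * y) ^+ 2.
  by rewrite ler_sqr ?nnegrE; lra.
have : 0 <= y * (y - 19 / 50) ^+ 2 by rewrite mulr_ge0 ?sqr_ge0.
(* With y^3 bounded below through y (y - 19/50)^2 >= 0, the quadratic 78/25 y^2 - 3361/1250 y + 3/5
   remains; 3361/7800 is its vertex. *)
have := sqr_ge0 (y - 3361 / 7800).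
by nra.
Qed.

Lemma trace_form_le1 x y : 0 <= x <= 1 -> 0 <= y ->
  trace_form x y <= x ^+ 2 * (1 - x) ^+ 2 + y ^+ 2 * (1 + 2 * y).
Proof.
move=> /andP[x0 x1] y0; rewrite /trace_form.
(* Up to 2/5 the bound (1 - x)^2 >= 9/25 is enough, by the square of x - 5/4 y; beyond, (x - 2/5) (1
   - x) >= 0 enters the discriminant estimate. *)
have [x4|x4] := leP x (2 / 5).
  have h1 : 9 / 25 * x ^+ 2 <= x ^+ 2 * (1 - x) ^+ 2.
    rewrite [leLHS]mulrC ler_wpM2l ?sqr_ge0//.
    have : 0 <= (2 / 5 - x) * (8 / 5 - x) by apply: mulr_ge0; lra.
    by nra.
  have : 0 <= y ^+ 3 by rewrite exprn_ge0.
  have := sqr_ge0 (x - 5 / 4 * y); have := sqr_ge0 y.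
  by nra.
(* s^3 >= 2 a s^2 - a^2 s at the near-minimiser a = 19/50 makes the claim
   quadratic in y, with a discriminant that is a quartic in x. *)
have y3 : 2 * (19 / 25 * y ^+ 2 - 361 / 2500 * y) <= 2 * y ^+ 3.
  by have : 0 <= y * (y - 19 / 50) ^+ 2 by [rewrite mulr_ge0 ?sqr_ge0]; nra.
have disc : (12 / 5 * x + 361 / 1250) ^+ 2 <= 4 * (78 / 25) * (x ^+ 2 * (1 - x) ^+ 2 + 3 / 5 * x
  ^+ 2).
  have := sqr_ge0 (x ^+ 2 - x + 2 / 25).
  have : 0 <= (x - 2 / 5) * (1 - x) by apply: mulr_ge0; lra.
  by nra.
have := sqr_ge0 (2 * (78 / 25) * y - (12 / 5 * x + 361 / 1250)).
by nra.
Qed.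

(** In units of 3 m and after division by 9 m^3, the left square at c0 = m is x^2 (1 - x)^2, and y^2
    (1 + 2 y) is a lower bound for the right one, whose quartic part is dropped. Both ends are thus
    reduced to the single parameter m. *)
Lemma trace_form_le_pos m c0 c1 p q : 0 < m -> m <= c0 -> m <= c1 -> 0 <= p -> 0 <= q ->
  m * trace_form p q <= c0^-1 * (c0 * p - p ^+ 2 / 3) ^+ 2 + c1^-1 * (c1 * q + q ^+ 2 / 3) ^+ 2.
Proof.
move=> m0 mc0 mc1 p0 q0.
have c00 : 0 < c0 by lra.
have c10 : 0 < c1 by lra.
pose x := p / (3 * m); pose y := q / (3 * m).
have m3 : 3 * m != 0 by rewrite mulf_neq0 ?gt_eqF//; lra.
have px : p = 3 * m * x by rewrite /x mulrC divfK.
have qy : q = 3 * m * y by rewrite /y mulrC divfK.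
have x0 : 0 <= x by rewrite divr_ge0//; lra.
have y0 : 0 <= y by rewrite divr_ge0//; lra.
have XE : m * trace_form p q = 9 * m ^+ 3 * trace_form x y.
  by rewrite /trace_form px qy; ring.
have S1 : 9 * m ^+ 3 * (y ^+ 2 * (1 + 2 * y)) <= c1^-1 * (c1 * q + q ^+ 2 / 3) ^+ 2.
  have -> : c1^-1 * (c1 * q + q ^+ 2 / 3) ^+ 2 = q ^+ 2 * (c1 + 2 * q / 3) + q ^+ 4 / (9 * c1).
    by field; rewrite gt_eqF.
  have -> : 9 * m ^+ 3 * (y ^+ 2 * (1 + 2 * y)) = q ^+ 2 * (m + 2 * q / 3).
    by rewrite qy; field.
  rewrite ler_wpDr ?divr_ge0 ?exprn_ge0//; first lra.
  by rewrite ler_wpM2l ?sqr_ge0// lerD2r.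
have S0 : 0 <= c0^-1 * (c0 * p - p ^+ 2 / 3) ^+ 2 by rewrite mulr_ge0 ?sqr_ge0// invr_ge0 ltW.
have m3' : 0 <= 9 * m ^+ 3 by rewrite mulr_ge0// exprn_ge0// ltW.
have [x1|x1] := leP 1 x.
  rewrite XE (le_trans (ler_wpM2l m3' (trace_form_gt1 x1 y0)))//.
  by rewrite ler_wpDl.
have x01 : 0 <= x <= 1 by rewrite x0 ltW.
rewrite XE (le_trans (ler_wpM2l m3' (trace_form_le1 x01 y0)))// mulrDr lerD//.
have -> : 9 * m ^+ 3 * (x ^+ 2 * (1 - x) ^+ 2) = p ^+ 2 * (m - 2 * p / 3 + p ^+ 2 / (9 * m)).
  by rewrite px; field; rewrite gt_eqF.
have -> : c0^-1 * (c0 * p - p ^+ 2 / 3) ^+ 2 = p ^+ 2 * (c0 - 2 * p / 3 + p ^+ 2 / (9 * c0)).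
  by field; rewrite gt_eqF.
rewrite ler_wpM2l ?sqr_ge0//.
(* Comparison of the left square at c0 with its value at m: the difference has the sign of 9 m c0 -
   p^2, nonnegative because p <= 3 m and m <= c0. *)
have -> : c0 - 2 * p / 3 + p ^+ 2 / (9 * c0) = m - 2 * p / 3 + p ^+ 2 / (9 * m) +
    (c0 - m) * (9 * m * c0 - p ^+ 2) / (9 * m * c0).
  by field; rewrite !gt_eqF.
rewrite lerDl divr_ge0 ?mulr_ge0 ?(ltW m0) ?(ltW c00)//; first lra.
have p3 : p <= 3 * m by rewrite px ler_piMr//; lra.
have : p ^+ 2 <= (3 * m) ^+ 2 by rewrite ler_sqr ?nnegrE//; lra.
have : m * m <= m * c0 by rewrite ler_wpM2l// ltW.
by rewrite exprMn; nra.
Qed.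

(** For p q <= 0 the form is nonpositive. When both are negative, the reflection x -> 1 - x combined
    with w -> -w exchanges the ends, preserves the form and the two squares, and leads back to the
    positive case. *)
Lemma trace_form_le m c0 c1 p q : 0 <= m -> 0 < c0 -> 0 < c1 -> m <= c0 -> m <= c1 ->
  m * trace_form p q <= c0^-1 * (c0 * p - p ^+ 2 / 3) ^+ 2 + c1^-1 * (c1 * q + q ^+ 2 / 3) ^+ 2.
Proof.
move=> m0 c00 c10 mc0 mc1.
have S c z : 0 < c -> 0 <= c^-1 * z ^+ 2 by move=> c_; rewrite mulr_ge0 ?sqr_ge0// invr_ge0 ltW.
have S01 : 0 <= c0^-1 * (c0 * p - p ^+ 2 / 3) ^+ 2 + c1^-1 * (c1 * q + q ^+ 2 / 3) ^+ 2.
  by rewrite addr_ge0 ?S.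
move: m0; rewrite le_eqVlt => /predU1P[<-|m0]; first by rewrite mul0r.
have [pq0|pq0] := leP (p * q) 0.
  rewrite (le_trans _ S01)// pmulr_rle0// /trace_form.
  by have := sqr_ge0 p; have := sqr_ge0 q; nra.
have [p0|p0] := leP 0 p.
  have q0 : 0 <= q by rewrite leNgt; apply/negP => q0; nra.
  exact: trace_form_le_pos.
have q0 : q < 0 by rewrite ltNge; apply/negP => q0; nra.
have := @trace_form_le_pos m c1 c0 (- q) (- p) m0 mc1 mc0.
rewrite !oppr_ge0 !(ltW p0) !(ltW q0) => /(_ isT isT).
have -> : trace_form (- q) (- p) = trace_form p q by rewrite /trace_form; ring.
have -> : (c1 * - q - (- q) ^+ 2 / 3 : R) = - (c1 * q + q ^+ 2 / 3) by ring.
have -> : (c0 * - p + (- p) ^+ 2 / 3 : R) = - (c0 * p - p ^+ 2 / 3) by ring.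
by rewrite !sqrrN addrC.
Qed.

(* [2 * (...)] below is twice the dissipation obtained by testing with the
   solution itself; completing squares at each end leaves a surplus that absorbs
   the L^2 part of the energy through [trace_form]. *)
Lemma dissipation_ge mu nu b k c0 c1 p q V W beta :
  0 < mu -> 0 < nu -> 0 <= b -> 0 <= k -> 0 < c0 -> 0 < c1 -> k <= c0 + b -> k <= c1 + b ->
  beta <= 2 * nu - k * (mu + 1) -> beta <= 1 - k * (mu / nu) -> 0 <= W ->
  V - W <= trace_form p q -> forall E,
  E = (c0 + b + 1 / (3 * c0) * p ^+ 2) * p ^+ 2 + (c1 + b + 1 / (3 * c1) * q ^+ 2) * q ^+ 2 ->
  k * (V + mu * W + mu / nu * E) + beta * (E + W) <=
  2 * (nu * W + b * ((q ^+ 2 - p ^+ 2) / 2) + (q ^+ 3 - p ^+ 3) / 3 +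
    (((c0 + b) * p + 2 / (9 * c0) * p ^+ 3) * p + ((c1 + b) * q + 2 / (9 * c1) * q ^+ 3) * q)).
Proof.
move=> mu0 nu0 b0 k0 c00 c10 kc0 kc1 bW bE W0 VW E EE.
have E0 : 0 <= E.
  have H c z : 0 < c -> 0 <= (c + b + 1 / (3 * c) * z ^+ 2) * z ^+ 2.
    move=> c_; rewrite mulr_ge0 ?sqr_ge0// addr_ge0 ?(addr_ge0 (ltW c_))//.
    by rewrite mulr_ge0 ?sqr_ge0// divr_ge0// mulr_ge0// ltW.
  by rewrite EE addr_ge0 ?H.
have -> : 2 * (nu * W + b * ((q ^+ 2 - p ^+ 2) / 2) + (q ^+ 3 - p ^+ 3) / 3 +
    (((c0 + b) * p + 2 / (9 * c0) * p ^+ 3) * p + ((c1 + b) * q + 2 / (9 * c1) * q ^+ 3) * q)) =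
  2 * nu * W + E + (2 * b * q ^+ 2 +
   (c0^-1 * (c0 * p - p ^+ 2 / 3) ^+ 2 + c1^-1 * (c1 * q + q ^+ 2 / 3) ^+ 2)).
  by rewrite EE; field; rewrite !gt_eqF.
have surplus : k * trace_form p q <= 2 * b * q ^+ 2 +
   (c0^-1 * (c0 * p - p ^+ 2 / 3) ^+ 2 + c1^-1 * (c1 * q + q ^+ 2 / 3) ^+ 2).
  have S c z : 0 < c -> 0 <= c^-1 * z ^+ 2 by move=> c_; rewrite mulr_ge0 ?sqr_ge0// invr_ge0 ltW.
  have S01 : 0 <= c0^-1 * (c0 * p - p ^+ 2 / 3) ^+ 2 + c1^-1 * (c1 * q + q ^+ 2 / 3) ^+ 2.
    by rewrite addr_ge0 ?S.
  have fb : b * trace_form p q <= 2 * b * q ^+ 2.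
    by rewrite -mulrA mulrCA ler_wpM2l// trace_form_le_right.
  (* For k > b, the part b of k is absorbed by 2 b q^2 and the excess k - b, at most c0 and c1, by
     the two squares; for k <= b the term 2 b q^2 is enough. *)
  have [kb|kb] := leP k b.
    have [X0|X0] := leP (trace_form p q) 0.
      rewrite (@le_trans _ _ 0)// ?mulr_ge0_le0// addr_ge0// mulr_ge0 ?sqr_ge0// mulr_ge0//.
    by rewrite ler_wpDr// (le_trans _ fb)// ler_wpM2r// ltW.
  rewrite -(subrK b k) addrC mulrDl lerD// trace_form_le//; lra.
have kVW : k * (V - W) <= k * trace_form p q by rewrite ler_wpM2l.
have h1 : beta * W <= (2 * nu - k * (mu + 1)) * W by rewrite ler_wpM2r.
have h2 : beta * E <= (1 - k * (mu / nu)) * E by rewrite ler_wpM2r.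
apply: (le_trans _ (lerD (lexx (2 * nu * W + E)) surplus)).
by move: (mu / nu) (trace_form p q) h1 h2 kVW; clear => t X *; lra.
Qed.

End algebra.

(** * A Poincare inequality with boundary values *)

Section poincare.
Context {R : realType}.
Local Notation leb := (@lebesgue_measure R).
Local Notation I01 := (`]0, 1[%classic : set R).

Lemma ip_id_1 : ip (@id R) (fun=> 1) = 2^-1.
Proof.
have := is_primitive_ip (@is_primitive_id R) (@is_primitive_id R).
by rewrite mulr1 mulr0 subr0 (ipC (fun=> 1)); lra.
Qed.

Lemma ip_id_id : ip (@id R) id = 3^-1.
Proof.
have Lid := is_primitive_L2 (@is_primitive_id R).
have := is_primitive_ip (is_primitiveM (@is_primitive_id R) (@is_primitive_id R))
  (@is_primitive_id R).
rewrite !mulr1 !mulr0 subr0.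
have -> : ip (fun x : R => x * 1 + x * 1) id = 2 * ip (@id R) id.
  by rewrite -ipZl//; apply: eq_ip => x _ //; ring.
have -> : ip (fun x : R => x * x) (fun=> 1) = ip (@id R) id.
  by apply: eq_Rintegral => x _; rewrite mulr1.
by lra.
Qed.

Lemma poincare_trace (v g : R -> R) : is_primitive v g ->
  L2norm v ^+ 2 - L2norm g ^+ 2 <= trace_form (v 0) (v 1).
Proof.
move=> vg; have [mv Lg vE] := vg; have Lv := is_primitive_L2 vg.
(* Z will be the squared norm of the derivative of the remainder: removing from [g] its mean q - p
   subtracts (q - p)^2. *)
set p := v 0; set q := v 1; set W := L2norm g ^+ 2; pose Z := W - (q - p) ^+ 2.
have L1 : L2 (fun _ : R => 1) by exact: L2_cst.
have Lid := is_primitive_L2 (@is_primitive_id R).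
have pz := is_primitiveD vg (is_primitiveD (is_primitiveM (is_primitive_cst (p - q))
  (@is_primitive_id R)) (is_primitive_cst (- p))).
set h := (X in is_primitive _ X) in pz; set z := (X in is_primitive X _) in pz.
have zE x : z x = v x - (p + (q - p) * x) by rewrite /z /=; ring.
have hE x : h x = g x - (q - p) by rewrite /h /=; ring.
have [mz Lh zzE] := pz.
have ip11 : ip (fun _ : R => 1) (fun=> 1) = 1.
  by rewrite /ip; under eq_Rintegral do rewrite mulr1; rewrite Rintegral_oo_cst// mul1r subr0.
have ZE : \int[leb]_(r in I01) (h r ^+ 2) = Z.
  have -> : \int[leb]_(r in I01) (h r ^+ 2) = ip (fun x => g x + (p - q) * 1) (fun x => g x + (p
    - q) * 1).
    by apply: eq_Rintegral => r _; rewrite hE -expr2; congr (_ ^+ 2); ring.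
  rewrite ip_sqrD// ip11 -sqr_L2norm -/W.
  have -> : ip g (fun=> 1) = q - p.
    by rewrite vE// /ip; under eq_Rintegral do rewrite mulr1.
  by rewrite /Z; ring.
have vx x : I01 x -> v x ^+ 2 <= 6 / 5 * p ^+ 2 + ((12 / 5 * p * (q - p) + 6 * Z) * x +
    (6 / 5 * (q - p) ^+ 2 - 6 * Z) * (x * x)).
  rewrite /= in_itv/= => /andP[x0 x1].
  have := L2_oo_CS Lh (lexx 0) (ltW x0) (ltW x1); rewrite -(zzE _ _ (lexx 0) (ltW x0) (ltW x1)).
  have := L2_oo_CS Lh (ltW x0) (ltW x1) (lexx 1); rewrite -(zzE _ _ (ltW x0) (ltW x1) (lexx 1)).
  have := Rintegral_oo_split (ltW x0) (ltW x1) (L2_integrable_sqr Lh).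
  have -> : z 0 = 0 by rewrite zE /p; ring.
  have -> : z 1 = 0 by rewrite zE /p /q; ring.
  rewrite ZE sub0r !subr0 sqrrN.
  move: (Rintegral _ _ _) (Rintegral _ _ _) => B A -> zB zA.
  (* Cauchy-Schwarz from the left end gives z^2 <= x A, from the right end z^2 <= (1 - x) B;
     averaging with weights 1 - x and x produces the total A + B = Z. *)
  have zx : z x ^+ 2 <= x * (1 - x) * (A + B).
    have -> : z x ^+ 2 = (1 - x) * z x ^+ 2 + x * z x ^+ 2 by ring.
    have : (1 - x) * z x ^+ 2 <= (1 - x) * (x * A) by rewrite ler_wpM2l// subr_ge0 ltW.
    have : x * z x ^+ 2 <= x * ((1 - x) * B) by rewrite ler_wpM2l// ltW.
    by nra.
  have -> : v x = (p + (q - p) * x) + z x by rewrite zE; ring.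
  move: zx; move: (z x) (p) (q - p) (A + B) => y s d C yx.
  (* One fifth of this square is the gap in Young's inequality with weights 6/5 and 6. *)
  by have := sqr_ge0 ((s + d * x) - 5 * y); clear -yx; nra.
have i1 : leb.-integrable I01 (EFin \o (fun x => (12 / 5 * p * (q - p) + 6 * Z) * x)).
  exact/L2_integrable/L2Z.
have i2 : leb.-integrable I01 (EFin \o (fun x : R => x * x)) by exact: L2_integrable_mul.
have i2' : leb.-integrable I01 (EFin \o (fun x : R => (6 / 5 * (q - p) ^+ 2 - 6 * Z) * (x * x))).
  exact: (@integrableZl _ _ _ leb _ _ (6 / 5 * (q - p) ^+ 2 - 6 * Z) (EFin \o (fun x : R => x *
    x))).
have ic := integrable_oo_cst 0 1 (6 / 5 * p ^+ 2).
have i12 : leb.-integrable I01 (EFin \o (fun x => (12 / 5 * p * (q - p) + 6 * Z) * x +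
    (6 / 5 * (q - p) ^+ 2 - 6 * Z) * (x * x))) by exact: (integrableD _ i1 i2').
have : L2norm v ^+ 2 <= 6 / 5 * p ^+ 2 + ((12 / 5 * p * (q - p) + 6 * Z) * 2^-1 +
    (6 / 5 * (q - p) ^+ 2 - 6 * Z) * 3^-1).
  rewrite -ip_id_1 -ip_id_id.
  have <- : \int[leb]_(x in I01) (6 / 5 * p ^+ 2 + ((12 / 5 * p * (q - p) + 6 * Z) * x +
    (6 / 5 * (q - p) ^+ 2 - 6 * Z) * (x * x))) = 6 / 5 * p ^+ 2 +
    ((12 / 5 * p * (q - p) + 6 * Z) * ip id (fun=> 1) + (6 / 5 * (q - p) ^+ 2 - 6 * Z) * ip id id).
    rewrite RintegralD// Rintegral_oo_cst// subr0 mulr1; congr (_ + _).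
    rewrite RintegralD//; congr (_ + _); rewrite RintegralZl//; last exact: L2_integrable.
    by rewrite /ip; under [in RHS]eq_Rintegral do rewrite mulr1.
  rewrite sqr_L2norm /ip; apply: le_Rintegral => //.
  - exact: L2_integrable_mul.
  - exact: (integrableD _ ic i12).
by rewrite /trace_form /Z; move: (L2norm v ^+ 2) (W) (p) (q); clear; move=> *; lra.
Qed.

End poincare.

(** * The energy balance *)

Section H1size.
Context {R : realType}.
Local Notation leb := (@lebesgue_measure R).
Local Notation I01 := (`]0, 1[%classic : set R).
Implicit Types (u v z g : R -> R).

Definition H1size v : R := L2norm v + L2norm (wderiv v).

Lemma H1size_ge0 v : 0 <= H1size v.
Proof. by rewrite addr_ge0 ?L2norm_ge0. Qed.

Lemma L2norm_le_H1size v : L2norm v <= H1size v.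
Proof. by rewrite lerDl L2norm_ge0. Qed.

Lemma L2norm_wderiv_le_H1size v : L2norm (wderiv v) <= H1size v.
Proof. by rewrite lerDr L2norm_ge0. Qed.

(** |v x| - |v_x| <= |v y| for every y; averaging over y gives the embedding with constant 1. *)
Lemma sup_le_H1size v x : H1 v -> 0 <= x <= 1 -> `|v x| <= H1size v.
Proof.
move=> Hv x01; have pv := H1_is_primitive Hv; have Lv := H1_L2 Hv.
rewrite -lerBlDr.
have <- : \int[leb]_(y in `]0, 1[) (`|v x| - L2norm (wderiv v)) = `|v x| - L2norm (wderiv v).
  by rewrite Rintegral_oo_cst// subr0 mulr1.
rewrite (le_trans _ (Rintegral_normr_oo_le Lv (lexx 0) ler01 (lexx 1)))//.
apply: le_Rintegral => //; [exact: integrable_oo_cst|exact/L2_integrable/L2_normr|].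
move=> y; rewrite /= in_itv/= => /andP[y0 y1]; rewrite lerBlDr -lerBlDl.
rewrite (le_trans (lerB_dist _ _))// (is_primitive_dist_le pv)//.
by rewrite !ltW.
Qed.

Lemma L2norm_bounded_mul M u g : 0 <= M -> measurable_fun I01 u ->
  (forall x, I01 x -> `|u x| <= M) -> L2 g -> L2norm (fun x => u x * g x) <= M * L2norm g.
Proof.
move=> M0 mu uM Lg; have Lug := L2_bounded_mul mu uM Lg.
rewrite -(ler_pXn2r (n:=2)) ?nnegrE ?mulr_ge0 ?L2norm_ge0//.
rewrite exprMn !sqr_L2norm -ipZl//.
apply: le_Rintegral => //; [exact: L2_integrable_mul|apply: L2_integrable_mul => //; exact: L2Z|].
move=> x Ix; have -> : u x * g x * (u x * g x) = u x ^+ 2 * g x ^+ 2 by ring.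
have -> : M ^+ 2 * g x * g x = M ^+ 2 * g x ^+ 2 by ring.
rewrite ler_wpM2r ?sqr_ge0// -(real_normK (num_real (u x))).
by rewrite lerXn2r ?nnegrE ?uM.
Qed.

Lemma H1_L2norm_mul_le v g : H1 v -> L2 g -> L2norm (fun x => v x * g x) <= H1size v * L2norm g.
Proof.
move=> Hv Lg; apply: L2norm_bounded_mul => //; [exact: H1size_ge0|by apply: L2_measurable; exact:
  H1_L2|].
by move=> x; rewrite /= in_itv/= => /andP[x0 x1]; rewrite sup_le_H1size// !ltW.
Qed.

Lemma H1_L2_mul v g : H1 v -> L2 g -> L2 (fun x => v x * g x).
Proof. by move=> /H1_is_primitive pv; exact: is_primitive_L2_mul pv. Qed.

End H1size.

(** * The part of the weak form without time derivatives *)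

Section flux.
Context {R : realType}.
Variables (nu wd c0 c1 : R).
Hypotheses (nu0 : 0 < nu) (wd0 : 0 <= wd) (c00 : 0 < c0) (c10 : 0 < c1).
Implicit Types (v z : R -> R).

Definition flux v z := nu * ip (wderiv v) (wderiv z) + (1 + wd) * ip (wderiv v) z
  + ip (fun x => v x * wderiv v x) z
  + (((c0 + 1 + wd) * v 0 + 2 / (9 * c0) * v 0 ^+ 3) * z 0
     + ((c1 + 1 + wd) * v 1 + 2 / (9 * c1) * v 1 ^+ 3) * z 1).

Lemma flux_self z : H1 z -> flux z z = nu * L2norm (wderiv z) ^+ 2
  + (1 + wd) * ((z 1 ^+ 2 - z 0 ^+ 2) / 2) + (z 1 ^+ 3 - z 0 ^+ 3) / 3
  + (((c0 + (1 + wd)) * z 0 + 2 / (9 * c0) * z 0 ^+ 3) * z 0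
     + ((c1 + (1 + wd)) * z 1 + 2 / (9 * c1) * z 1 ^+ 3) * z 1).
Proof.
move=> Hz; have pz := H1_is_primitive Hz; have Lz := H1_L2 Hz; have Lg := H1_L2_wderiv Hz.
have i2 : ip (wderiv z) z = (z 1 ^+ 2 - z 0 ^+ 2) / 2.
  by have := is_primitive_ip pz pz; rewrite (ipC z); lra.
have i3 : ip (fun x => z x * wderiv z x) z = (z 1 ^+ 3 - z 0 ^+ 3) / 3.
  have := is_primitive_ip (is_primitiveM pz pz) pz.
  have -> : ip (fun x => z x * wderiv z x + z x * wderiv z x) z = 2 * ip (fun x => z x * wderiv z
    x) z.
    rewrite -ipZl//; last exact: H1_L2_mul.
    by apply: eq_ip => x _ //; ring.
  have -> : ip (fun x => z x * z x) (wderiv z) = ip (fun x => z x * wderiv z x) z.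
    by apply: eq_Rintegral => x _; ring.
  by lra.
by rewrite /flux i2 i3 sqr_L2norm !addrA.
Qed.

Lemma normr_mul_le (a b A B : R) : `|a| <= A -> `|b| <= B -> `|a * b| <= A * B.
Proof. by move=> aA bB; rewrite normrM ler_pM. Qed.

(** The test function is the same in both terms: this is the cost of replacing w(r) by w(s) in the
    equation at time r tested with w(s). Products are changed one factor at a time, with traces and
    sup norms bounded by [H1size]. *)
Lemma flux_lipschitz B : 0 <= B -> exists2 C, 0 <= C & forall v z, H1 v -> H1 z ->
  H1size v <= B -> H1size z <= B -> `|flux v z - flux z z| <= C * H1size (v \- z).
Proof.
move=> B0.
pose a0 := c0 + 1 + wd; pose a1 := c1 + 1 + wd.
pose k0 := 2 / (9 * c0); pose k1 := 2 / (9 * c1).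
have a00 : 0 <= a0 by rewrite /a0 !addr_ge0// ltW.
have a10 : 0 <= a1 by rewrite /a1 !addr_ge0// ltW.
have k00 : 0 <= k0 by rewrite /k0 divr_ge0// mulr_ge0// ltW.
have k10 : 0 <= k1 by rewrite /k1 divr_ge0// mulr_ge0// ltW.
exists (nu * B + (1 + wd) * B + 2 * B * B + (a0 + k0 * (3 * B ^+ 2)) * B + (a1 + k1 * (3 * B ^+
  2)) * B).
  have B2 : 0 <= 3 * B ^+ 2 by rewrite mulr_ge0 ?sqr_ge0.
  have wd1 : 0 <= 1 + wd by rewrite addr_ge0.
  have p0 : 0 <= a0 + k0 * (3 * B ^+ 2) by rewrite addr_ge0// mulr_ge0.
  have p1 : 0 <= a1 + k1 * (3 * B ^+ 2) by rewrite addr_ge0// mulr_ge0.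
  apply: addr_ge0; last by rewrite mulr_ge0.
  apply: addr_ge0; last by rewrite mulr_ge0.
  apply: addr_ge0; last by rewrite !mulr_ge0.
  by apply: addr_ge0; rewrite mulr_ge0// ltW.
move=> v z Hv Hz vB zB; set D := H1size (v \- z).
have Hd := H1B Hv Hz; have D0 : 0 <= D by exact: H1size_ge0.
have Lv := H1_L2 Hv; have Lz := H1_L2 Hz.
have Lgv := H1_L2_wderiv Hv; have Lgz := H1_L2_wderiv Hz; have Lgd := H1_L2_wderiv Hd.
have gdD : L2norm (wderiv v \- wderiv z) <= D.
  by rewrite -L2norm_wderivB// L2norm_wderiv_le_H1size.
have zB' : L2norm z <= B by exact: le_trans (L2norm_le_H1size _) zB.
have gzB : L2norm (wderiv z) <= B by exact: le_trans (L2norm_wderiv_le_H1size _) zB.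
have gvB : L2norm (wderiv v) <= B by exact: le_trans (L2norm_wderiv_le_H1size _) vB.
have Lgg : L2 (wderiv v \- wderiv z) by exact: L2B.
have t1 : `|ip (wderiv v \- wderiv z) (wderiv z)| <= D * B.
  exact: le_trans (normr_ip_le Lgg Lgz) (ler_pM (L2norm_ge0 _) (L2norm_ge0 _) gdD gzB).
have t2 : `|ip (wderiv v \- wderiv z) z| <= D * B.
  exact: le_trans (normr_ip_le Lgg Lz) (ler_pM (L2norm_ge0 _) (L2norm_ge0 _) gdD zB').
have Ldv : L2 (fun x => (v \- z) x * wderiv v x) by exact: H1_L2_mul.
have Lzg : L2 (fun x => z x * (wderiv v \- wderiv z) x) by exact: H1_L2_mul.
have t3 : `|ip (fun x => (v \- z) x * wderiv v x) z| <= D * B * B.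
  apply: le_trans (normr_ip_le Ldv Lz) (ler_pM (L2norm_ge0 _) (L2norm_ge0 _) _ zB').
  exact: le_trans (H1_L2norm_mul_le Hd Lgv) (ler_wpM2l D0 gvB).
have t4 : `|ip (fun x => z x * (wderiv v \- wderiv z) x) z| <= B * D * B.
  apply: le_trans (normr_ip_le Lzg Lz) (ler_pM (L2norm_ge0 _) (L2norm_ge0 _) _ zB').
  exact: le_trans (H1_L2norm_mul_le Hz Lgg) (ler_pM (H1size_ge0 _) (L2norm_ge0 _) zB gdD).
have i1 : ip (wderiv v) (wderiv z) - ip (wderiv z) (wderiv z) = ip (wderiv v \- wderiv z) (wderiv
  z).
  by rewrite ipBl.
have i2 : ip (wderiv v) z - ip (wderiv z) z = ip (wderiv v \- wderiv z) z by rewrite ipBl.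
have i3 : ip (fun x => v x * wderiv v x) z - ip (fun x => z x * wderiv z x) z =
    ip (fun x => (v \- z) x * wderiv v x) z + ip (fun x => z x * (wderiv v \- wderiv z) x) z.
  rewrite -(ipBl (H1_L2_mul Hv Lgv) (H1_L2_mul Hz Lgz) Lz) -(ipDl Ldv Lzg Lz).
  by apply: eq_ip => x _ //=; ring.
have bd x a k : 0 <= x <= 1 -> 0 <= a -> 0 <= k ->
    `|(a * v x + k * v x ^+ 3) * z x - (a * z x + k * z x ^+ 3) * z x| <=
    (a + k * (3 * B ^+ 2)) * B * D.
  move=> x01 a0' k0'.
  have vx := le_trans (sup_le_H1size Hv x01) vB; have zx := le_trans (sup_le_H1size Hz x01) zB.
  have dx : `|v x - z x| <= D := sup_le_H1size Hd x01.
  have -> : (a * v x + k * v x ^+ 3) * z x - (a * z x + k * z x ^+ 3) * z x =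
    (a + k * (v x * v x + v x * z x + z x * z x)) * z x * (v x - z x) by ring.
  apply: normr_mul_le => //; apply: normr_mul_le => //.
  rewrite (le_trans (ler_normD _ _))// (ger0_norm a0') lerD2l normrM (ger0_norm k0') ler_wpM2l//.
  rewrite (le_trans (ler_normD _ _))//.
  have -> : 3 * B ^+ 2 = B * B + B * B + B * B by ring.
  by rewrite lerD// ?normr_mul_le// (le_trans (ler_normD _ _))// lerD// normr_mul_le.
have b0 := bd 0 a0 k0 ltac:(by rewrite lexx ler01) a00 k00.
have b1 := bd 1 a1 k1 ltac:(by rewrite lexx ler01) a10 k10.
have -> : flux v z - flux z z = nu * ip (wderiv v \- wderiv z) (wderiv z)
  + (1 + wd) * ip (wderiv v \- wderiv z) z
  + (ip (fun x => (v \- z) x * wderiv v x) z + ip (fun x => z x * (wderiv v \- wderiv z) x) z)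
  + ((a0 * v 0 + k0 * v 0 ^+ 3) * z 0 - (a0 * z 0 + k0 * z 0 ^+ 3) * z 0)
  + ((a1 * v 1 + k1 * v 1 ^+ 3) * z 1 - (a1 * z 1 + k1 * z 1 ^+ 3) * z 1).
  rewrite -i1 -i2 -i3 /flux -/a0 -/a1 -/k0 -/k1.
  move: (ip _ _) (ip _ _) (ip _ _) (ip _ _) (ip _ _) (ip _ _) => x1 x2 x3 x4 x5 x6.
  by ring.
have c1' : `|nu * ip (wderiv v \- wderiv z) (wderiv z)| <= nu * (D * B).
  by rewrite normrM gtr0_norm// ler_pM2l.
have c2 : `|(1 + wd) * ip (wderiv v \- wderiv z) z| <= (1 + wd) * (D * B).
  by rewrite normrM ger0_norm ?addr_ge0// ler_wpM2l ?addr_ge0.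
apply: le_trans (ler_normD _ _) _.
apply: le_trans (lerD (le_trans (ler_normD _ _) (lerD (le_trans (ler_normD _ _) (lerD
  (le_trans (ler_normD _ _) (lerD c1' c2)) (le_trans (ler_normD _ _) (lerD t3 t4)))) b0)) b1) _.
by rewrite le_eqVlt; apply/orP; left; apply/eqP; ring.
Qed.

End flux.

Local Opaque wderiv L2norm ip.

(** * The energy and its first variation *)

Section closed_loop.
Context {R : realType}.
Local Notation leb := (@lebesgue_measure R).
Variables (mu nu wd : R) (c : 'I_2 -> R).
Let c0 := c ord0.
Let c1 := c (lift ord0 ord0).
Implicit Types (v vt z : R -> R).

Lemma E1E v : E1 wd c v = (c0 + (1 + wd) + 1 / (3 * c0) * v 0 ^+ 2) * v 0 ^+ 2
  + (c1 + (1 + wd) + 1 / (3 * c1) * v 1 ^+ 2) * v 1 ^+ 2.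
Proof. by rewrite /E1 !big_ord_recl big_ord0 addr0 /= !(addrA c0) !(addrA c1). Qed.

Lemma weak_formE v vt z : weak_form mu nu wd c v vt z ->
  ip vt z + mu * ip (wderiv vt) (wderiv z) + mu / nu *
    ((c0 + 1 + wd + 2 / (3 * c0) * v 0 ^+ 2) * vt 0 * z 0 +
     (c1 + 1 + wd + 2 / (3 * c1) * v 1 ^+ 2) * vt 1 * z 1)
  = - flux nu wd c0 c1 v z.
Proof.
rewrite /weak_form !big_ord_recl !big_ord0 !addr0 /= => h.
apply/eqP; rewrite -subr_eq0 opprK -[X in _ == X]h /flux -/c0 -/c1.
apply/eqP; move: (ip _ _) (ip _ _) (ip _ _) (ip _ _) (ip _ _) => x1 x2 x3 x4 x5.
by ring.
Qed.

Definition energy v : R :=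
  L2norm v ^+ 2 + mu * L2norm (wderiv v) ^+ 2 + mu / nu * E1 wd c v.

(* The derivative of [energy] at [z] in the direction [v], halved. *)
Definition energy_form z v : R := ip v z + mu * ip (wderiv v) (wderiv z) + mu / nu *
    ((c0 + 1 + wd + 2 / (3 * c0) * z 0 ^+ 2) * v 0 * z 0 +
     (c1 + 1 + wd + 2 / (3 * c1) * z 1 ^+ 2) * v 1 * z 1).

(** Puts the form in the shape that [H1_increment_le] accepts. With A and B the coefficients of v 0
    and v 1, [trace0] and [trace1] contribute A + B to xi and A (x - 1) + B x to eta. *)
Lemma energy_form_ip z : H1 z -> exists xi eta, [/\ L2 xi, L2 eta &
  forall v, H1 v -> energy_form z v = ip v xi + ip (wderiv v) eta].
Proof.
move=> Hz; have Lz := H1_L2 Hz; have Lg := H1_L2_wderiv Hz.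
pose A := mu / nu * ((c0 + 1 + wd + 2 / (3 * c0) * z 0 ^+ 2) * z 0).
pose B := mu / nu * ((c1 + 1 + wd + 2 / (3 * c1) * z 1 ^+ 2) * z 1).
have L1 : L2 (fun _ : R => 1) by exact: L2_cst.
have Lid := is_primitive_L2 (@is_primitive_id R).
have Lid1 : L2 (fun x : R => x - 1) by exact: L2B Lid L1.
have LA := L2Z A Lid1; have LB := L2Z B Lid; have Lmu := L2Z mu Lg.
have LAB : L2 ((fun x => A * (x - 1)) \+ (fun x => B * x)) by exact: L2D.
exists (z \+ (fun x => (A + B) * 1)).
exists ((fun x => mu * wderiv z x) \+ ((fun x => A * (x - 1)) \+ (fun x => B * x))); split.
- exact: L2D Lz (L2Z _ L1).
- exact: L2D Lmu LAB.
move=> v Hv; have Lv := H1_L2 Hv; have Lgv := H1_L2_wderiv Hv.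
have pv := H1_is_primitive Hv.
have -> : ip v (z \+ (fun=> (A + B) * 1)) = ip v z + (A + B) * ip v (fun=> 1).
  by rewrite (ipDr Lz (L2Z _ L1) Lv) (ipZr _ L1 Lv).
have -> : ip (wderiv v) ((fun x => mu * wderiv z x) \+ ((fun x => A * (x - 1)) \+ (fun x => B *
  x))) =
    mu * ip (wderiv v) (wderiv z) + (A * ip (wderiv v) (fun x => x - 1) + B * ip (wderiv v) id).
  by rewrite (ipDr Lmu LAB Lgv) (ipDr LA LB Lgv) (ipZr _ Lg Lgv) (ipZr _ Lid1 Lgv) (ipZr _ Lid Lgv).
have t0 := trace0 pv; have t1 := trace1 pv.
rewrite /energy_form; move: t0 t1.
have -> : mu / nu * ((c0 + 1 + wd + 2 / (3 * c0) * z 0 ^+ 2) * v 0 * z 0 +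
  (c1 + 1 + wd + 2 / (3 * c1) * z 1 ^+ 2) * v 1 * z 1) = A * v 0 + B * v 1 by rewrite /A /B; ring.
move: A B (v 0) (v 1) {LA LB LAB} => A B v0 v1 -> ->.
move: (ip _ _) (ip _ _) (ip _ _) (ip _ _) (ip _ _) => x1 x2 x3 x4 x5.
by ring.
Qed.

(** An exact expansion: the norms are quadratic, and the quartic traces satisfy v^4 - z^4 - 4 z^3 (v
    - z) = (v - z)^2 (v^2 + 2 v z + 3 z^2). The whole remainder is thus of second order in v - z. *)
Lemma energy_increment z v : H1 z -> H1 v -> energy v - energy z =
  2 * energy_form z (v \- z) + L2norm (v \- z) ^+ 2 + mu * L2norm (wderiv (v \- z)) ^+ 2
  + mu / nu * ((c0 + 1 + wd + 1 / (3 * c0) * (v 0 ^+ 2 + 2 * v 0 * z 0 + 3 * z 0 ^+ 2)) * (v 0 -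
    z 0) ^+ 2
    + (c1 + 1 + wd + 1 / (3 * c1) * (v 1 ^+ 2 + 2 * v 1 * z 1 + 3 * z 1 ^+ 2)) * (v 1 - z 1) ^+ 2).
Proof.
move=> Hz Hv; have Lz := H1_L2 Hz; have Lv := H1_L2 Hv.
have Lgz := H1_L2_wderiv Hz; have Lgv := H1_L2_wderiv Hv.
have f1 := ipBl Lv Lz Lz.
have f2 := sqr_L2normB Lv Lz.
have f3 := ip_wderivB Hv Hz Lgz.
have f4 := etrans (congr1 (fun x => x ^+ 2) (L2norm_wderivB Hv Hz)) (sqr_L2normB Lgv Lgz).
rewrite /= in f4.
have f5 : (v \- z) 0 = v 0 - z 0 by [].
have f6 : (v \- z) 1 = v 1 - z 1 by [].
rewrite /energy /energy_form !E1E; move: f1 f2 f3 f4 f5 f6; set d := v \- z; move: d => d.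
move: (wderiv d) (wderiv v) (wderiv z) => gd gv gz f1 f2 f3 f4 f5 f6.
rewrite f1 f2 f3 f4 f5 f6 (sqr_L2norm v) (sqr_L2norm z) (sqr_L2norm gv) (sqr_L2norm gz).
have -> : 2 / (3 * c0) = 2 * (1 / (3 * c0)) by rewrite mul1r.
have -> : 2 / (3 * c1) = 2 * (1 / (3 * c1)) by rewrite mul1r.
move: (ip v v) (ip z z) (ip v z) (ip gv gv) (ip gz gz) (ip gv gz) (1 / (3 * c0)) (1 / (3 * c1))
  (v 0) (v 1) (z 0) (z 1) (mu / nu).
by move=> *; ring.
Qed.

End closed_loop.

Section energy_balance.
Context {R : realType}.
Local Notation leb := (@lebesgue_measure R).
Variables (mu nu wd : R) (c : 'I_2 -> R).
Let c0 := c ord0.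
Let c1 := c (lift ord0 ord0).
Hypotheses (mu0 : 0 < mu) (nu0 : 0 < nu) (wd0 : 0 <= wd) (hc : forall i, 0 < c i).
Variables (T : R) (w wt : R -> R -> R) (m : R -> R).
Hypothesis wH1 : forall t : R, 0 <= t -> H1 (w t).
Hypothesis wc : forall t : R, 0 <= t ->
  L2norm (w s \- w t) @[s --> within `[0, +oo[ (nbhs t)] --> (0 : R).
Hypothesis wwt : weak_time_deriv T w wt.
Hypothesis m0 : forall t, 0 <= m t.
Hypothesis mm : measurable_fun `]0, T[ m.
Hypothesis im2 : leb.-integrable `]0, T[ (EFin \o (fun t => m t ^+ 2)).
Hypothesis wtm : {ae leb, forall t, `]0, T[%classic t ->
  [/\ H1 (wt t), L2norm (wt t) <= m t & L2norm (wderiv (wt t)) <= m t]}.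
Hypothesis wf : {ae leb, forall t : R, 0 < t ->
  forall chi, H1 chi -> weak_form mu nu wd c (w t) (wt t) chi}.

Local Notation J s t := (\int[leb]_(r in `]s, t[) m r).
Local Notation M s t := (\int[leb]_(r in `]s, t[) (m r ^+ 2)).

Lemma majorant_le_sub s t s' t' : 0 <= s -> s <= s' -> s' <= t' -> t' <= t -> t <= T ->
  J s' t' <= J s t.
Proof.
move=> s0 ss st tt tT; apply: Rintegral_oo_le_sub => //.
exact: (@majorant_integrable_oo R T m mm im2 s t s0 tT).
Qed.

Lemma majorant_ge0 s t : 0 <= J s t.
Proof. exact: Rintegral_ge0. Qed.

Lemma H1size_increment_le s t : 0 <= s -> s < t -> t <= T ->
  H1size (w t \- w s) <= 2 * J s t.
Proof.
move=> s0 st tT.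
have [h1 h2] := @L2norm_increment_le R T w wt m wH1 wc wwt m0 mm im2 wtm s t s0 st tT.
by rewrite /H1size mulr_natl mulr2n lerD.
Qed.

Lemma H1size_le_dist (u v : R -> R) : H1 u -> H1 v -> H1size u <= H1size (u \- v) + H1size v.
Proof.
move=> Hu Hv.
have h1 := le_trans (ler_norm _) (ler_dist_L2norm (H1_L2 Hu) (H1_L2 Hv)).
have := le_trans (ler_norm _) (ler_dist_L2norm (H1_L2_wderiv Hu) (H1_L2_wderiv Hv)).
rewrite -L2norm_wderivB// => h2; rewrite /H1size.
move: h1 h2; move: (L2norm _) (L2norm _) (L2norm _) (L2norm _) (L2norm _) (L2norm _) => *; lra.
Qed.

(** Obtained from the majorant alone, before any energy estimate, so that all Lipschitz constants
    are uniform on [0, T]. *)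
Lemma H1size_bounded : exists2 B, 0 <= B & forall t, 0 <= t <= T -> H1size (w t) <= B.
Proof.
exists (2 * J 0 T + H1size (w 0)).
  by rewrite addr_ge0 ?H1size_ge0// mulr_ge0// majorant_ge0.
move=> t /andP[]; rewrite le_eqVlt => /predU1P[<- _|t0 tT].
  by rewrite lerDr mulr_ge0// majorant_ge0.
apply: le_trans (H1size_le_dist (wH1 (ltW t0)) (wH1 (lexx 0))) _.
rewrite lerD2r (le_trans (H1size_increment_le (lexx 0) t0 tT))// ler_pM2l//.
exact: majorant_le_sub (lexx 0) (lexx 0) (ltW t0) tT (lexx T).
Qed.

Lemma wt_trace_le r i : 0 <= i <= 1 -> [/\ H1 (wt r), L2norm (wt r) <= m r & L2norm (wderiv (wt
  r)) <= m r] ->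
  `|wt r i| <= 2 * m r.
Proof.
move=> i01 [Hr h1 h2]; rewrite (le_trans (sup_le_H1size Hr i01))//.
by rewrite /H1size mulr_natl mulr2n lerD.
Qed.

(** The cost of moving the coefficient w^2 of the boundary term w^2 w_t from time r to time s: p, q
    and x stand for w(s), w(r) and w_t(r) at an end point. *)
Lemma trace_perturbation_le B D k r p q x : 0 <= k -> 0 <= D -> 0 <= B -> 0 <= m r ->
  `|q - p| <= D -> `|p| <= B -> `|q| <= B -> `|x| <= 2 * m r ->
  `|k * (q ^+ 2 - p ^+ 2) * x * p| <= k * 4 * B ^+ 2 * D * m r.
Proof.
move=> k0 D0 B0 mr0 qp pB qB xm.
have -> : k * (q ^+ 2 - p ^+ 2) * x * p = k * (q - p) * (q + p) * x * p by ring.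
have -> : k * 4 * B ^+ 2 * D * m r = k * D * (B + B) * (2 * m r) * B by ring.
apply: normr_mul_le => //; apply: normr_mul_le => //; apply: normr_mul_le => //.
  by apply: normr_mul_le => //; rewrite ger0_norm.
by rewrite (le_trans (ler_normD _ _))// lerD.
Qed.

Lemma energy_increment_le : exists2 C, 0 <= C & forall s t, 0 <= s -> s < t -> t <= T ->
  energy mu nu wd c (w t) - energy mu nu wd c (w s) <=
  - (2 * (t - s) * flux nu wd c0 c1 (w s) (w s)) + C * ((t - s) * (J s t + M s t)).
Proof.
have [B B0 wB] := H1size_bounded.
have c00 : 0 < c0 by exact: hc.
have c10 : 0 < c1 by exact: hc.
have [CF CF0 fluxL] := @flux_lipschitz R nu wd c0 c1 nu0 wd0 c00 c10 B B0.
have B2 : 0 <= B ^+ 2 by exact: sqr_ge0.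
have mn0 : 0 <= mu / nu by rewrite divr_ge0// ltW.
pose k0 := 2 / (3 * c0); pose k1 := 2 / (3 * c1).
have k00 : 0 <= k0 by rewrite divr_ge0// mulr_ge0// ltW.
have k10 : 0 <= k1 by rewrite divr_ge0// mulr_ge0// ltW.
pose C1 := mu / nu * (k0 * 4 * B ^+ 2 * 2 + k1 * 4 * B ^+ 2 * 2).
have C10 : 0 <= C1.
  by apply: mulr_ge0 => //; apply: addr_ge0; do 3 (apply: mulr_ge0 => //).
(* The factor of J^2 in the remainder of [energy_increment]: v^2 + 2 v z + 3 z^2 is at most 6 B^2,
   and traces move by at most 2 J, whence the 4. *)
pose C2 := 1 + mu + mu / nu * ((c0 + 1 + wd + 1 / (3 * c0) * (6 * B ^+ 2)) * 4 +
  (c1 + 1 + wd + 1 / (3 * c1) * (6 * B ^+ 2)) * 4).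
have a00 : 0 <= c0 + 1 + wd by rewrite !addr_ge0// ltW.
have e00 : 0 <= 1 / (3 * c0) by rewrite divr_ge0// mulr_ge0// ltW.
have a10 : 0 <= c1 + 1 + wd by rewrite !addr_ge0// ltW.
have e10 : 0 <= 1 / (3 * c1) by rewrite divr_ge0// mulr_ge0// ltW.
have f0 : 0 <= c0 + 1 + wd + 1 / (3 * c0) * (6 * B ^+ 2).
  exact: addr_ge0 a00 (mulr_ge0 e00 (mulr_ge0 (ler0n _ 6) B2)).
have f1 : 0 <= c1 + 1 + wd + 1 / (3 * c1) * (6 * B ^+ 2).
  exact: addr_ge0 a10 (mulr_ge0 e10 (mulr_ge0 (ler0n _ 6) B2)).
have C20 : 0 <= C2.
  exact: addr_ge0 (addr_ge0 ler01 (ltW mu0)) (mulr_ge0 mn0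
    (addr_ge0 (mulr_ge0 f0 (ler0n _ 4)) (mulr_ge0 f1 (ler0n _ 4)))).
exists (4 * CF + (2 * C1 + C2)).
  exact: addr_ge0 (mulr_ge0 (ler0n _ 4) CF0) (addr_ge0 (mulr_ge0 (ler0n _ 2) C10) C20).
move=> s t s0 st tT; have t0 : 0 <= t by rewrite (le_trans s0)// ltW.
have Hz := wH1 s0; have Hv := wH1 t0; have Hd := H1B Hv Hz.
have zB : H1size (w s) <= B by apply: wB; rewrite s0 (le_trans (ltW st)).
have vB : H1size (w t) <= B by apply: wB; rewrite t0.
pose j := J s t; have j0 : 0 <= j by exact: majorant_ge0.
have jM : j ^+ 2 <= (t - s) * M s t := @majorant_CS R T m mm im2 s t s0 (ltW st) tT.
have dj : H1size (w t \- w s) <= 2 * j := H1size_increment_le s0 st tT.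
have [dj1 dj2] := @L2norm_increment_le R T w wt m wH1 wc wwt m0 mm im2 wtm s t s0 st tT.
have [xi [eta [Lxi Leta lE]]] := energy_form_ip mu nu wd c Hz.
have i00 : 0 <= (0 : R) <= 1 by rewrite lexx ler01.
have i11 : 0 <= (1 : R) <= 1 by rewrite lexx ler01.
set F := flux nu wd c0 c1 (w s) (w s).
(* [- F + CF * (2 * j)] bounds the flux at time r, and [C1 * j] times [m r] the change of the
   boundary coefficients; integrating [m] supplies the second factor [j]. *)
have form_le : energy_form mu nu wd c (w s) (w t \- w s) <=
    (- F + CF * (2 * j)) * (t - s) + C1 * j * j.
  rewrite lE//.
  apply: (@H1_increment_le R T w wt m wH1 wc wwt m0 mm im2 wtm s t xi eta _ _ s0 st tT Lxi Leta).
  apply: leb_aeS (leb_ae_and wf (@wt_majorant R T wt m wtm s t s0 tT)) => r [wfr wtr].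
  rewrite /= in_itv/= => /andP[sr rt].
  have r0 : 0 < r by exact: le_lt_trans sr.
  have {}wtr := wtr ltac:(by rewrite /= in_itv/= sr rt).
  have [Hr _ _] := wtr; rewrite -lE//.
  have Hw := wH1 (ltW r0); have rT : r <= T by rewrite (le_trans (ltW rt)).
  have rB : H1size (w r) <= B by apply: wB; rewrite ltW.
  have drj : H1size (w r \- w s) <= 2 * j.
    apply: le_trans (H1size_increment_le s0 sr rT) _; rewrite ler_pM2l//.
    exact: majorant_le_sub s0 (lexx s) (ltW sr) (ltW rt) tT.
  have Hdr := H1B Hw Hz.
  have FL : - flux nu wd c0 c1 (w r) (w s) <= - F + CF * (2 * j).
    have := le_trans (fluxL _ _ Hw Hz rB zB) (ler_wpM2l CF0 drj).
    by rewrite ler_distl => /andP[h _]; rewrite lerNl opprD opprK.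
  have wfE := weak_formE (wfr r0 _ Hz).
  have j20 : 0 <= 2 * j by rewrite mulr_ge0.
  have tr i k : 0 <= i <= 1 -> 0 <= k ->
      `|k * (w r i ^+ 2 - w s i ^+ 2) * wt r i * w s i| <= k * 4 * B ^+ 2 * (2 * j) * m r.
    move=> i01 k_0; apply: trace_perturbation_le => //.
    - exact: le_trans (sup_le_H1size Hdr i01) drj.
    - exact: le_trans (sup_le_H1size Hz i01) zB.
    - exact: le_trans (sup_le_H1size Hw i01) rB.
    - exact: wt_trace_le i01 wtr.
  have -> : energy_form mu nu wd c (w s) (wt r) = - flux nu wd c0 c1 (w r) (w s)
      - mu / nu * (k1 * (w r 1 ^+ 2 - w s 1 ^+ 2) * wt r 1 * w s 1
                   + k0 * (w r 0 ^+ 2 - w s 0 ^+ 2) * wt r 0 * w s 0).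
    rewrite -wfE /energy_form -/c0 -/c1 -/k0 -/k1.
    by move: (ip _ _) (ip _ _) (w r 0) (w s 0) (wt r 0) (w r 1) (w s 1) (wt r 1) (mu / nu) => *;
      ring.
  have {}tr i k (h0 : 0 <= i <= 1) (h1 : 0 <= k) : - (k * (w r i ^+ 2 - w s i ^+ 2) * wt r i * w
    s i)
      <= k * 4 * B ^+ 2 * (2 * j) * m r.
    by rewrite (le_trans (ler_norm _))// normrN tr.
  apply: le_trans (lerD FL (_ : _ <= mu / nu * (k1 * 4 * B ^+ 2 * (2 * j) * m r + k0 * 4 * B ^+ 2
    * (2 * j) * m r))) _.
    by rewrite -mulrN ler_wpM2l// opprD lerD// tr.
  by rewrite le_eqVlt /C1; apply/orP; left; apply/eqP; ring.
rewrite energy_increment// -/c0 -/c1.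
have sq (x : R) : 0 <= x -> x <= j -> x ^+ 2 <= j ^+ 2 by move=> x0 xj; rewrite ler_sqr ?nnegrE.
have h1 := sq _ (L2norm_ge0 _) dj1.
have h2 := ler_wpM2l (ltW mu0) (sq _ (L2norm_ge0 _) dj2).
have tr i a e : 0 <= i <= 1 -> 0 <= a -> 0 <= e ->
   (a + e * (w t i ^+ 2 + 2 * w t i * w s i + 3 * w s i ^+ 2)) * (w t i - w s i) ^+ 2 <=
   (a + e * (6 * B ^+ 2)) * (4 * j ^+ 2).
  move=> i01 a0 e0.
  have := le_trans (sup_le_H1size Hd i01) dj.
  have := le_trans (sup_le_H1size Hz i01) zB.
  have := le_trans (sup_le_H1size Hv i01) vB.
  rewrite /=; move: (w t i) (w s i) => p q pB qB pqj.
  have pq2 : (p - q) ^+ 2 <= 4 * j ^+ 2.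
    rewrite -(real_normK (num_real (p - q))).
    have -> : 4 * j ^+ 2 = (2 * j) ^+ 2 by ring.
    rewrite ler_sqr ?nnegrE//; exact: mulr_ge0.
  have p2 : p ^+ 2 <= B ^+ 2 by rewrite -(real_normK (num_real p)) ler_sqr ?nnegrE.
  have q2 : q ^+ 2 <= B ^+ 2 by rewrite -(real_normK (num_real q)) ler_sqr ?nnegrE.
  have pq6 : p ^+ 2 + 2 * p * q + 3 * q ^+ 2 <= 6 * B ^+ 2.
    rewrite -subr_ge0; have -> : 6 * B ^+ 2 - (p ^+ 2 + 2 * p * q + 3 * q ^+ 2) =
      2 * (B ^+ 2 - p ^+ 2) + 4 * (B ^+ 2 - q ^+ 2) + (p - q) ^+ 2 by ring.
    by apply: addr_ge0 (sqr_ge0 _); apply: addr_ge0; apply: mulr_ge0 => //; rewrite subr_ge0.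
  apply: le_trans (ler_wpM2r (sqr_ge0 _) (_ : _ <= a + e * (6 * B ^+ 2))) _.
    by rewrite lerD2l ler_wpM2l.
  by rewrite ler_wpM2l// addr_ge0// mulr_ge0// mulr_ge0.
have h3 := ler_wpM2l mn0 (lerD (tr 0 _ _ i00 a00 e00) (tr 1 _ _ i11 a10 e10)).
have ts0 : 0 <= t - s by rewrite subr_ge0 ltW.
apply: le_trans (lerD (lerD (lerD (ler_wpM2l (ler0n _ 2) form_le) h1) h2) h3) _.
have -> : 2 * ((- F + CF * (2 * j)) * (t - s) + C1 * j * j) + j ^+ 2 + mu * j ^+ 2 +
  mu / nu * ((c0 + 1 + wd + 1 / (3 * c0) * (6 * B ^+ 2)) * (4 * j ^+ 2) +
   (c1 + 1 + wd + 1 / (3 * c1) * (6 * B ^+ 2)) * (4 * j ^+ 2)) =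
  - (2 * (t - s) * F) + (4 * CF * ((t - s) * j) + (2 * C1 + C2) * j ^+ 2).
  by rewrite /C2; ring.
rewrite lerD2l (mulrDr (t - s)) (mulrDl (4 * CF)).
have M0 : 0 <= (t - s) * M s t by rewrite mulr_ge0// Rintegral_ge0// => r _; exact: sqr_ge0.
have j0' : 0 <= (t - s) * j by rewrite mulr_ge0.
have C12 : 0 <= 2 * C1 + C2 by rewrite addr_ge0// mulr_ge0.
apply: lerD; apply: ler_wpM2l => //.
- exact: mulr_ge0.
- by rewrite lerDl.
- by rewrite (le_trans jM)// lerDr.
Qed.

End energy_balance.

(** * Exponential decay *)

Section gronwall.
Context {R : realType}.
Local Notation leb := (@lebesgue_measure R).

Lemma nondecreasing_in_measurable (a b : R) (f : R -> R) : a <= b ->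
  (forall x y, a <= x -> x <= y -> y <= b -> f x <= f y) -> measurable_fun `]a, b[ f.
Proof.
move=> ab fnd.
(* Clamping the argument to [a, b] extends [f] to a monotone function on the whole line. *)
have clampE x : x \in (`]a, b[%classic : set R) -> f (Num.max a (Num.min x b)) = f x.
  by rewrite inE/= in_itv/= => /andP[ax xb]; rewrite min_l ?max_r// ltW.
apply: eq_measurable_fun clampE _; apply: nondecreasing_measurable => // x y xy; apply: fnd.
- by rewrite le_max lexx.
- rewrite ge_max; apply/andP; split; rewrite le_max ?lexx//.
  by apply/orP; right; rewrite le_min !ge_min xy lexx !orbT.
- by rewrite ge_max ab ge_min lexx orbT.
Qed.

(** The hypothesis makes both [K] and q + K nondecreasing, so [q] is a difference of monotone
    functions. This is the source of measurability in time for traces and gradient norms. *)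
Lemma bounded_oscillation_integrable (a b : R) (q K : R -> R) : a <= b ->
  (forall x y, a <= x -> x <= y -> y <= b -> `|q y - q x| <= K y - K x) ->
  leb.-integrable `]a, b[ (EFin \o q).
Proof.
move=> ab qK.
have mK : measurable_fun `]a, b[ K.
  apply: nondecreasing_in_measurable => // x y ax xy yb.
  by rewrite -subr_ge0 (le_trans _ (qK _ _ ax xy yb)).
have mqK : measurable_fun `]a, b[ (q \+ K).
  apply: nondecreasing_in_measurable => // x y ax xy yb /=.
  have := qK _ _ ax xy yb; rewrite ler_norml => /andP[h _].
  by move: h; clear; lra.
have mq : measurable_fun `]a, b[ q.
  apply: (@eq_measurable_fun _ _ _ _ _ ((q \+ K) \- K)); last exact: measurable_funB.
  by move=> x _ /=; rewrite addrK.
apply: (@integrable_bounded _ _ a b _ (`|q a| + (K b - K a))) => //.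
  exact: subset_itv_oo_cc.
move=> x; rewrite /= in_itv/= => /andP[/ltW ax /ltW xb].
have h1 := qK _ _ (lexx a) ax xb.
have h2 := le_trans (normr_ge0 _) (qK _ _ ax xb (lexx b)).
have h3 := lerB_dist (q x) (q a).
by move: h1 h2 h3; clear; lra.
Qed.

(* A Gronwall inequality for functions that need not be differentiable: the
   error [(y - x) * (K y - K x)] summed over a partition tends to 0 with the mesh. *)
Lemma increment_gronwall (k b T : R) (Phi Q K : R -> R) : 0 <= k -> 0 <= T ->
  (forall t, 0 <= Phi t) ->
  (forall x y, 0 <= x -> x <= y -> y <= T ->
    Phi y - Phi x <= - ((y - x) * (k * Phi x + b * Q x)) + (y - x) * (K y - K x)) ->
  (forall x y, 0 <= x -> x <= y -> y <= T -> `|Q y - Q x| <= K y - K x) ->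
  expR (k * T) * Phi T + b * \int[leb]_(r in `[0, T]) (expR (k * r) * Q r) <= Phi 0.
Proof.
move=> k0 T0 Phi0 PhiK QK.
pose q r := expR (k * r) * Q r.
pose QT := `|Q 0| + (K T - K 0).
have QTP x : 0 <= x -> x <= T -> `|Q x| <= QT.
  move=> x0 xT.
  have h1 := QK _ _ (lexx 0) x0 xT.
  have h2 := le_trans (normr_ge0 _) (QK _ _ x0 xT (lexx T)).
  have h3 := lerB_dist (Q x) (Q 0).
  by move: h1 h2 h3; rewrite /QT; clear; lra.
have QT0 : 0 <= QT := le_trans (normr_ge0 _) (QTP _ (lexx 0) T0).
pose Kq x := expR (k * T) * K x + QT * expR (k * x).
have e_nd x y : x <= y -> expR (k * x) <= expR (k * y) by move=> xy; rewrite ler_expR ler_wpM2l.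
(* The mixed value exp(k y) Q x appears because the increment of exp(k .) Phi is taken as exp(k y)
   (Phi y - Phi x) plus (exp(k y) - exp(k x)) Phi x, with [Q] known at the earlier time. *)
have qK x y z : 0 <= x -> x <= z -> z <= y -> y <= T ->
    `|expR (k * z) * Q z - expR (k * y) * Q x| <= Kq y - Kq x.
  move=> x0 xz zy yT; have zT := le_trans zy yT; have z0 := le_trans x0 xz.
  have -> : expR (k * z) * Q z - expR (k * y) * Q x =
    expR (k * y) * (Q z - Q x) - (expR (k * y) - expR (k * z)) * Q z by ring.
  have e0 : 0 <= expR (k * y) - expR (k * z) by rewrite subr_ge0 e_nd.
  rewrite (le_trans (ler_normB _ _))// !normrM (ger0_norm e0) (ger0_norm (expR_ge0 _)).
  have h1 := QK _ _ x0 xz zT.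
  have h2 := le_trans (normr_ge0 _) (QK _ _ z0 zy yT).
  have h3 : expR (k * y) * `|Q z - Q x| <= expR (k * T) * (K y - K x).
    by apply: ler_pM => //; [exact: e_nd|move: h1 h2; clear; lra].
  have h4 : (expR (k * y) - expR (k * z)) * `|Q z| <= (expR (k * y) - expR (k * x)) * QT.
    by apply: ler_pM => //; [rewrite lerD2l lerN2 e_nd|exact: QTP].
  by rewrite /Kq; move: h3 h4; clear; lra.
have qi x : 0 <= x -> x <= T -> leb.-integrable `]0, x[ (EFin \o q).
  move=> x0 xT; apply: (@bounded_oscillation_integrable _ _ _ (fun x => 2 * Kq x)) => // y z y0
    yz zx.
  have h1 := qK _ _ _ y0 (lexx y) yz (le_trans zx xT).
  have h2 := qK _ _ _ y0 yz (lexx z) (le_trans zx xT).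
  have := ler_distD (expR (k * z) * Q y) (q z) (q y); rewrite (distrC (expR (k * z) * Q y) (q y)).
  by move: h1 h2; rewrite /q; clear; lra.
pose G x := expR (k * x) * Phi x + b * \int[leb]_(r in `]0, x[) q r.
have : G T <= G 0.
  apply: (@increment_le_by_partition R G (fun x => expR (k * T) * K x + `|b| * Kq x)) => // x y
    x0 xy yT.
  have y0 := le_trans x0 xy; have yx0 : 0 <= y - x by rewrite subr_ge0.
  have qxy : leb.-integrable `]x, y[ (EFin \o q).
    by apply: integrableS (qi y y0 yT) => //; apply: subset_itvr; rewrite bnd_simp.
  have iq : `|\int[leb]_(r in `]x, y[) q r - (y - x) * (expR (k * y) * Q x)| <= (y - x) * (Kq y -
    Kq x).
    have cst c : \int[leb]_(r in `]x, y[) c = (y - x) * c by rewrite Rintegral_oo_cst// mulrC.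
    have icst c : leb.-integrable `]x, y[ (EFin \o (fun=> c)) by exact: integrable_oo_cst.
    have near z : `]x, y[%classic z -> `|q z - expR (k * y) * Q x| <= Kq y - Kq x.
      by rewrite /= in_itv/= => /andP[/ltW xz /ltW zy]; exact: qK.
    rewrite ler_distl -mulrBr -mulrDr -!cst; apply/andP; split.
      by apply: le_Rintegral => // z /near; rewrite ler_distl => /andP[].
    by apply: le_Rintegral => // z /near; rewrite ler_distl => /andP[].
  rewrite /G (Rintegral_oo_split x0 xy (qi y y0 yT)).
  (* From 1 + u <= exp u at u = k (x - y). Times Phi x, the right side is cancelled by the decay
     term - k Phi x of the increment. *)
  have ey : expR (k * y) - expR (k * x) <= k * (y - x) * expR (k * y).
    have := expR_ge1Dx (k * x - k * y).
    rewrite -(ler_pM2r (expR_gt0 (k * y))) -expRD subrK; move: (expR _) (expR _) => ex ey'.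
    by clear; lra.
  have h1 := ler_wpM2l (expR_ge0 (k * y)) (PhiK _ _ x0 xy yT).
  have h2 := ler_wpM2r (Phi0 x) ey.
  have h3 : expR (k * y) * ((y - x) * (K y - K x)) <= expR (k * T) * ((y - x) * (K y - K x)).
    rewrite ler_wpM2r ?e_nd// mulr_ge0//.
    exact: le_trans (normr_ge0 _) (QK _ _ x0 xy yT).
  have h4 : b * (\int[leb]_(r in `]x, y[) q r - (y - x) * (expR (k * y) * Q x)) <=
      `|b| * ((y - x) * (Kq y - Kq x)).
    by rewrite (le_trans (ler_norm _))// normrM ler_wpM2l.
  move: h1 h2 h3 h4.
  move: (Phi x) (Phi y) (Q x) (K x) (K y) (Kq x) (Kq y) (expR _) (expR _) (expR _) `|b|
    (\int[leb]_(r in `]x, y[) q r) (\int[leb]_(r in `]0, x[) q r).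
  clear => p1 p2 q1 k1 k2 u1 u2 e1 e2 e3 bb i1 i2 h1 h2 h3 h4.
  have := lerD (lerD h1 h2) (lerD h3 h4).
  rewrite -subr_ge0 => h; rewrite -subr_ge0; apply: le_trans h _.
  by rewrite le_eqVlt; apply/orP; left; apply/eqP; ring.
rewrite -(Rintegral_oo_cc (qi T T0 (lexx T))) /G mulr0 expR0 mul1r (@set_itv_ge _ _ (BRight 0)
  (BLeft 0)) ?Rintegral_set0 ?mulr0 ?addr0//.
by rewrite -leNgt bnd_simp.
Qed.

End gronwall.

(** * From the energy balance to the decay estimate *)

Section decay.
Context {R : realType}.
Local Notation leb := (@lebesgue_measure R).
Variables (mu nu wd : R) (c : 'I_2 -> R).
Hypotheses (mu0 : 0 < mu) (nu0 : 0 < nu) (wd0 : 0 <= wd) (hc : forall i, 0 < c i).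

Lemma E1_ge0 (v : R -> R) : 0 <= E1 wd c v.
Proof.
apply: sumr_ge0 => i _; rewrite mulr_ge0 ?sqr_ge0// addr_ge0//.
  by rewrite !addr_ge0// ltW.
by rewrite mulr_ge0 ?sqr_ge0// divr_ge0// mulr_ge0// ltW.
Qed.

Lemma energy_ge0 (v : R -> R) : 0 <= energy mu nu wd c v.
Proof.
apply: addr_ge0; last by rewrite mulr_ge0 ?E1_ge0// divr_ge0// ltW.
by rewrite addr_ge0 ?sqr_ge0// mulr_ge0 ?sqr_ge0// ltW.
Qed.

Lemma dissipation_le_flux (alpha : R) (z : R -> R) : 0 <= alpha <= alpha_max mu nu wd c -> H1 z ->
  2 * alpha * energy mu nu wd c z + beta mu nu wd c alpha * (E1 wd c z + L2norm (wderiv z) ^+ 2)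
  <= 2 * flux nu wd (c ord0) (c (lift ord0 ord0)) z z.
Proof.
move=> /andP[a0 aM] Hz.
(* With a = 1 + c_i + w_d, the entry nu a / (nu + a mu) of [alpha_max] is at most a; this is the
   condition k <= c_i + b of [dissipation_ge] for k = 2 alpha and b = 1 + w_d. *)
have alpha_le i : 2 * alpha <= c i + (1 + wd).
  have ai0 : 0 < 1 + c i + wd by rewrite (lt_le_trans (hc i))// -addrA addrCA lerDl addr_ge0.
  have : 2 * alpha <= nu * (1 + c i + wd) / (nu + (1 + c i + wd) * mu).
    rewrite -ler_pdivlMl// (le_trans aM)// /alpha_max div1r ler_pM2l ?invr_gt0//.
    by rewrite (bigD1 i)//= ge_min lexx.
  move=> /le_trans; apply.
  rewrite ler_pdivrMr; last by rewrite addr_gt0// mulr_gt0.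
  have -> : c i + (1 + wd) = 1 + c i + wd by ring.
  move: (1 + c i + wd) ai0 => a /ltW ai0.
  by rewrite mulrDr (mulrC nu) lerDl !mulr_ge0// ltW.
have bE : beta mu nu wd c alpha <= 1 - 2 * alpha * (mu / nu).
  by rewrite /beta !big_ord_recl big_ord0 !ge_min lexx !orbT.
have bW : beta mu nu wd c alpha <= 2 * nu - 2 * alpha * (mu + 1).
  have -> : 2 * nu - 2 * alpha * (mu + 1) = 2 * (nu - alpha * (mu + 1)) by ring.
  by rewrite /beta !big_ord_recl big_ord0 !ge_min lexx !orbT.
have := @dissipation_ge R mu nu (1 + wd) (2 * alpha) (c ord0) (c (lift ord0 ord0)) (z 0) (z 1)
  (L2norm z ^+ 2) (L2norm (wderiv z) ^+ 2) (beta mu nu wd c alpha) mu0 nu0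
  (addr_ge0 ler01 wd0) (mulr_ge0 (ler0n _ 2) a0) (hc _) (hc _) (alpha_le _) (alpha_le _) bW bE
    (sqr_ge0 _)
  (poincare_trace (H1_is_primitive Hz)) _ (E1E wd c z).
by rewrite (flux_self nu wd (c ord0) (c (lift ord0 ord0)) Hz).
Qed.

(** Supplies the oscillation bound on the integrand that [increment_gronwall] asks for. *)
Lemma dissipation_lipschitz (B : R) : 0 <= B -> exists2 C, 0 <= C &
  forall v z : R -> R, H1 v -> H1 z -> H1size v <= B -> H1size z <= B ->
  `|(E1 wd c v + L2norm (wderiv v) ^+ 2) - (E1 wd c z + L2norm (wderiv z) ^+ 2)| <= C * H1size (v
    \- z).
Proof.
move=> B0; set c0 := c ord0; set c1 := c (lift ord0 ord0).
have B2 : 0 <= B + B by exact: addr_ge0.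
have BB : 0 <= B * B + B * B by rewrite addr_ge0 ?mulr_ge0.
have a0 i : 0 <= c i + (1 + wd) by rewrite !addr_ge0// ltW.
have e0 i : 0 <= 1 / (3 * c i) by rewrite divr_ge0// mulr_ge0// ltW.
pose k i := (c i + (1 + wd) + 1 / (3 * c i) * (B * B + B * B)) * (B + B).
have k0 i : 0 <= k i by rewrite /k mulr_ge0// addr_ge0// mulr_ge0.
exists (k ord0 + k (lift ord0 ord0) + (B + B)) => [|v z Hv Hz vB zB]; first by rewrite !addr_ge0.
set D := H1size (v \- z).
have Hd := H1B Hv Hz.
have tr i x : 0 <= x <= 1 ->
    `|(c i + (1 + wd) + 1 / (3 * c i) * v x ^+ 2) * v x ^+ 2 -
      (c i + (1 + wd) + 1 / (3 * c i) * z x ^+ 2) * z x ^+ 2| <= k i * D.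
  move=> x01.
  have vx := le_trans (sup_le_H1size Hv x01) vB; have zx := le_trans (sup_le_H1size Hz x01) zB.
  have dx : `|v x - z x| <= D := sup_le_H1size Hd x01.
  have -> : (c i + (1 + wd) + 1 / (3 * c i) * v x ^+ 2) * v x ^+ 2 -
      (c i + (1 + wd) + 1 / (3 * c i) * z x ^+ 2) * z x ^+ 2 =
    (c i + (1 + wd) + 1 / (3 * c i) * (v x * v x + z x * z x)) * (v x + z x) * (v x - z x) by ring.
  apply: normr_mul_le dx; apply: normr_mul_le; last by rewrite (le_trans (ler_normD _ _))// lerD.
  rewrite (le_trans (ler_normD _ _))// (ger0_norm (a0 i)) lerD2l normrM (ger0_norm (e0 i))
    ler_wpM2l//.
  by rewrite (le_trans (ler_normD _ _))// lerD// normr_mul_le.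
have gE : `|L2norm (wderiv v) ^+ 2 - L2norm (wderiv z) ^+ 2| <= (B + B) * D.
  have gv := le_trans (L2norm_wderiv_le_H1size v) vB.
  have gz := le_trans (L2norm_wderiv_le_H1size z) zB.
  have gd : `|L2norm (wderiv v) - L2norm (wderiv z)| <= D.
    apply: le_trans (ler_dist_L2norm (H1_L2_wderiv Hv) (H1_L2_wderiv Hz)) _.
    rewrite -L2norm_wderivB//; exact: L2norm_wderiv_le_H1size.
  move: (L2norm_ge0 (wderiv v)) (L2norm_ge0 (wderiv z)) gv gz gd.
  move: (L2norm (wderiv v)) (L2norm (wderiv z)) => x y x_0 y_0 xB yB xy.
  rewrite subr_sqr mulrC; apply: normr_mul_le xy.
  by rewrite ger0_norm ?addr_ge0// lerD.
have t0 := tr ord0 0 ltac:(by rewrite lexx ler01).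
have t1 := tr (lift ord0 ord0) 1 ltac:(by rewrite lexx ler01).
rewrite !E1E -/c0 -/c1.
have -> : forall x1 x2 x3 y1 y2 y3 : R, x1 + x2 + x3 - (y1 + y2 + y3) = (x1 - y1) + (x2 - y2) +
  (x3 - y3).
  by move=> *; ring.
rewrite (mulrDl (k ord0 + _)) (mulrDl (k ord0)).
exact: le_trans (ler_normD _ _) (lerD (le_trans (ler_normD _ _) (lerD t0 t1)) gE).
Qed.

Variables (T : R) (w wt : R -> R -> R) (m : R -> R).
Hypothesis T0 : 0 < T.
Hypothesis wH1 : forall t : R, 0 <= t -> H1 (w t).
Hypothesis wc : forall t : R, 0 <= t ->
  L2norm (w s \- w t) @[s --> within `[0, +oo[ (nbhs t)] --> (0 : R).
Hypothesis wwt : weak_time_deriv T w wt.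
Hypothesis m0 : forall t, 0 <= m t.
Hypothesis mm : measurable_fun `]0, T[ m.
Hypothesis im2 : leb.-integrable `]0, T[ (EFin \o (fun t => m t ^+ 2)).
Hypothesis wtm : {ae leb, forall t, `]0, T[%classic t ->
  [/\ H1 (wt t), L2norm (wt t) <= m t & L2norm (wderiv (wt t)) <= m t]}.
Hypothesis wf : {ae leb, forall t : R, 0 < t ->
  forall chi, H1 chi -> weak_form mu nu wd c (w t) (wt t) chi}.

Lemma energy_decay (alpha : R) : 0 <= alpha <= alpha_max mu nu wd c ->
  expR (2 * alpha * T) * energy mu nu wd c (w T) + beta mu nu wd c alpha *
    \int[leb]_(r in `[0, T]) (expR (2 * alpha * r) * (E1 wd c (w r) + L2norm (wderiv (w r)) ^+ 2))
  <= energy mu nu wd c (w 0).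
Proof.
move=> aM; have a0 : 0 <= 2 * alpha by case/andP: aM => a0 _; rewrite mulr_ge0.
have [B B0 wB] := @H1size_bounded R T w wt m wH1 wc wwt m0 mm im2 wtm.
have [CQ CQ0 QL] := dissipation_lipschitz B0.
have [C C0 wE] := @energy_increment_le R mu nu wd c mu0 nu0 wd0 hc T w wt m wH1 wc wwt m0 mm im2
  wtm wf.
pose J x := \int[leb]_(r in `]0, x[) m r.
pose M x := \int[leb]_(r in `]0, x[) (m r ^+ 2).
(* One function has to dominate both the error C (J + M) of the energy increment and the oscillation
   2 CQ J of [Q]. *)
pose K x := (C + 2 * CQ) * J x + C * M x.
have KE x y : K y - K x = C * (J y - J x) + C * (M y - M x) + 2 * CQ * (J y - J x).
  by rewrite /K; ring.
have JB x y : 0 <= x -> x <= y -> y <= T -> J y - J x = \int[leb]_(r in `]x, y[) m r.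
  move=> x0 xy yT; have im := @majorant_integrable_oo R T m mm im2 0 y (lexx 0) yT.
  by rewrite /J (Rintegral_oo_split x0 xy im) addrC addKr.
have MB x y : 0 <= x -> x <= y -> y <= T -> M y - M x = \int[leb]_(r in `]x, y[) (m r ^+ 2).
  move=> x0 xy yT.
  have im : leb.-integrable `]0, y[ (EFin \o (fun r => m r ^+ 2)).
    by apply: integrableS im2 => //; exact: subset_oo_0T.
  by rewrite /M (Rintegral_oo_split x0 xy im) addrC addKr.
have J0 x y : 0 <= x -> x <= y -> y <= T -> 0 <= J y - J x.
  by move=> x0 xy yT; rewrite JB// Rintegral_ge0.
have M0 x y : 0 <= x -> x <= y -> y <= T -> 0 <= M y - M x.
  by move=> x0 xy yT; rewrite MB// Rintegral_ge0// => r _; exact: sqr_ge0.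
pose Q x := E1 wd c (w x) + L2norm (wderiv (w x)) ^+ 2.
have QK x y : 0 <= x -> x <= y -> y <= T -> `|Q y - Q x| <= K y - K x.
  move=> x0 xy yT; have y0 := le_trans x0 xy.
  have h1 := mulr_ge0 C0 (J0 _ _ x0 xy yT); have h2 := mulr_ge0 C0 (M0 _ _ x0 xy yT).
  have h3 : `|Q y - Q x| <= 2 * CQ * (J y - J x).
    have := xy; rewrite le_eqVlt => /predU1P[->|xy'].
      by rewrite !subrr normr0 mulr0.
    apply: le_trans (QL _ _ (wH1 y0) (wH1 x0) (wB _ _) (wB _ _)) _.
    - by rewrite y0.
    - by rewrite x0 (le_trans xy).
    rewrite -mulrA mulrCA ler_wpM2l// JB//.
    exact: (@H1size_increment_le R T w wt m wH1 wc wwt m0 mm im2 wtm).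
  by rewrite KE (le_trans h3)// lerDr addr_ge0.
apply: (@increment_gronwall R _ _ T (fun x => energy mu nu wd c (w x)) Q K a0 (ltW T0)) => //.
- by move=> t; exact: energy_ge0.
move=> x y x0 xy yT; have y0 := le_trans x0 xy.
have := xy; rewrite le_eqVlt => /predU1P[->|xy'].
  by rewrite !subrr !mul0r oppr0 addr0.
apply: le_trans (wE _ _ x0 xy' yT) _.
have yx0 : 0 <= y - x by rewrite subr_ge0.
apply: lerD.
  rewrite lerN2 [leRHS]mulrAC [leRHS]mulrC; apply: ler_wpM2l => //.
  exact: dissipation_le_flux aM (wH1 x0).
rewrite -JB// -MB// mulrCA ler_wpM2l//.
by rewrite KE -mulrDr lerDl mulr_ge0 ?J0// mulr_ge0.
Qed.

End decay.

Section scaled_majorant.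
Context {R : realType}.
Local Notation leb := (@lebesgue_measure R).

(** The solution class controls mu w_t in H^1; dividing by mu > 0 gives one majorant for the norms
    of w_t and of its space derivative. *)
Lemma bochner_H1_scaled_majorant (mu T : R) (wt : R -> R -> R) : 0 < mu ->
  bochner_L2 H1 H1norm `]0, T[ (fun t x => mu * wt t x) ->
  exists m : R -> R, [/\ forall t, 0 <= m t, measurable_fun `]0, T[ m,
    leb.-integrable `]0, T[ (EFin \o (fun t => m t ^+ 2)) &
    {ae leb, forall t, `]0, T[%classic t ->
      [/\ H1 (wt t), L2norm (wt t) <= m t & L2norm (wderiv (wt t)) <= m t]}].
Proof.
move=> mu0 /(bochner_H1_majorant (measurable_itv _))[m [m0 mm im mP]].
exists (fun t => mu^-1 * m t); split.
- by move=> t; rewrite mulr_ge0// invr_ge0 ltW.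
- exact: measurable_funM.
- have := @integrableZl _ _ _ leb _ (measurable_itv _) (mu^-1 ^+ 2) _ im.
  by apply: eq_integrable => // t _ /=; rewrite exprMn.
- apply: leb_aeS mP => t h /h[Hu um].
  have wtE : wt t = (fun x => mu^-1 * (mu * wt t x)).
    by apply/funext => x; rewrite mulKf// gt_eqF.
  have i0 : 0 <= mu^-1 by rewrite invr_ge0 ltW.
  rewrite wtE; split; first exact: H1Z.
    rewrite (L2normZ _ (H1_L2 Hu)) (ger0_norm i0); apply: ler_wpM2l => //.
    exact: le_trans (L2norm_le_H1norm _) um.
  rewrite (L2norm_wderivZ _ Hu) (ger0_norm i0); apply: ler_wpM2l => //.
  exact: le_trans (L2norm_wderiv_le_H1norm _) um.
Qed.

End scaled_majorant.

Theorem lemma2p1 (R : realType) (mu nu wd : R) (c : 'I_2 -> R)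
    (hmu : 0 < mu) (hnu : 0 < nu) (hwd : 0 <= wd) (hc : forall i, 0 < c i)
    (w0 : R -> R) (hw0 : H1 w0)
    (w : R -> R -> R) (hw : weak_solution mu nu wd c w0 w)
    (alpha : R) (halpha : 0 <= alpha <= alpha_max mu nu wd c) :
  forall t : R, 0 < t ->
    L2norm (w t) ^+ 2 + mu * L2norm (wderiv (w t)) ^+ 2
      + mu / nu * E1 wd c (w t)
      + beta mu nu wd c alpha * expR (- (2 * alpha * t))
        * \int[@lebesgue_measure R]_(s in `[0, t])
            (expR (2 * alpha * s)
             * (E1 wd c (w s) + L2norm (wderiv (w s)) ^+ 2))
    <= expR (- (2 * alpha * t))
       * (L2norm w0 ^+ 2 + mu * L2norm (wderiv w0) ^+ 2
          + mu / nu * E1 wd c (w 0)).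
Proof.
move=> t t0; have [wH1 w00 wc [wt [wwt _ wtB wf]]] := hw.
(* The Bochner conditions are local in time, so the argument runs on ]0, t[ itself; [m] and the
   constants depend on t but do not survive in the conclusion. *)
have [m [m0 mm im2 wtm]] := bochner_H1_scaled_majorant hmu (wtB t t0).
have decay := @energy_decay R mu nu wd c hmu hnu hwd hc t w wt m t0 wH1 wc
  (wwt t t0) m0 mm im2 wtm wf alpha halpha.
have [n0 g0] := eq_H1norms w00.
rewrite -n0 -g0.
have := ler_wpM2l (expR_ge0 (- (2 * alpha * t))) decay.
by rewrite mulrDr mulrA -expRD addNr expR0 mul1r mulrA (mulrC _ (beta _ _ _ _ _)).
Qed.
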